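(* Let $f:{S_k}^n\to\mathbb{R}\cup\{+\infty\}$ be a $k$-submodular function represented by a (given) network $N$ with $\tilde m$ edges. The PIP-representation for the minimizer set of $f$ is obtained in $O(\mathrm{MF}(kn,\tilde m))$ time.
   Context: $\mathrm{MF}(n,m)$ denotes the time complexity of an algorithm for a maximum flow (and a minimum cut) in a network of $n$ vertices and $m$ edges; a standard max-flow algorithm is assumed, and $\mathrm{MF}(n,m)$ is assumed to be not less than $O(nm)$. $S_k=\{0,1,\dots,k\}$ is partially ordered by $a\preceq b$ iff $a\in\{0,b\}$; ${S_k}^n$ has the componentwise order $\preceq$. Define $x\sqcap y$, $x\sqcup y$ componentwise: if $x_i,y_i$ are comparable, $(x\sqcap y)_i=\min\{x_i,y_i\}$, $(x\sqcup y)_i=\max\{x_i,y_i\}$ (with respect to $\preceq$); otherwise both are $0$. $f$ is $k$-submodular if $f(x)+f(y)\ge f(x\sqcap y)+f(x\sqcup y)$ for all $x,y\in{S_k}^n$. Its minimizer set is the set of $x$ with $f(x)\le f(y)$ for all $y$; it is nonempty and closed under $\sqcap,\sqcup$. Networks. $N=(V,A,c)$ is a directed network with nonnegative edge capacity $c$, where $V$ consists of a source $s$, a sink $t$ and vertices $v_i^\alpha$, $i\in\{1,\dots,n\}$, $\alpha\in\{1,\dots,k\}$. Put $U_i=\{v_i^1,\dots,v_i^k\}$. An $(s,t)$-cut is $X\subseteq V$ with $s\in X$, $t\notin X$; it is legal if $|X\cap U_i|\le1$ for all $i$. $c(X)$ is the sum of capacities of all edges from $X$ to $V\setminus X$. For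 $x\in{S_k}^n$, $\psi(x)=\{s\}\cup\{v_i^{x_i}:x_i\ne0\}$. For an $(s,t)$-cut $X$, $\check X$ is obtained by removing the vertices in $X\cap U_i$ for every $i$ with $|X\cap U_i|\ge2$. $N$ represents $f$ if (NR1) there is a constant $K\in\mathbb{R}$ with $f(x)=c(\psi(x))+K$ for all $x\in{S_k}^n$, and (NR2) $c(\check X)\le c(X)$ for all $(s,t)$-cuts $X$. PIP-representation. A poset with inconsistent pairs (PIP) is a finite poset $(P,\le)$ with a symmetric relation $\smile$ such that (IC1) if $p\smile q$ there is no $r$ with $p\le r$, $q\le r$; (IC2) if $p'\le p$, $q'\le q$, $p'\smile q'$, then $p\smile q$. For a nonempty $M\subseteq{S_k}^n$ closed under $\sqcap,\sqcup$, the PIP-representation of $M$ is (up to isomorphism of PIPs) the PIP $(M^{\mathrm{ir}},\preceq,\smile)$, where $M^{\mathrm{ir}}$ is the set of join-irreducible elements of $M$ (not the minimum of $M$ and not a join in $M$ of other elements) and $x\smile y$ iff $x\vee y$ does not exist in ${S_k}^n$. Its consistent ideals (down-closed subsets containing no pair $x\smile y$), ordered by inclusion, are in isomorphism with $(M,\preceq)$.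
   Formalization: The formal theorem assumes the network has at least k edges: for f = 0 with no edges, the PIP has nk(k-1) inconsistent pairs, which cannot be written out in O(MF(kn,0)) time when MF(n,m) is only known to be at least of order nm. *)

(* Defs.v *)
From HB Require Import structures.
From mathcomp Require Import all_boot all_order all_algebra.
From mathcomp Require Import reals constructive_ereal.

Set Implicit Arguments.
Unset Strict Implicit.
Unset Printing Implicit Defensive.

Import Order.TTheory GRing.Theory Num.Theory.

Definition sle k (a b : 'I_k.+1) : bool := (a == ord0) || (a == b).

Definition smeet k (a b : 'I_k.+1) : 'I_k.+1 :=
  if sle a b then a else if sle b a then b else ord0.

Definition sjoin k (a b : 'I_k.+1) : 'I_k.+1 :=
  if sle a b then b else if sle b a then a else ord0.

Definition vec n k := {ffun 'I_n -> 'I_k.+1}.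

Definition vle n k (x y : vec n k) : bool := [forall i, sle (x i) (y i)].
Definition vmeet n k (x y : vec n k) : vec n k := [ffun i => smeet (x i) (y i)].
Definition vjoin n k (x y : vec n k) : vec n k := [ffun i => sjoin (x i) (y i)].

Definition k_submodular (R : realType) n k (f : vec n k -> \bar R) : Prop :=
  forall x y, (f (vmeet x y) + f (vjoin x y) <= f x + f y)%E.

Definition minimizers (R : realType) n k (f : vec n k -> \bar R) : {set vec n k} :=
  [set x | [forall y, (f x <= f y)%E]].

Record pip := Pip {
  pip_sort :> finType;
  ple : rel pip_sort;
  pinc : rel pip_sort;
  ple_refl : reflexive ple;
  ple_anti : antisymmetric ple;
  ple_trans : transitive ple;
  pinc_sym : symmetric pinc;
  pip_IC1 : forall p q, pinc p q -> ~ exists r, ple p r /\ ple q r;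
  pip_IC2 : forall p q p' q', ple p' p -> ple q' q -> pinc p' q' -> pinc p q
}.

(** z is the least upper bound of Y in the subposet M *)
Definition is_join n k (M Y : {set vec n k}) (z : vec n k) : bool :=
  [&& z \in M, [forall y in Y, vle y z]
    & [forall w in M, [forall y in Y, vle y w] ==> vle z w]].

Definition is_minimum n k (M : {set vec n k}) (x : vec n k) : bool :=
  (x \in M) && [forall y in M, vle x y].

Definition join_irreducibles n k (M : {set vec n k}) : {set vec n k} :=
  [set x in M | ~~ is_minimum M x &&
     ~~ [exists Y : {set vec n k}, (Y \subset M :\ x) && is_join M Y x]].

Definition vinc n k (x y : vec n k) : bool :=
  ~~ [exists z, is_join [set: vec n k] [set x; y] z].

Lemma sle_refl k : reflexive (@sle k).
Proof. by move=> a; rewrite /sle eqxx orbT. Qed.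

Lemma sle_anti k : antisymmetric (@sle k).
Proof.
by move=> a b /andP[/orP[/eqP-> | /eqP//] /orP[/eqP-> | /eqP->]].
Qed.

Lemma sle_trans k : transitive (@sle k).
Proof.
move=> b a c /orP[/eqP-> _ | /eqP->//]; by rewrite /sle eqxx.
Qed.

Lemma sle_joinP k (a b r : 'I_k.+1) : sle a r -> sle b r ->
  [/\ sle a (sjoin a b), sle b (sjoin a b)
    & forall c, sle a c -> sle b c -> sle (sjoin a b) c].
Proof.
move=> ar br; have cmp : sle a b \/ sle b a.
  case/orP: ar => [a0 | /eqP->]; last by right.
  by left; rewrite /sle a0.
rewrite /sjoin; case: ifP => [ab | ab]; first by rewrite ab sle_refl; split.
by case: cmp => [|ba]; rewrite ?ab // ba sle_refl; split.
Qed.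

Section VecOrder.
Variables n k : nat.
Implicit Types x y z : vec n k.

Lemma vle_refl : reflexive (@vle n k).
Proof. by move=> x; apply/forallP => i; apply: sle_refl. Qed.

Lemma vle_anti : antisymmetric (@vle n k).
Proof.
move=> x y /andP[/forallP xy /forallP yx]; apply/ffunP => i.
by apply: sle_anti; rewrite xy yx.
Qed.

Lemma vle_trans : transitive (@vle n k).
Proof.
move=> y x z /forallP xy /forallP yz; apply/forallP => i.
exact: sle_trans (xy i) (yz i).
Qed.

Lemma vinc_sym : symmetric (@vinc n k).
Proof. by move=> x y; rewrite /vinc setUC. Qed.

Lemma vincP x y : reflect (~ exists z, vle x z /\ vle y z) (vinc x y).
Proof.
apply: (iffP idP) => [/existsPn nj [r [/forallP xr /forallP yr]] | nub].
  move: (nj (vjoin x y)) => /negP; apply; apply/and3P; split.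
  - by rewrite inE.
  - apply/forall_inP => u /set2P[] ->; apply/forallP => i; rewrite ffunE.
      by case: (sle_joinP (xr i) (yr i)).
    by case: (sle_joinP (xr i) (yr i)).
  - apply/forall_inP => w _; apply/implyP => /forall_inP ub.
    have /forallP xw := ub x (set21 x y); have /forallP yw := ub y (set22 x y).
    apply/forallP => i; rewrite ffunE.
    by case: (sle_joinP (xr i) (yr i)) => _ _; apply.
apply/negP => /existsP[z /and3P[_ /forall_inP ub _]].
by apply: nub; exists z; split; apply: ub; rewrite !inE eqxx ?orbT.
Qed.

Lemma vinc_mono x y x' y' : vle x' x -> vle y' y -> vinc x' y' -> vinc x y.
Proof.
move=> xx yy /vincP nub; apply/vincP => -[z [xz yz]]; apply: nub.
by exists z; split; [apply: vle_trans xx xz | apply: vle_trans yy yz].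
Qed.

Variable M : {set vec n k}.
Let T := {x : vec n k | x \in join_irreducibles M}.

Definition pip_rep : pip.
Proof.
refine (@Pip T (fun p q => vle (val p) (val q)) (fun p q => vinc (val p) (val q))
  _ _ _ _ _ _).
- by move=> p; apply: vle_refl.
- by move=> p q pq; apply/val_inj/vle_anti.
- by move=> q p r; apply: vle_trans.
- by move=> p q; apply: vinc_sym.
- by move=> p q /vincP nub [r ub]; apply: nub; exists (val r).
- by move=> p q p' q'; apply: vinc_mono.
Defined.

End VecOrder.

Definition vertex (T : finType) : finType := option (option T).
Definition source {T : finType} : vertex T := None.
Definition sink {T : finType} : vertex T := Some None.
Definition inner {T : finType} (v : T) : vertex T := Some (Some v).

(** The arcs are listed in the order in which algorithms receive them.
    Infinite capacities are allowed, since represented functions may take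
    the value +oo. *)
Record network (R : realType) (T : finType) := Network {
  arcs : seq (vertex T * vertex T);
  cap : vertex T * vertex T -> \bar R;
  arcs_uniq : uniq arcs;
  cap_ge0 : forall e, e \in arcs -> (0 <= cap e)%E
}.

Section Networks.
Variables (R : realType) (T : finType) (N : network R T).

Definition finite_network : Prop := forall e, e \in arcs N -> cap N e \is a fin_num.

Definition st_cut (X : {set vertex T}) : bool := (source \in X) && (sink \notin X).

Definition cut_cap (X : {set vertex T}) : \bar R :=
  (\sum_(e <- arcs N | (e.1 \in X) && (e.2 \notin X)) cap N e)%E.

Definition min_cut (X : {set vertex T}) : Prop :=
  st_cut X /\ forall Y, st_cut Y -> (cut_cap X <= cut_cap Y)%E.

Local Open Scope ring_scope.

Definition is_flow (phi : vertex T * vertex T -> R) : Prop :=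
  (forall e, e \in arcs N -> 0 <= phi e /\ ((phi e)%:E <= cap N e)%E) /\
  (forall v : T, \sum_(e <- arcs N | e.2 == inner v) phi e =
                 \sum_(e <- arcs N | e.1 == inner v) phi e).

Definition flow_value (phi : vertex T * vertex T -> R) : R :=
  \sum_(e <- arcs N | e.1 == source) phi e - \sum_(e <- arcs N | e.2 == source) phi e.

Definition max_flow (phi : vertex T * vertex T -> R) : Prop :=
  is_flow phi /\ forall phi', is_flow phi' -> flow_value phi' <= flow_value phi.

End Networks.

(** [vtx i a] is the vertex of variable i and label a.+1, labels 1, ..., k being
    indexed by 'I_k. *)
Definition vtx n k (i : 'I_n) (a : 'I_k) : vertex ('I_n * 'I_k)%type := inner (i, a).

Definition U n k (i : 'I_n) : {set vertex ('I_n * 'I_k)%type} :=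
  [set vtx i a | a : 'I_k].

Definition psi n k (x : vec n k) : {set vertex ('I_n * 'I_k)%type} :=
  source |: [set vtx p.1 p.2 | p : 'I_n * 'I_k & x p.1 == lift ord0 p.2].

Definition legal_part n k (X : {set vertex ('I_n * 'I_k)%type}) :
    {set vertex ('I_n * 'I_k)%type} :=
  X :\: \bigcup_(i < n | 2 <= #|X :&: U k i|) (X :&: U k i).

Definition represents (R : realType) n k (N : network R ('I_n * 'I_k)%type)
    (f : vec n k -> \bar R) : Prop :=
  (exists K : R, forall x, f x = (cut_cap N (psi x) + K%:E)%E) /\
  (forall X, st_cut X -> (cut_cap N (legal_part X) <= cut_cap N X)%E).

(** A unit-cost real RAM, programmed in a while language.  The memory consists
    of countably many arrays of natural numbers and countably many arrays of
    reals, a program naming finitely many of them.  Evaluating any node of an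
    expression or executing any statement costs one time unit.  Natural numbers
    can only be added and subtracted, so that their bit length grows by at most
    a constant per time unit; reals admit the field operations and
    comparison, but cannot be converted to natural numbers. *)

Inductive nexp :=
  | NCst of nat
  | NGet of nat & nexp          (* NGet a e is entry e of array a *)
  | NAdd of nexp & nexp
  | NSub of nexp & nexp.        (* truncated *)

Inductive rexp :=
  | RZero
  | ROne
  | RGet of nat & nexp
  | RAdd of rexp & rexp
  | RSub of rexp & rexp
  | RMul of rexp & rexp
  | RDiv of rexp & rexp.        (* x / 0 = 0 *)

Inductive bexp :=
  | BNLe of nexp & nexp
  | BRLe of rexp & rexp
  | BNot of bexp
  | BAnd of bexp & bexp.

Inductive cmd :=
  | CSkip
  | CNSet of nat & nexp & nexp  (* CNSet a e1 e2 sets entry e1 of array a to e2 *)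
  | CRSet of nat & nexp & rexp
  | CSeq of cmd & cmd
  | CIf of bexp & cmd & cmd
  | CWhile of bexp & cmd.

Fixpoint ncost (e : nexp) : nat :=
  match e with
  | NCst _ => 1
  | NGet _ e1 => (ncost e1).+1
  | NAdd e1 e2 | NSub e1 e2 => (ncost e1 + ncost e2).+1
  end.

Fixpoint rcost (e : rexp) : nat :=
  match e with
  | RZero | ROne => 1
  | RGet _ e1 => (ncost e1).+1
  | RAdd e1 e2 | RSub e1 e2 | RMul e1 e2 | RDiv e1 e2 => (rcost e1 + rcost e2).+1
  end.

Fixpoint bcost (b : bexp) : nat :=
  match b with
  | BNLe e1 e2 => (ncost e1 + ncost e2).+1
  | BRLe e1 e2 => (rcost e1 + rcost e2).+1
  | BNot b1 => (bcost b1).+1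
  | BAnd b1 b2 => (bcost b1 + bcost b2).+1
  end.

Section Semantics.
Variable R : realType.

Record state := State { nmem : nat -> nat -> nat; rmem : nat -> nat -> R }.

Definition update (A : Type) (mem : nat -> nat -> A) (a j : nat) (v : A) :
    nat -> nat -> A :=
  fun a' j' => if (a' == a) && (j' == j) then v else mem a' j'.

Fixpoint neval (s : state) (e : nexp) : nat :=
  match e with
  | NCst c => c
  | NGet a e1 => nmem s a (neval s e1)
  | NAdd e1 e2 => neval s e1 + neval s e2
  | NSub e1 e2 => neval s e1 - neval s e2
  end.

Fixpoint reval (s : state) (e : rexp) : R :=
  match e with
  | RZero => 0%R
  | ROne => 1%R
  | RGet a e1 => rmem s a (neval s e1)
  | RAdd e1 e2 => (reval s e1 + reval s e2)%R
  | RSub e1 e2 => (reval s e1 - reval s e2)%R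
  | RMul e1 e2 => (reval s e1 * reval s e2)%R
  | RDiv e1 e2 => (reval s e1 / reval s e2)%R
  end.

Fixpoint beval (s : state) (b : bexp) : bool :=
  match b with
  | BNLe e1 e2 => neval s e1 <= neval s e2
  | BRLe e1 e2 => (reval s e1 <= reval s e2)%R
  | BNot b1 => ~~ beval s b1
  | BAnd b1 b2 => beval s b1 && beval s b2
  end.

(** [exec c s t s']: started in s, the program c halts after t time units in s' *)
Inductive exec : cmd -> state -> nat -> state -> Prop :=
  | ESkip s : exec CSkip s 1 s
  | ENSet s a e1 e2 :
      exec (CNSet a e1 e2) s (ncost e1 + ncost e2).+1
        (State (update (nmem s) a (neval s e1) (neval s e2)) (rmem s))
  | ERSet s a e1 e2 :
      exec (CRSet a e1 e2) s (ncost e1 + rcost e2).+1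
        (State (nmem s) (update (rmem s) a (neval s e1) (reval s e2)))
  | ESeq c1 c2 s t1 s1 t2 s2 :
      exec c1 s t1 s1 -> exec c2 s1 t2 s2 -> exec (CSeq c1 c2) s (t1 + t2).+1 s2
  | EIfT b c1 c2 s t s' :
      beval s b -> exec c1 s t s' -> exec (CIf b c1 c2) s (bcost b + t).+1 s'
  | EIfF b c1 c2 s t s' :
      ~~ beval s b -> exec c2 s t s' -> exec (CIf b c1 c2) s (bcost b + t).+1 s'
  | EWhileF b c s : ~~ beval s b -> exec (CWhile b c) s (bcost b).+1 s
  | EWhileT b c s t1 s1 t2 s2 :
      beval s b -> exec c s t1 s1 -> exec (CWhile b c) s1 t2 s2 ->
      exec (CWhile b c) s (bcost b + t1 + t2).+1 s2.

(** Vertices are numbered with the source first and the sink second. *)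
Definition vcode (T : finType) (num : T -> nat) (v : vertex T) : nat :=
  match v with
  | None => 0
  | Some None => 1
  | Some (Some u) => (num u).+2
  end.

(** Initial memory: the numerical parameters of the instance in natural array 0;
    for the j-th arc, its tail, its head and whether its capacity is infinite in
    entry j of natural arrays 1, 2 and 3, and its capacity, or 0 if infinite, in
    entry j of real array 0; all other entries are 0. *)
Definition input (T : finType) (num : T -> nat) (params : seq nat)
    (N : network R T) : state :=
  State
    (fun a j => match a with
      | 0 => nth 0 params j
      | 1 => nth 0 [seq vcode num e.1 | e <- arcs N] j
      | 2 => nth 0 [seq vcode num e.2 | e <- arcs N] j
      | 3 => nth 0 [seq nat_of_bool (cap N e == +oo%E) | e <- arcs N] j
      | _ => 0
      end)
    (fun a j => match a with
      | 0 => nth 0%R [seq fine (cap N e) | e <- arcs N] j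
      | _ => 0%R
      end).

Definition flow_input n (N : network R 'I_n) : state :=
  input (@nat_of_ord n) [:: n; size (arcs N)] N.

Definition pip_input n k (N : network R ('I_n * 'I_k)%type) : state :=
  input (fun u : 'I_n * 'I_k => u.1 * k + u.2) [:: k; n; size (arcs N)] N.

(** A maximum flow in real array 1 (indexed by arcs), and the indicator of a
    minimum cut in natural array 4 (indexed by vertices). *)
Definition flow_output n (N : network R 'I_n) (s : state) : Prop :=
  (exists2 phi, max_flow N phi &
     [seq rmem s 1 j | j <- iota 0 (size (arcs N))] = [seq phi e | e <- arcs N]) /\
  (exists2 X, min_cut N X &
     forall v, (v \in X) = (nmem s 4 (vcode (@nat_of_ord n) v) != 0)).

(** MF bounds the running time of the maximum flow program on finite networks
    with n vertices besides the terminals and m arcs. *)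
Definition solves_max_flow (maxflow : cmd) (MF : nat -> nat -> nat) : Prop :=
  forall n (N : network R 'I_n), finite_network N ->
  exists t s, [/\ exec maxflow (flow_input N) t s,
                  t <= MF n (size (arcs N)) & flow_output N s].

(** The pairs stored in the first len entries of arrays a and b are those of r. *)
Definition stores_rel (s : state) (len a b : nat) d (r : rel 'I_d) : Prop :=
  [seq (nmem s a j, nmem s b j) | j <- iota 0 len]
    =i [seq (val u.1, val u.2) | u in [pred u : 'I_d * 'I_d | r u.1 u.2]].

(** Natural array 0 holds the number of elements of P and the lengths of the
    lists of all pairs in the order (arrays 1 and 2) and of all inconsistent
    pairs (arrays 3 and 4), the elements being numbered arbitrarily; that is,
    the memory holds a PIP isomorphic to P. *)
Definition pip_output (P : pip) (s : state) : Prop :=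
  nmem s 0 0 = #|P| /\
  exists2 g : 'I_#|P| -> P, bijective g &
    stores_rel s (nmem s 0 1) 1 2 (fun p q => ple (g p) (g q)) /\
    stores_rel s (nmem s 0 2) 3 4 (fun p q => pinc (g p) (g q)).

End Semantics.

(* Main.v *)
Require Import Defs.
From mathcomp Require Import all_boot all_order all_algebra.
From mathcomp Require Import reals constructive_ereal zify ring lra.

Set Implicit Arguments.
Unset Strict Implicit.
Unset Printing Implicit Defensive.

Import Order.TTheory GRing.Theory Num.Theory.

#[local] Arguments update A mem a j v a' j' /.

(** Let phi be a maximum flow, infinite capacities having been replaced by a
    number [big_cap] that exceeds the sum of the finite ones.  The capacity of a
    cut is the value of phi plus the [slack] of the cut, which is nonnegative and
    vanishes exactly for the cuts closed under the residual arcs; some cut has no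
    slack, since a residual path from s to t would give a direction in which the
    flow increases.  So the minimum cuts are the closed cuts ([min_cutP]).  As the
    network represents f, the legal part of a minimum cut is again a minimum cut,
    and [psi] identifies the minimizers of f with the legal closed cuts
    ([minimizers_closed]).  If even a minimum cut contains an infinite arc, then f
    is constantly infinite, every vector is a minimizer, and the graph without
    arcs takes the place of the residual graph.

    The closed cuts are closed under union, so the join-irreducible minimizers are
    the legal ones among the least closed cuts [hull v] containing a vertex v; they
    are indexed by the strong components of the residual graph.  Legality needs to
    be tested at one block only: the legal part of [hull v] is closed, and if it
    still contains v, then it is all of [hull v].  The same argument shows that
    the elements of u and v are inconsistent if and only if u reaches a sibling of
    v, that is, another vertex of its block ([irr_inc]).

    The program therefore performs one maximum flow computation and one search of
    the residual graph from every vertex ([bfs_correct]), which takes time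
    O(kn * m) for m arcs and so is covered by the hypothesis on MF.  From the
    reachability matrix it selects the smallest vertex of each good strong
    component ([label_correct]), and it lists the pairs of both relations by going
    through the vertices reached from each selected vertex and their siblings
    ([out_correct]).  There are at most n + 1 reached vertices, and only one if no
    arc leaves the selected vertex; since there are at most 2 * m residual arcs,
    the lists are also completed in time O(kn * m).

    Running times are carried by the program logic: [wp c s T Q] says that c,
    started in s, halts within T steps in a state satisfying Q.  The maximum flow
    program is called with its arrays renamed ([exec_shift]), so that it finds a
    fresh memory and leaves the data of its caller alone. *)

(** * Reasoning about programs and their running time *)

Section Language.
Variable R : realType.
Implicit Types (s : state R) (c : cmd) (Q : state R -> Prop) (T : nat).

Definition setn s a i v : state R := State (update (nmem s) a i v) (rmem s).
Definition setr s a i v : state R := State (nmem s) (update (rmem s) a i v).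

Lemma nmem_setn s a i v a' i' :
  nmem (setn s a i v) a' i' = if (a' == a) && (i' == i) then v else nmem s a' i'.
Proof. by []. Qed.

Lemma nmem_setr s a i v a' i' : nmem (setr s a i v) a' i' = nmem s a' i'.
Proof. by []. Qed.

Lemma rmem_setn s a i v a' i' : rmem (setn s a i v) a' i' = rmem s a' i'.
Proof. by []. Qed.

Lemma rmem_setr s a i v a' i' :
  rmem (setr s a i v) a' i' = if (a' == a) && (i' == i) then v else rmem s a' i'.
Proof. by []. Qed.

(** Weakest precondition with a time budget T: since [exec] only relates halting
    runs, this asserts total correctness. *)
Definition wp c s T Q := exists t s', [/\ exec c s t s', t <= T & Q s'].

Lemma wp_weak c s T T' Q Q' :
  wp c s T Q -> T <= T' -> (forall s', Q s' -> Q' s') -> wp c s T' Q'.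
Proof.
by move=> [t [s' [ex tT Qs]]] TT QQ; exists t, s'; split; eauto; apply: leq_trans TT.
Qed.

Lemma wp_seq c1 c2 s T1 T2 T Q1 Q :
  wp c1 s T1 Q1 -> (forall s1, Q1 s1 -> wp c2 s1 T2 Q) -> T1 + T2 < T ->
  wp (CSeq c1 c2) s T Q.
Proof.
move=> [t1 [s1 [ex1 t1T Qs1]]] /(_ _ Qs1) [t2 [s2 [ex2 t2T Qs2]]] TT.
by exists (t1 + t2).+1, s2; split=> //; [apply: ESeq ex1 ex2 | lia].
Qed.

(** Loop-free code is executed symbolically: [srun] is its effect as a function
    and [scost] bounds its running time on all branches. *)
Fixpoint loopfree c :=
  match c with
  | CWhile _ _ => false
  | CSeq c1 c2 | CIf _ c1 c2 => loopfree c1 && loopfree c2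
  | _ => true
  end.

Fixpoint srun c s : state R :=
  match c with
  | CSkip => s
  | CNSet a e1 e2 => setn s a (neval s e1) (neval s e2)
  | CRSet a e1 e2 => setr s a (neval s e1) (reval s e2)
  | CSeq c1 c2 => srun c2 (srun c1 s)
  | CIf b c1 c2 => if beval s b then srun c1 s else srun c2 s
  | CWhile _ _ => s
  end.

Fixpoint scost c : nat :=
  match c with
  | CSkip => 1
  | CNSet _ e1 e2 => (ncost e1 + ncost e2).+1
  | CRSet _ e1 e2 => (ncost e1 + rcost e2).+1
  | CSeq c1 c2 => (scost c1 + scost c2).+1
  | CIf b c1 c2 => (bcost b + (scost c1 + scost c2)).+1
  | CWhile _ _ => 0
  end.

Lemma wp_loopfree c s T Q :
  loopfree c -> scost c <= T -> Q (srun c s) -> wp c s T Q.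
Proof.
move=> lf cT Qs; have [t ex tc] : exists2 t, exec c s t (srun c s) & t <= scost c.
  elim: c s lf {cT Qs} => //=.
  - by move=> s _; exists 1 => //; constructor.
  - by move=> a e1 e2 s _; eexists; [constructor|].
  - by move=> a e1 e2 s _; eexists; [constructor|].
  - move=> c1 IH1 c2 IH2 s /andP[/(IH1 s)[t1 e1 l1] /(IH2 (srun c1 s))[t2 e2 l2]].
    by exists (t1 + t2).+1; [apply: ESeq e1 e2 | lia].
  - move=> b c1 IH1 c2 IH2 s /andP[/(IH1 s)[t1 e1 l1] /(IH2 s)[t2 e2 l2]].
    case: ifPn => bs.
      by exists (bcost b + t1).+1; [apply: EIfT | lia].
    by exists (bcost b + t2).+1; [apply: EIfF | lia].
by exists t, (srun c s); split=> //; apply: leq_trans cT.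
Qed.

Lemma wp_if b c1 c2 s T Q :
  (beval s b -> wp c1 s T Q) -> (~~ beval s b -> wp c2 s T Q) ->
  wp (CIf b c1 c2) s (bcost b + T).+1 Q.
Proof.
case: (boolP (beval s b)) => bs H1 H2.
  have [t [s' [ex tT Qs]]] := H1 isT; exists (bcost b + t).+1, s'; split=> //.
    exact: EIfT.
  by lia.
have [t [s' [ex tT Qs]]] := H2 isT; exists (bcost b + t).+1, s'; split=> //.
  exact: EIfF.
by lia.
Qed.

Fixpoint nmod c : seq nat :=
  match c with
  | CNSet a _ _ => [:: a]
  | CSeq c1 c2 | CIf _ c1 c2 => nmod c1 ++ nmod c2
  | CWhile _ c1 => nmod c1
  | _ => [::]
  end.

Fixpoint rmod c : seq nat :=
  match c with
  | CRSet a _ _ => [:: a]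
  | CSeq c1 c2 | CIf _ c1 c2 => rmod c1 ++ rmod c2
  | CWhile _ c1 => rmod c1
  | _ => [::]
  end.

Definition nframe (mods : seq nat) s s' :=
  forall a i, a \notin mods -> nmem s' a i = nmem s a i.
Definition rframe (mods : seq nat) s s' :=
  forall a i, a \notin mods -> rmem s' a i = rmem s a i.

Lemma nframe_refl mods s : nframe mods s s.
Proof. by []. Qed.

Lemma nframe_trans mods s1 s2 s3 :
  nframe mods s1 s2 -> nframe mods s2 s3 -> nframe mods s1 s3.
Proof. by move=> f12 f23 a i aM; rewrite f23 // f12. Qed.

Lemma rframe_refl mods s : rframe mods s s.
Proof. by []. Qed.

Lemma rframe_trans mods s1 s2 s3 :
  rframe mods s1 s2 -> rframe mods s2 s3 -> rframe mods s1 s3.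
Proof. by move=> f12 f23 a i aM; rewrite f23 // f12. Qed.

Lemma nframe_sub (m1 m2 : seq nat) s s' :
  {subset m1 <= m2} -> nframe m1 s s' -> nframe m2 s s'.
Proof. by move=> sub f a i /(contra (sub a)); apply: f. Qed.

Lemma exec_frame c s t s' :
  exec c s t s' -> nframe (nmod c) s s' /\ rframe (rmod c) s s'.
Proof.
elim=> //=.
- move=> {}s a e1 e2; split=> // a' i; rewrite inE /= /update => /negPf -> //.
- move=> {}s a e1 e2; split=> // a' i; rewrite inE /= /update => /negPf -> //.
- move=> c1 c2 s0 t1 s1 t2 s2 _ [n1 r1] _ [n2 r2]; split=> a i;
    by rewrite mem_cat negb_or => /andP[a1 a2]; rewrite ?n2 ?r2 // ?n1 ?r1.
- by move=> b c1 c2 s0 t0 s1 _ _ [n1 r1]; split=> a i;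
    rewrite mem_cat negb_or => /andP[a1 a2]; rewrite ?n1 ?r1.
- by move=> b c1 c2 s0 t0 s1 _ _ [n1 r1]; split=> a i;
    rewrite mem_cat negb_or => /andP[a1 a2]; rewrite ?n1 ?r1.
- by move=> b c0 s0 t1 s1 t2 s2 _ _ [n1 r1] _ [n2 r2]; split=> a i aM;
    rewrite ?n2 ?r2 // ?n1 ?r1.
Qed.

Lemma wp_run c s Q : loopfree c -> Q (srun c s) -> wp c s (scost c) Q.
Proof. by move=> lf; apply: wp_loopfree. Qed.

(** The variants without a budget to compare with let unification assemble the
    total cost, which is then bounded once, at the end of a proof. *)
Lemma wp_seq_cost c1 c2 s T1 T2 Q1 Q :
  wp c1 s T1 Q1 -> (forall s1, Q1 s1 -> wp c2 s1 T2 Q) ->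
  wp (CSeq c1 c2) s (T1 + T2).+1 Q.
Proof. by move=> H1 H2; apply: wp_seq H1 H2 _. Qed.

(** Frames come for free from the syntax, so that specifications and invariants
    only have to speak of the arrays that a piece of code writes. *)
Lemma wp_frame c s T Q :
  wp c s T Q ->
  wp c s T (fun s' => [/\ Q s', nframe (nmod c) s s' & rframe (rmod c) s s']).
Proof.
move=> [t [s' [ex tT Qs]]]; have [nf rf] := exec_frame ex.
by exists t, s'; split.
Qed.

Lemma nframe_srun c s : loopfree c -> nframe (nmod c) s (srun c s).
Proof.
move=> lf; have [t [s' [ex _ ->]]] := wp_loopfree (Q := eq (srun c s)) lf (leqnn _) erefl.
by case: (exec_frame ex).
Qed.

Lemma rframe_srun c s : loopfree c -> rframe (rmod c) s (srun c s).
Proof.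
move=> lf; have [t [s' [ex _ ->]]] := wp_loopfree (Q := eq (srun c s)) lf (leqnn _) erefl.
by case: (exec_frame ex).
Qed.

(** The loop rule with a ghost potential [p]: every iteration is paid for by a
    decrease of the potential.  This is what makes amortised bounds possible. *)
Lemma wp_while b c (I : nat -> state R -> Prop) s T p :
  (forall p s1, I p s1 -> nframe (nmod c) s s1 -> rframe (rmod c) s s1 ->
     beval s1 b ->
     wp c s1 T (fun s2 => exists2 q, I q s2 & q < p)) ->
  I p s ->
  wp (CWhile b c) s (p * (T + bcost b).+1 + (bcost b).+1)
     (fun s' => exists q, I q s' /\ ~~ beval s' b).
Proof.
move=> body; have := @nframe_refl (nmod c) s; have := @rframe_refl (rmod c) s.
move: {2 4 5 6}s => s1; elim/ltn_ind: p s1 => p IH s1 rf nf Ip.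
case: (boolP (beval s1 b)) => bs.
  have [t1 [s2 [e1 t1T [q Iq qp]]]] := body _ _ Ip nf rf bs.
  have [nf2 rf2] := exec_frame e1.
  have [t2 [s3 [e2 t2T Is3]]] :=
    IH _ qp _ (rframe_trans rf rf2) (nframe_trans nf nf2) Iq.
  exists (bcost b + t1 + t2).+1, s3; split=> //; first exact: EWhileT e1 e2.
  by have := leq_mul2r (T + bcost b).+1 q.+1 p; rewrite qp orbT mulSn; lia.
exists (bcost b).+1, s1; split; [exact: EWhileF | lia | by exists p].
Qed.

Definition get x := NGet x (NCst 0).
Definition assign x e := CNSet x (NCst 0) e.

Definition for_loop x e c :=
  CSeq (assign x (NCst 0))
    (CWhile (BNLe (NAdd (get x) (NCst 1)) e)
       (CSeq c (assign x (NAdd (get x) (NCst 1))))).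

Definition for_overhead e := ncost e + 20.

(** The invariant is told the number of completed iterations, and the stability
    hypothesis forbids it to read the cell of the counter. *)
Lemma wp_for x e c (I : nat -> state R -> Prop) (cost : nat -> nat) N s T :
  x \notin nmod c ->
  (forall j s1 v, I j s1 -> I j (setn s1 x 0 v)) ->
  (forall j s1, I j s1 -> nframe (x :: nmod c) s s1 -> neval s1 e = N) ->
  I 0 s ->
  (forall j s1, j < N -> I j s1 -> nframe (x :: nmod c) s s1 ->
     rframe (rmod c) s s1 -> nmem s1 x 0 = j -> wp c s1 (cost j) (I j.+1)) ->
  \sum_(j < N) (cost j + for_overhead e) + for_overhead e <= T ->
  wp (for_loop x e c) s T (I N).
Proof.
move=> xc stable eN I0 body leT.
have loop M j s1 : M = N - j -> j <= N -> I j s1 -> nframe (x :: nmod c) s s1 ->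
    rframe (rmod c) s s1 -> nmem s1 x 0 = j ->
    wp (CWhile (BNLe (NAdd (get x) (NCst 1)) e)
         (CSeq c (assign x (NAdd (get x) (NCst 1))))) s1
      (\sum_(j <= i < N) (cost i + for_overhead e) + (ncost e + 5).+1) (I N).
  elim: M j s1 => [|M IH] j s1 MN jN Ij nf rf xj.
    have -> : j = N by lia.
    exists (ncost e + 5).+1, s1; split=> //; last first.
    - by have <- : j = N by lia.
    - by rewrite leq_addl.
      have -> : (ncost e + 5).+1 = (bcost (BNLe (NAdd (get x) (NCst 1)) e)).+1.
        by rewrite /=; lia.
      apply: EWhileF => /=.
      by rewrite (eN _ _ Ij nf) /= xj; lia.
  have jN' : j < N by lia.
  have [t1 [s2 [e1 t1T Is2]]] := body _ _ jN' Ij nf rf xj.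
  have [nf2 rf2] := exec_frame e1.
  pose s3 := setn s2 x 0 j.+1.
  have sub : {subset nmod c <= x :: nmod c} by move=> a ac; rewrite inE ac orbT.
  have nf3 : nframe (x :: nmod c) s s3.
    apply: nframe_trans nf _; apply: nframe_trans (nframe_sub sub nf2) _.
    by move=> a i; rewrite inE negb_or nmem_setn => /andP[/negPf-> _].
  have [] // := IH j.+1 s3.
  - by lia.
  - exact: stable.
  - by apply: rframe_trans rf _ => a i ac; rewrite /s3 rmem_setn rf2.
  - by rewrite /s3 nmem_setn !eqxx.
  move=> t2 [s4 [e2 t2T Is4]].
  exists ((ncost e + 5) + (t1 + 6).+1 + t2).+1, s4; split=> //.
    have -> : ncost e + 5 = bcost (BNLe (NAdd (get x) (NCst 1)) e) by rewrite /=; lia.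
    apply: EWhileT e2 => /=; first by rewrite (eN _ _ Ij nf) /= xj; lia.
    apply: ESeq e1 _.
    have := ENSet s2 x (NCst 0) (NAdd (get x) (NCst 1)).
    by rewrite /= (nf2 x 0 xc) xj (addn1 j).
  move: t2T; rewrite [X in _ -> _ < X + _]big_ltn // /for_overhead; lia.
pose s1 := setn s x 0 0.
have [] // := loop (N - 0) 0 s1.
- exact: stable.
- by move=> a i; rewrite inE negb_or nmem_setn => /andP[/negPf-> _].
- by rewrite /s1 nmem_setn !eqxx.
move=> t [s2 [e2 t2T Is2]]; exists (3 + t).+1, s2; split=> //.
  by apply: ESeq e2; apply: (ENSet s x (NCst 0) (NCst 0)).
by move: t2T leT; rewrite /for_overhead big_mkord; lia.
Qed.

Lemma wp_for_const x e c (I : nat -> state R -> Prop) K N s T :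
  x \notin nmod c ->
  (forall j s1 v, I j s1 -> I j (setn s1 x 0 v)) ->
  (forall j s1, I j s1 -> nframe (x :: nmod c) s s1 -> neval s1 e = N) ->
  I 0 s ->
  (forall j s1, j < N -> I j s1 -> nframe (x :: nmod c) s s1 ->
     rframe (rmod c) s s1 -> nmem s1 x 0 = j -> wp c s1 K (I j.+1)) ->
  N.+1 * (K + for_overhead e) <= T ->
  wp (for_loop x e c) s T (I N).
Proof.
move=> xc stable eN I0 body leT; apply: (wp_for (cost := fun=> K)) => //.
by rewrite sum_nat_const card_ord; move: leT; rewrite mulSn; lia.
Qed.

(** * Running a program in arrays of its own *)

(** Renaming the arrays makes room for the data that has to survive a call. *)
Fixpoint nshift D (e : nexp) : nexp :=
  match e with
  | NCst c => NCst c
  | NGet a e1 => NGet (D + a) (nshift D e1)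
  | NAdd e1 e2 => NAdd (nshift D e1) (nshift D e2)
  | NSub e1 e2 => NSub (nshift D e1) (nshift D e2)
  end.

Fixpoint rshift_exp D (e : rexp) : rexp :=
  match e with
  | RZero => RZero
  | ROne => ROne
  | RGet a e1 => RGet (D + a) (nshift D e1)
  | RAdd e1 e2 => RAdd (rshift_exp D e1) (rshift_exp D e2)
  | RSub e1 e2 => RSub (rshift_exp D e1) (rshift_exp D e2)
  | RMul e1 e2 => RMul (rshift_exp D e1) (rshift_exp D e2)
  | RDiv e1 e2 => RDiv (rshift_exp D e1) (rshift_exp D e2)
  end.

Fixpoint bshift D (b : bexp) : bexp :=
  match b with
  | BNLe e1 e2 => BNLe (nshift D e1) (nshift D e2)
  | BRLe e1 e2 => BRLe (rshift_exp D e1) (rshift_exp D e2)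
  | BNot b1 => BNot (bshift D b1)
  | BAnd b1 b2 => BAnd (bshift D b1) (bshift D b2)
  end.

Fixpoint cshift D (c : cmd) : cmd :=
  match c with
  | CSkip => CSkip
  | CNSet a e1 e2 => CNSet (D + a) (nshift D e1) (nshift D e2)
  | CRSet a e1 e2 => CRSet (D + a) (nshift D e1) (rshift_exp D e2)
  | CSeq c1 c2 => CSeq (cshift D c1) (cshift D c2)
  | CIf b c1 c2 => CIf (bshift D b) (cshift D c1) (cshift D c2)
  | CWhile b c1 => CWhile (bshift D b) (cshift D c1)
  end.

Definition simulates D s S :=
  (forall a i, nmem S (D + a) i = nmem s a i) /\
  (forall a i, rmem S (D + a) i = rmem s a i).

Lemma ncost_shift D e : ncost (nshift D e) = ncost e.
Proof. by elim: e => //= [a e ->|e1 -> e2 ->|e1 -> e2 ->]. Qed.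

Lemma rcost_shift D e : rcost (rshift_exp D e) = rcost e.
Proof.
by elim: e => //= [a e|e1 -> e2 ->|e1 -> e2 ->|e1 -> e2 ->|e1 -> e2 ->] //;
  rewrite ncost_shift.
Qed.

Lemma bcost_shift D b : bcost (bshift D b) = bcost b.
Proof.
by elim: b => //= [e1 e2|e1 e2|b ->|b1 -> b2 ->] //;
  rewrite ?ncost_shift ?rcost_shift.
Qed.

Section Simulation.
Variables (D : nat) (s S : state R).
Hypothesis sim : simulates D s S.

Lemma neval_shift e : neval S (nshift D e) = neval s e.
Proof.
by elim: e => //= [a e ->|e1 -> e2 ->|e1 -> e2 ->] //; rewrite sim.1.
Qed.

Lemma reval_shift e : reval S (rshift_exp D e) = reval s e.
Proof.
elim: e => //= [a e|e1 -> e2 ->|e1 -> e2 ->|e1 -> e2 ->|e1 -> e2 ->] //.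
by rewrite neval_shift sim.2.
Qed.

Lemma beval_shift b : beval S (bshift D b) = beval s b.
Proof.
by elim: b => //= [e1 e2|e1 e2|b ->|b1 -> b2 ->] //;
  rewrite ?neval_shift ?reval_shift.
Qed.
End Simulation.

(** The memory of an execution is only accessed through the arrays that the
    program names, so a copy of the initial memory in the arrays from D on is all
    that the renamed program needs, whatever the arrays below D contain. *)
Lemma exec_shift D c s t s' S :
  exec c s t s' -> simulates D s S ->
  exists2 S', exec (cshift D c) S t S' & simulates D s' S'.
Proof.
move=> ex; elim: ex S => /=.
- by move=> {}s S sim; exists S => //; constructor.
- move=> {}s a e1 e2 S sim.
  exists (setn S (D + a) (neval s e1) (neval s e2)).
    rewrite -(neval_shift sim) -(neval_shift sim e2).
    by rewrite -(ncost_shift D) -(ncost_shift D e2); constructor.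
  split=> a' i; last by rewrite rmem_setn sim.2.
  by rewrite nmem_setn eqn_add2l /= /update sim.1.
- move=> {}s a e1 e2 S sim.
  exists (setr S (D + a) (neval s e1) (reval s e2)).
    rewrite -(neval_shift sim) -(reval_shift sim e2).
    by rewrite -(ncost_shift D) -(rcost_shift D e2); constructor.
  split=> a' i; first by rewrite nmem_setr sim.1.
  by rewrite rmem_setr eqn_add2l /= /update sim.2.
- move=> c1 c2 s0 t1 s1 t2 s2 _ IH1 _ IH2 S /IH1[S1 e1 /IH2[S2 e2 sim2]].
  by exists S2 => //; apply: ESeq e1 e2.
- move=> b c1 c2 s0 t0 s1 bs _ IH S sim; have [S1 e1 sim1] := IH _ sim.
  exists S1 => //; rewrite -(bcost_shift D); apply: EIfT e1.
  by rewrite (beval_shift sim).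
- move=> b c1 c2 s0 t0 s1 bs _ IH S sim; have [S1 e1 sim1] := IH _ sim.
  exists S1 => //; rewrite -(bcost_shift D); apply: EIfF e1.
  by rewrite (beval_shift sim).
- move=> b c0 s0 bs S sim; exists S => //; rewrite -(bcost_shift D).
  by apply: EWhileF; rewrite (beval_shift sim).
- move=> b c0 s0 t1 s1 t2 s2 bs _ IH1 _ IH2 S sim.
  have [S1 e1 /IH2[S2 e2 sim2]] := IH1 _ sim.
  exists S2 => //; rewrite -(bcost_shift D); apply: EWhileT e1 e2.
  by rewrite (beval_shift sim).
Qed.

Lemma nmod_shift D c a : a < D -> a \notin nmod (cshift D c).
Proof.
move=> aD; elim: c => //= [a0 e1 e2|c1 I1 c2 I2|b c1 I1 c2 I2].
- by rewrite inE; apply/eqP; lia.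
- by rewrite mem_cat negb_or I1.
- by rewrite mem_cat negb_or I1.
Qed.

Lemma rmod_shift D c a : a < D -> a \notin rmod (cshift D c).
Proof.
move=> aD; elim: c => //= [a0 e1 e2|c1 I1 c2 I2|b c1 I1 c2 I2].
- by rewrite inE; apply/eqP; lia.
- by rewrite mem_cat negb_or I1.
- by rewrite mem_cat negb_or I1.
Qed.

End Language.

(** * Graph search *)

Infix ";;" := CSeq (at level 90, right associativity).
Infix ":+:" := NAdd (at level 50, left associativity).
Infix ":-:" := NSub (at level 50, left associativity).
Infix ":<=:" := BNLe (at level 70).
Coercion NCst : nat >-> nexp.

(** Adjacency lists: [arr_head u] is the first cell of the list of u, cell e holds
    the target [arr_target e] and is followed by [arr_next e], and 0 ends the list. *)
Notation arr_head := 11 (only parsing).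
Notation arr_next := 12 (only parsing).
Notation arr_target := 13 (only parsing).
(** Row v of the reachability matrix and the list of the vertices reached from v,
    both starting at entry v * L. *)
Notation arr_mark := 14 (only parsing).
Notation arr_queue := 15 (only parsing).
Notation var_v := 20 (only parsing).
Notation var_cell := 21 (only parsing).
Notation var_qhead := 22 (only parsing).
Notation var_qtail := 23 (only parsing).
Notation var_base := 24 (only parsing).
Notation var_w := 25 (only parsing).

(** One flat loop scans the adjacency lists of the queued vertices, so that a
    single potential accounts for all of its steps. *)
Definition bfs_guard := BNot (BAnd (get var_cell :<=: 0) (get var_qtail :<=: get var_qhead)).

Definition bfs_step :=
  CIf (1 :<=: get var_cell)
    (assign var_w (NGet arr_target (get var_cell)) ;;
     assign var_cell (NGet arr_next (get var_cell)) ;;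
     CIf (NGet arr_mark (get var_base :+: get var_w) :<=: 0)
       (CNSet arr_mark (get var_base :+: get var_w) 1 ;;
        CNSet arr_queue (get var_base :+: get var_qtail) (get var_w) ;;
        assign var_qtail (get var_qtail :+: 1))
       CSkip)
    (assign var_cell (NGet arr_head (NGet arr_queue (get var_base :+: get var_qhead))) ;;
     assign var_qhead (get var_qhead :+: 1)).

Definition bfs_init :=
  CNSet arr_mark (get var_base :+: get var_v) 1 ;;
  CNSet arr_queue (get var_base) (get var_v) ;;
  assign var_qhead 0 ;; assign var_qtail 1 ;; assign var_cell 0.

Definition bfs := bfs_init ;; CWhile bfs_guard bfs_step.


Section Search.
Variable R : realType.
Implicit Types (s : state R).

(** The list l is stored in the cells from e on; all of its cells have a number
    at most B, so that it survives the creation of cells with larger numbers. *)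
Fixpoint chain s B e (l : seq nat) : Prop :=
  if l is w :: l' then
    [/\ 0 < e, e <= B, nmem s arr_target e = w & chain s B (nmem s arr_next e) l']
  else e = 0.

Lemma eq_chain s s' B e l :
  (forall i, i <= B -> nmem s' arr_target i = nmem s arr_target i /\ nmem s' arr_next i = nmem s arr_next i) ->
  chain s B e l -> chain s' B e l.
Proof.
move=> eqs; elim: l e => //= w l IH e [e0 eB tw ch].
by have [-> ->] := eqs _ eB; split=> //; apply: IH.
Qed.

Lemma chain_widen s B B' e l : B <= B' -> chain s B e l -> chain s B' e l.
Proof.
move=> BB; elim: l e => //= w l IH e [e0 eB tw ch].
by split=> //; [apply: leq_trans BB | apply: IH].
Qed.

(** The vertices reachable from u are described as the least set that contains u
    and is closed under arcs, which is what a search computes. *)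
Variables (L : nat) (adj : nat -> seq nat) (reach : rel nat).
Hypothesis reach_lt : forall u w, reach u w -> w < L.
Hypothesis reach_refl : forall u, u < L -> reach u u.
Hypothesis reach_step : forall u w x, reach u w -> x \in adj w -> reach u x.
Hypothesis reach_least : forall (C : pred nat) u w,
  (forall a b, C a -> b \in adj a -> C b) -> C u -> reach u w -> C w.

Definition adjacency s B := forall u, u < L -> chain s B (nmem s arr_head u) (adj u).

Definition reach_row s v (q : seq nat) :=
  [/\ uniq q, forall i, i < size q -> nmem s arr_queue (v * L + i) = nth 0 q i,
      forall w, w < L -> (nmem s arr_mark (v * L + w) != 0) = (w \in q)
    & q =i reach v].

Definition narcs := \sum_(u < L) size (adj u).

(** Applied to the vertices already expanded, this bounds the number of arcs
    scanned during a search by the number of all arcs. *)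
Lemma sum_uniq_le (q : seq nat) (F : nat -> nat) :
  uniq q -> all (gtn L) q -> \sum_(u <- q) F u <= \sum_(u < L) F u.
Proof.
move=> uq /allP qL; rewrite -(big_mkord xpredT) /index_iota subn0.
have -> : \sum_(u <- q) F u = \sum_(u <- iota 0 L | u \in q) F u.
  rewrite -[RHS]big_filter; apply: perm_big; apply: uniq_perm => //.
    exact/filter_uniq/iota_uniq.
  by move=> u; rewrite mem_filter mem_iota add0n /=; case: (boolP (u \in q)) => //= /qL /= ->.
by rewrite [leqRHS](bigID (mem q)) /= leq_addr.
Qed.

(** The ghost state of the search: the queue q, of which the first d vertices
    have been expanded, and the rest l of the adjacency list being scanned.
    The potential p counts two steps for each arc that is still to be scanned
    and one for each vertex waiting in the queue. *)
Definition bfs_inv v B s0 p s := exists (q : seq nat) (d : nat) (l : seq nat),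
  [/\ [/\ uniq q, all (gtn L) q & d <= size q],
      [/\ nmem s var_qtail 0 = size q, nmem s var_qhead 0 = d & chain s B (nmem s var_cell 0) l],
      [/\ forall i, i < size q -> nmem s arr_queue (v * L + i) = nth 0 q i,
          forall w, w < L -> (nmem s arr_mark (v * L + w) != 0) = (w \in q),
          forall i, i < v * L \/ v * L + L <= i -> nmem s arr_mark i = nmem s0 arr_mark i
        & forall i, i < v * L \/ v * L + L <= i -> nmem s arr_queue i = nmem s0 arr_queue i],
      [/\ v \in q, forall u x : nat, u \in take d q -> x \in adj u -> (x \in q) || (x \in l),
          forall u : nat, u \in q -> reach v u & forall u : nat, u \in l -> reach v u]
    & 2 * size l + 2 * narcs + size q
        <= p + 2 * (\sum_(u <- take d q) size (adj u)) + d].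

(** The vertices expanded so far have all of their arcs either leading into the
    queue or still pending in l; the loop ends with l empty and d = size q, when
    the queue is closed under arcs and hence contains everything reachable. *)
Lemma bfs_inv_step v B s0 p s :
  v < L -> nmem s0 var_base 0 = v * L -> adjacency s0 B ->
  bfs_inv v B s0 p s -> nframe (nmod bfs_step) s0 s -> beval s bfs_guard ->
  exists2 p', bfs_inv v B s0 p' (srun bfs_step s) & p' < p.
Proof.
move=> vL base0 adjs [q [d [l [[uq qL dq] [qt qh ch] [qQ qM oM oQ] [vq clo rq rl] pot]]]].
move=> fr; have base : nmem s var_base 0 = v * L by rewrite fr.
have done_le : \sum_(u <- take d q) size (adj u) <= narcs.
  apply: sum_uniq_le; first exact: take_uniq.
  by apply/allP => u /mem_take; apply: (allP qL).
case: l => [|w l] in ch clo rl pot *.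
  rewrite /= in ch; rewrite /bfs_guard /bfs_step /= ch qt qh /= -ltnNge => dltq.
  exists p.-1; last by rewrite /= in pot; lia.
  set u := nth 0 q d; have uq' : u \in q by apply: mem_nth.
  have uL : u < L by apply: (allP qL).
  exists q, d.+1, (adj u); rewrite /=; rewrite base (qQ _ dltq) -/u.
  split=> //.
  - split=> //; first by rewrite addn1.
    rewrite (fr arr_head) //.
    by apply: eq_chain (adjs _ uL) => i _; rewrite /=; split; rewrite fr.
  - split=> // [x y|x]; rewrite ?(take_nth 0 dltq) ?mem_rcons ?inE.
      by case/orP => [/eqP->->|xt /(clo _ _ xt)]; rewrite ?orbT // in_nil orbF => ->.
    by apply: reach_step; apply: rq.
  - rewrite (take_nth 0 dltq) -cats1 big_cat big_seq1 /= -/u.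
    have : \sum_(u <- take d.+1 q) size (adj u) <= narcs.
      apply: sum_uniq_le; first exact: take_uniq.
      by apply/allP => x /mem_take; apply: (allP qL).
    rewrite (take_nth 0 dltq) -cats1 big_cat big_seq1 /= -/u.
    by rewrite /= in pot; lia.
rewrite /= in ch; case: ch => e0 eB tw ch _.
have wL : w < L by apply: reach_lt (rl _ (mem_head _ _)).
have rw : reach v w by apply: rl; rewrite mem_head.
exists p.-1; last by rewrite /= in pot; lia.
rewrite /bfs_step /= e0; rewrite /=; rewrite base tw.
have -> : (nmem s arr_mark (v * L + w) <= 0) = (w \notin q).
  by rewrite -(qM _ wL) leqn0 negbK.
case: (boolP (w \in q)) => wq /=; last first.
  exists (rcons q w), d, l; rewrite size_rcons; rewrite /=; rewrite qt.
  have szq : size q < L.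
    have := @sum_uniq_le (rcons q w) (fun=> 1); rewrite sum1_size size_rcons.
    rewrite sum_nat_const card_ord muln1; apply.
      by rewrite rcons_uniq wq.
    by rewrite all_rcons /= wL.
  have tq : take d (rcons q w) = take d q by rewrite -cats1 takel_cat.
  split=> //.
  - by rewrite rcons_uniq wq all_rcons /= wL; split=> //; lia.
  - split=> //; first by rewrite addn1.
    by apply: eq_chain ch => i _; rewrite /=.
  - split=> [i|x xL|i oi|i oi]; rewrite /=.
    + by rewrite eqn_add2l nth_rcons ltnS leq_eqVlt; case: eqVneq => [->|_ /= iq];
        rewrite ?ltnn // iq; apply: qQ.
    + by rewrite eqn_add2l mem_rcons inE; case: (eqVneq x w) => //= _; apply: qM.
    + by case: (eqVneq i _) => [|_]; [lia | apply: oM].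
    + by case: (eqVneq i _) => [|_]; [lia | apply: oQ].
  - split=> [|u x ut xu|u|u ul]; rewrite ?mem_rcons ?inE ?vq ?orbT //.
    + by rewrite tq in ut; have := clo _ _ ut xu; rewrite inE orbA [_ || (x == w)]orbC.
    + by case/orP => [/eqP->|/rq].
    + by apply: rl; rewrite inE ul orbT.
  - by rewrite tq; rewrite /= in pot; lia.
exists q, d, l; rewrite /=; split=> //.
- split=> //; first by apply: eq_chain ch => i _; rewrite /=.
- split=> // [u x ut xu|u ul].
    by have := clo _ _ ut xu; rewrite inE => /or3P[->|/eqP->|->]; rewrite ?wq ?orbT.
  by apply: rl; rewrite inE ul orbT.
- by rewrite /= in pot; lia.
Qed.

Lemma bfs_correct v B s :
  v < L -> nmem s var_base 0 = v * L -> nmem s var_v 0 = v -> adjacency s B ->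
  (forall w, w < L -> nmem s arr_mark (v * L + w) = 0) ->
  wp bfs s (scost bfs_init + (narcs.*2.+2 * (scost bfs_step + bcost bfs_guard).+1) + 1)
    (fun s' => exists q : seq nat, [/\ reach_row s' v q, nmem s' var_qtail 0 = size q,
       forall i, i < v * L \/ v * L + L <= i -> nmem s' arr_mark i = nmem s arr_mark i
     & forall i, i < v * L \/ v * L + L <= i -> nmem s' arr_queue i = nmem s arr_queue i]).
Proof.
move=> vL base vv adjs m0.
apply: (wp_seq (Q1 := fun s1 => s1 = srun bfs_init s) (T1 := scost bfs_init)
    (T2 := narcs.*2.+2 * (scost bfs_step + bcost bfs_guard).+1)).
- exact: wp_loopfree.
- move=> s1 ->; set s1' := srun _ _.
  apply: (wp_weak (wp_while (I := bfs_inv v B s) (T := scost bfs_step)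
           (p := narcs.*2.+1) _ _)).
  + move=> p s2 inv fr _ gd; apply: wp_loopfree => //.
    have fr2 : nframe (nmod bfs_step) s s2.
      apply: nframe_trans fr; apply: nframe_sub (nframe_srun _ _) => //.
      by apply/allP.
    exact: bfs_inv_step gd.
  + exists [:: v], 0, [::]; rewrite /s1' /=; split=> //.
    * by rewrite vL.
    * split=> [[|i] // _|w wL|i oi|i oi].
      - by rewrite addn0 base eqxx.
      - by rewrite base vv eqn_add2l inE; case: (eqVneq w v) => //= _; rewrite m0.
      - by rewrite base vv; case: (eqVneq i _) => [|//]; lia.
      - by rewrite base; case: (eqVneq i _) => [|//]; lia.
    * by split=> // [|u]; rewrite inE ?eqxx // => /eqP->; apply: reach_refl.
    * by rewrite big_nil; lia.
  + by rewrite [leqRHS]mulSn; lia.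
  + move=> s2 [p [[q [d [l [[uq qL dq] [qt qh ch] [qQ qM oM oQ] [vq clo rq rl] _]]]]]].
    rewrite /= negbK => /andP[]; rewrite leqn0 => /eqP e0; rewrite qt qh => qd.
    have {ch e0} l0 : l = [::] by case: l ch {clo rl} => //= w l []; rewrite e0.
    subst l; exists q; split=> //; split=> // w; apply/idP/idP; first exact: rq.
    apply: (@reach_least (mem q) v w) => // a b aq ba; rewrite /= in aq *.
    have := clo a b; rewrite take_oversize // => /(_ aq ba).
    by rewrite in_nil orbF.
- by rewrite addn1.
Qed.
End Search.

(** * Finding the elements of the poset *)

(** [arr_len v] is the length of the list of the vertices reached from v,
    [arr_row v] is v * L, [arr_block v] is the least number in the block of v, and
    [arr_id v] is 0 unless v represents an element of the poset, which then has
    index [arr_id v] - 1. *)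
Notation var_k := 0 (only parsing).
Notation var_j := 6 (only parsing).
Notation var_L := 8 (only parsing).
Notation arr_len := 16 (only parsing).
Notation arr_row := 17 (only parsing).
Notation arr_block := 18 (only parsing).
Notation arr_id := 19 (only parsing).
Notation var_ok := 26 (only parsing).
Notation var_pos := 27 (only parsing).
Notation var_count := 28 (only parsing).

(** The counter [var_pos] is the position of v in its block; it replaces a division,
    which the machine lacks. *)
Definition label_pre :=
  CNSet arr_len (get var_v) (get var_qtail) ;;
  CNSet arr_block (get var_v) (get var_v :-: get var_pos) ;;
  CIf (2 :<=: get var_v)
    (assign var_pos (get var_pos :+: 1) ;; CIf (get var_k :<=: get var_pos) (assign var_pos 0) CSkip)
    CSkip ;;
  CIf (BAnd (2 :<=: get var_v)
        (BAnd (NGet arr_mark (get var_base :+: 1) :<=: 0) (NGet arr_mark (get var_v) :<=: 0)))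
    (assign var_ok 1) (assign var_ok 0).

Definition label_sib_body :=
  assign var_w (NGet arr_block (get var_v) :+: get var_j) ;;
  CIf (BAnd (BNot (BAnd (get var_w :<=: get var_v) (get var_v :<=: get var_w)))
        (BNot (BAnd (NGet arr_mark (get var_base :+: get var_w) :<=: 0)
                    (NGet arr_mark (get var_w) :<=: 0))))
    (assign var_ok 0) CSkip.

(** The rows of smaller vertices are complete when v is treated, so a look at
    the rows of the vertices reached from v tells whether v is the least vertex of
    its strong component. *)
Definition label_rep_body :=
  assign var_w (NGet arr_queue (get var_base :+: get var_j)) ;;
  CIf (BAnd (get var_w :+: 1 :<=: get var_v) (1 :<=: NGet arr_mark (NGet arr_row (get var_w) :+: get var_v)))
    (assign var_ok 0) CSkip.

Definition label_post :=
  CIf (1 :<=: get var_ok)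
    (assign var_count (get var_count :+: 1) ;; CNSet arr_id (get var_v) (get var_count)) CSkip ;;
  assign var_base (get var_base :+: get var_L).

Definition label_body :=
  CNSet arr_row (get var_v) (get var_base) ;;
  bfs ;;
  label_pre ;;
  for_loop var_j (get var_k) label_sib_body ;;
  for_loop var_j (NGet arr_len (get var_v)) label_rep_body ;;
  label_post.

Definition label := for_loop var_v (get var_L) label_body.

Section Label.
Variable R : realType.
Implicit Types (s : state R).
Variables (L k n : nat) (adj : nat -> seq nat) (reach : rel nat).
Hypothesis L_eq : L = 2 + n * k.
Hypothesis reach_lt : forall u w, reach u w -> w < L.
Hypothesis reach_refl : forall u, u < L -> reach u u.
Hypothesis reach_step : forall u w x, reach u w -> x \in adj w -> reach u x.
Hypothesis reach_least : forall (C : pred nat) u w,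
  (forall a b, C a -> b \in adj a -> C b) -> C u -> reach u w -> C w.

(** The numbers 0 and 1 belong to the source and the sink; the other vertices
    follow in n blocks of length k. *)
Definition block_pos v := (v - 2) %% k.
Definition block_start v := v - block_pos v.

(** One block suffices: if the least closed set containing v and the source meets
    a block twice, then it contains the sink or another vertex of the block of v. *)
Definition good v :=
  [&& 2 <= v, ~~ reach v 1, ~~ reach 0 v
    & all (fun b => (block_start v + b == v) ||
             ~~ reach v (block_start v + b) && ~~ reach 0 (block_start v + b))
        (iota 0 k)].

(** Strongly connected vertices stand for the same element of the poset; the one
    with the smallest number represents it. *)
Definition selected v :=
  good v && all (fun u => ~~ (reach v u && reach u v)) (iota 0 v).

Definition elt_index v := count selected (iota 0 v).
Definition elt_id v := if selected v then (elt_index v).+1 else 0.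

Lemma block_startD v b : 2 <= v < L -> b < k -> block_start v + b < L.
Proof.
move=> /andP[v2 vL] bk; rewrite /block_start /block_pos.
have e := divn_eq (v - 2) k; have rk : (v - 2) %% k < k by rewrite ltn_mod; lia.
have : (v - 2) %/ k < n by rewrite ltn_divLR; lia.
move: rk; set r := _ %% k in e *; set d := _ %/ k in e * => rk dn.
have : d.+1 * k <= n * k by rewrite leq_mul2r dn orbT.
rewrite mulSn; lia.
Qed.

Lemma block_posS v : 2 <= v < L ->
  block_pos v.+1 = if k <= (block_pos v).+1 then 0 else (block_pos v).+1.
Proof.
move=> /andP[v2 vL]; rewrite /block_pos; have k0 : 0 < k by case: (k) L_eq; lia.
have -> : v.+1 - 2 = (v - 2).+1 by lia.
have rk : (v - 2) %% k < k by rewrite ltn_mod.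
rewrite -addn1 -modnDml addn1; case: leqP => kr; last by rewrite modn_small.
by have -> : ((v - 2) %% k).+1 = k by [lia]; rewrite modnn.
Qed.

(** Every vertex reached from v, except v, is the target of an arc; hence the
    list of v is scanned within the time that it took to compute. *)
Lemma size_reach_le v (q : seq nat) :
  v < L -> uniq q -> q =i reach v -> size q <= (narcs L adj).+1.
Proof.
move=> vL uq qr; pose l := v :: flatten [seq adj u | u <- iota 0 L].
have -> : (narcs L adj).+1 = size l.
  rewrite /= size_flatten /shape -map_comp sumnE big_map /narcs.
  by rewrite -(big_mkord xpredT (fun u => size (adj u))) /index_iota subn0.
apply: uniq_leq_size => // w; rewrite qr => rvw.
pose C := [pred w | reach v w && (w \in l)]; suff /andP[] : C w by [].
apply: (@reach_least C v w) => // [a b /andP[rva _] ba | ]; last first.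
  by rewrite /C /= reach_refl //= mem_head.
rewrite /C /= (reach_step rva ba) inE /=; apply/orP; right.
apply/flattenP; exists (adj a) => //; apply: map_f.
by rewrite mem_iota add0n (reach_lt rva).
Qed.

Lemma size_reach_ltL v (q : seq nat) : uniq q -> q =i reach v -> size q <= L.
Proof.
move=> uq qr; rewrite -[X in _ <= X](size_iota 0); apply: uniq_leq_size => // w.
by rewrite qr mem_iota add0n; apply: reach_lt.
Qed.

Definition rows s j :=
  [/\ forall u, u < j -> exists2 q : seq nat, reach_row L reach s u q & nmem s arr_len u = size q,
      forall u, u < j -> nmem s arr_row u = u * L
    & forall u, u < j -> nmem s arr_block u = block_start u].

(** The marks of later rows are still 0, which is what their searches start
    from; the matrix is never cleared. *)
Definition label_inv j s :=
  [/\ rows s j,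
      forall u, nmem s arr_id u = if u < j then elt_id u else 0,
      forall i, j * L <= i -> nmem s arr_mark i = 0,
      nmem s var_base 0 = j * L
    & nmem s var_count 0 = elt_index j /\ nmem s var_pos 0 = block_pos j].

Lemma label_sib_correct (c0 : bool) s v :
  v < L -> (c0 -> 2 <= v) -> nmem s var_k 0 = k -> nmem s var_v 0 = v -> nmem s var_base 0 = v * L ->
  nmem s arr_block v = block_start v -> nmem s var_ok 0 = nat_of_bool c0 ->
  (forall w, w < L -> (nmem s arr_mark (v * L + w) != 0) = reach v w) ->
  (forall w, w < L -> (nmem s arr_mark w != 0) = reach 0 w) ->
  wp (for_loop var_j (get var_k) label_sib_body) s
    (k.+1 * (scost label_sib_body + for_overhead (get var_k)))
    (fun s' => nmem s' var_ok 0 = c0 && all (fun b => (block_start v + b == v) ||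
             ~~ reach v (block_start v + b) && ~~ reach 0 (block_start v + b))
        (iota 0 k) :> nat).
Proof.
move=> vL c0v k0 vv base bs ok mv m0.
apply: (wp_for_const (N := k) (K := scost label_sib_body)
  (I := fun j s' => nmem s' var_ok 0 = c0 && all (fun b => (block_start v + b == v) ||
             ~~ reach v (block_start v + b) && ~~ reach 0 (block_start v + b))
        (iota 0 j) :> nat)) => //.
- by move=> j s1 _ fr; rewrite -k0 -(fr var_k).
- by rewrite andbT.
- move=> j s1 jk okj fr _ jj; apply: wp_loopfree => //.
  have [c0F | /c0v v2] : c0 = false \/ c0 by case: (c0); [right | left].
    by rewrite /label_sib_body /=; case: ifP => _; rewrite /= ?okj ?c0F.
  have wL : block_start v + j < L by apply: block_startD; rewrite ?v2.
  rewrite -[X in iota 0 X]addn1 iotaD all_cat andbA.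
  move: okj; set c1 := c0 && all _ (iota 0 j) => okj.
  rewrite /label_sib_body /= ?(fr arr_block, fr var_v, fr var_base, fr arr_mark) // vv jj base bs.
  rewrite -?(leqn0 (nmem s arr_mark _)) -mv // -m0 // !negbK andbT -eqn_leq.
  rewrite add0n !leqn0.
  by case: eqVneq => _; case: eqVneq => _; case: eqVneq => _; rewrite /= ?okj ?andbT ?andbF.
Qed.

Lemma label_rep_correct (c0 : bool) (q : seq nat) s v T :
  v < L -> nmem s var_v 0 = v -> nmem s var_base 0 = v * L -> nmem s arr_len v = size q ->
  nmem s var_ok 0 = nat_of_bool c0 -> q =i reach v ->
  (forall i, i < size q -> nmem s arr_queue (v * L + i) = nth 0 q i) ->
  (forall u, u < v -> nmem s arr_row u = u * L) ->
  (forall u, u < v -> (nmem s arr_mark (u * L + v) != 0) = reach u v) ->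
  (size q).+1 * (scost label_rep_body + for_overhead (NGet arr_len (get var_v))) <= T ->
  wp (for_loop var_j (NGet arr_len (get var_v)) label_rep_body) s T
    (fun s' => nmem s' var_ok 0 =
       c0 && all (fun u => ~~ (reach v u && reach u v)) (iota 0 v) :> nat).
Proof.
move=> vL vv base len ok qr qQ rb mu leT.
have -> : all (fun u => ~~ (reach v u && reach u v)) (iota 0 v) =
    all (fun u => ~~ ((u < v) && reach u v)) (take (size q) q).
  rewrite take_size; apply/allP/allP => H u.
    move=> uq; apply/negP => /andP[uv ruv]; have := H u; rewrite mem_iota add0n uv ruv andbT.
    move=> /(_ isT) /negP; apply; move: uq; rewrite qr andbT => h; exact: h.
  rewrite mem_iota => /= uv; apply/negP => /andP[rvu ruv].
  by have := H u; rewrite qr uv ruv => /(_ rvu).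
apply: (wp_for_const (N := size q) (K := scost label_rep_body)
  (I := fun j s' => nmem s' var_ok 0 =
     c0 && all (fun u => ~~ ((u < v) && reach u v)) (take j q) :> nat)) => //.
- by move=> j s1 _ fr; rewrite /= (fr var_v) // vv (fr arr_len) // len.
- by rewrite take0 andbT.
- move=> j s1 jq okj fr _ jj; apply: wp_loopfree => //.
  rewrite (take_nth 0) // all_rcons [_ && all _ _]andbC andbA.
  move: okj; set c1 := c0 && all _ (take j q) => okj.
  rewrite /label_rep_body /= ?(fr arr_row, fr var_v, fr var_base, fr arr_mark, fr arr_queue) // vv jj base qQ //.
  set u := nth 0 q j; rewrite addn1.
  case: (ltnP u v) => uv; last by rewrite /= ?okj ?andbT ?andbF.
  rewrite rb // -mu // -lt0n /=.
  by case: (posnP (nmem s arr_mark _)) => _; rewrite /= ?okj ?andbT ?andbF.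
Qed.

Lemma label_body_correct s0 B j s :
  nmem s0 var_k 0 = k -> nmem s0 var_L 0 = L -> adjacency L adj s0 B ->
  j < L -> label_inv j s -> nframe (var_v :: nmod label_body) s0 s -> nmem s var_v 0 = j ->
  wp label_body s (3000 * ((narcs L adj) + k + 1)) (label_inv j.+1).
Proof.
move=> k0 L0 adj0 jL [[rq rb rbs] iid mz base [cnt rr]] fr vj.
pose s1 := srun (CNSet arr_row (get var_v) (get var_base)) s.
have adj1 : adjacency L adj s1 B.
  move=> u uL; rewrite /s1 /= (fr arr_head) //.
  by apply: eq_chain (adj0 _ uL) => i _ /=; split; rewrite fr.
apply: (wp_weak (Q := label_inv j.+1) (wp_seq_cost (Q1 := fun s' => s' = s1) _ _)).
- exact: wp_run.
- move=> _ ->; apply: wp_seq_cost.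
    apply: wp_frame.
    apply: (bfs_correct (v := j) (s := s1) reach_lt reach_refl reach_step
      reach_least jL _ _ adj1) => //.
    by move=> w wL; rewrite /s1 /= mz //; lia.
  move=> s2 [[q [rowq qt oM oQ]] fr2 _].
  apply: (wp_seq_cost (Q1 := fun s' => s' = srun label_pre s2)).
    exact: wp_run.
  move=> _ ->; set s3 := srun _ _.
  have fr3 : nframe (nmod label_pre) s2 s3 by apply: nframe_srun.
  have [uq qQ qM qr] := rowq.
  have v2 : nmem s2 var_v 0 = j by rewrite fr2 // /s1 /= vj.
  have b2 : nmem s2 var_base 0 = j * L by rewrite fr2 // /s1 /= base.
  have k2 : nmem s2 var_k 0 = k by rewrite fr2 // /s1 /= fr // k0.
  have r2 : nmem s2 var_pos 0 = block_pos j by rewrite fr2 // /s1 /= rr.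
  have [L2 old_row] : 2 <= L /\ forall u w, u < j -> w < L -> u * L + w < j * L.
    split=> [|u w uj wL]; first by lia.
    have : u.+1 * L <= j * L by rewrite leq_mul2r uj orbT.
    by rewrite mulSn; lia.
  have mark_old u w : u < j -> w < L -> (nmem s2 arr_mark (u * L + w) != 0) = reach u w.
    move=> uj wL; rewrite oM; last by left; apply: old_row.
    by have [q' [_ _ qM' qr'] _] := rq _ uj; rewrite /s1 /= qM' // qr'.
  have facts : [/\ forall i, nmem s3 arr_len i = if i == j then size q else nmem s arr_len i,
      forall i, nmem s3 arr_block i = if i == j then block_start j else nmem s arr_block i,
      nmem s3 var_pos 0 = block_pos j.+1
    & nmem s3 var_ok 0 = [&& 2 <= j, ~~ reach j 1 & ~~ reach 0 j] :> nat].
    have mj : 2 <= j -> (nmem s2 arr_mark j == 0) = ~~ reach 0 j.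
      by move=> j2; rewrite -(mark_old 0 j) ?negbK //; lia.
    have m1 : (nmem s2 arr_mark (j * L + 1) == 0) = ~~ reach j 1.
      by rewrite -[reach j 1]qr -qM // negbK.
    have posS := @block_posS j; rewrite jL andbT in posS.
    have len2 i : nmem s2 arr_len i = nmem s arr_len i by rewrite fr2 // /s1.
    have bs2 i : nmem s2 arr_block i = nmem s arr_block i by rewrite fr2 // /s1.
    case: (ltnP 1 j) => [j2|j1] /=; last first.
      have j2F : (2 <= j) = false by lia.
      rewrite /s3 /label_pre /= v2 j2F /= ?v2 j2F /=.
      split=> [i|i||//] /=; rewrite ?len2 ?bs2 ?r2 ?qt //.
      by rewrite /block_pos; have [-> ->] : j - 2 = 0 /\ j.+1 - 2 = 0 by lia.
    rewrite posS // /s3 /label_pre /= v2 j2 /= r2 addn1 k2 -mj // -m1.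
    by case: (leqP k) => kr /=; rewrite v2 j2 b2 !leqn0 /=; case: (_ && _) => /=;
      split=> [i|i||//] /=; rewrite ?len2 ?bs2 ?qt.
  have [len3 bs3 rr3 ok3] := facts.
  have rb3 u : nmem s3 arr_row u = if u == j then j * L else nmem s arr_row u.
    by rewrite fr3 // fr2 // /s1 /= vj base.
  have row3 u : u < j.+1 -> exists2 q : seq nat, reach_row L reach s3 u q & nmem s3 arr_len u = size q.
    rewrite ltnS leq_eqVlt len3; case: eqVneq => [-> _ | _ /= uj].
      by exists q => //; split=> // [i iq|w wL]; rewrite fr3 // ?qQ ?qM.
    have [q' [uq' qQ' qM' qr'] len'] := rq _ uj; exists q' => //; split=> // [i iq|w wL].
      rewrite fr3 // oQ ?/s1 /= ?qQ' //; left; apply: old_row => //.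
      exact: leq_trans iq (size_reach_ltL uq' qr').
    by rewrite fr3 // mark_old // qr'.
  apply: wp_seq_cost.
    apply: wp_frame; apply: (label_sib_correct (v := j) _ _ _ _ _ _ ok3) => //.
    - by case/and3P.
    - by rewrite fr3.
    - by rewrite fr3.
    - by rewrite fr3.
    - by rewrite bs3 eqxx.
    - by move=> w wL; rewrite fr3 // qM // qr.
    - move=> w wL; rewrite fr3 //; case: (posnP j) => [j0 | j0].
        by have := qM _ wL; rewrite qr j0.
      by have := mark_old 0 w j0 wL; rewrite mul0n.
  move=> s4 [ok4 fr4 _].
  apply: (wp_seq_cost (T1 := (narcs L adj).+2 *
           (scost label_rep_body + for_overhead (NGet arr_len (get var_v))))).
    apply: wp_frame.
    apply: (label_rep_correct (v := j) (q := q) _ _ _ _ ok4 qr) => //.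
    - by rewrite fr4 // fr3.
    - by rewrite fr4 // fr3.
    - by rewrite fr4 // len3 eqxx.
    - by move=> i iq; rewrite fr4 // fr3 // qQ.
    - by move=> u uj; rewrite fr4 // rb3 ltn_eqF // rb.
    - by move=> u uj; rewrite fr4 // fr3 // mark_old.
    - by rewrite leq_mul2r ltnS (size_reach_le jL uq qr) orbT.
  move=> s5 [ok5 fr5 _].
  apply: wp_run => //.
  have fr35 : nframe [:: var_j; var_w; var_ok] s3 s5.
    apply: nframe_trans (nframe_sub _ fr4) (nframe_sub _ fr5).
      by apply/allP.
    by apply/allP.
  set s6 := srun _ _.
  have fr6 : nframe [:: var_base; var_count; arr_id] s5 s6.
    by apply: nframe_sub (nframe_srun s5 _); [apply/allP | ].
  have ok5' : nmem s5 var_ok 0 = selected j.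
    by rewrite ok5 /selected /good !andbA.
  have v5 : nmem s5 var_v 0 = j by rewrite fr35 // fr3.
  have b5 : nmem s5 var_base 0 = j * L by rewrite fr35 // fr3.
  have L5 : nmem s5 var_L 0 = L by rewrite fr35 // fr3 // fr2 // /s1 /= fr.
  have c5 : nmem s5 var_count 0 = elt_index j by rewrite fr35 // fr3 // fr2.
  have i5 u : nmem s5 arr_id u = if u < j then elt_id u else 0.
    by rewrite fr35 // fr3 // fr2 // /s1 /= iid.
  have s6E : [/\ nmem s6 var_base 0 = j.+1 * L, nmem s6 var_count 0 = elt_index j.+1
      & forall u, nmem s6 arr_id u = if u < j.+1 then elt_id u else 0].
    rewrite /elt_index -[X in iota 0 X]addn1 iotaD count_cat /= add0n addn0 -/(elt_index j).
    rewrite /s6 /label_post /= ok5'.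
    have i5' u : u != j -> nmem s5 arr_id u = if u < j.+1 then elt_id u else 0.
      by rewrite i5 ltnS [u <= j]leq_eqVlt => /negPf ->.
    case: (boolP (selected j)) => sj /=; rewrite ?v5 c5 ?b5 ?L5.
      split=> [||u]; rewrite ?mulSn 1?[L + _]addnC //.
      case: eqVneq => [->|/i5'//]; rewrite ltnS leqnn /elt_id sj.
      by rewrite addn1.
    split=> [||u]; rewrite ?mulSn ?addn0 1?[L + _]addnC //=.
    case: (eqVneq u j) => [->|/i5'//]; rewrite i5 ltnn ltnS leqnn /elt_id.
    by rewrite (negPf sj).
  have [b6 c6 i6] := s6E.
  split=> //.
  - split=> u uj.
    + have [q' [uq' qQ' qM' qr'] len'] := row3 _ uj.
      exists q'; last by rewrite fr6 // fr35.
      by split=> // [i iq|w wL]; rewrite fr6 // fr35 // ?qQ' ?qM'.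
    + rewrite fr6 // fr35 // rb3; case: eqVneq => [->//|uj'].
      by rewrite rb //; lia.
    + rewrite fr6 // fr35 // bs3; case: eqVneq => [->//|uj'].
      by rewrite rbs //; lia.
  - move=> i ij; rewrite fr6 // fr35 // fr3 // oM ?/s1 /= ?mz //; first by lia.
    by right; rewrite mulSn in ij; lia.
  - by split=> //; rewrite fr6 // fr35.
- rewrite /for_overhead /=. lia.
- by [].
Qed.

Lemma label_correct B s :
  nmem s var_k 0 = k -> nmem s var_L 0 = L -> adjacency L adj s B ->
  nmem s var_base 0 = 0 -> nmem s var_count 0 = 0 -> nmem s var_pos 0 = 0 ->
  (forall u, nmem s arr_id u = 0) -> (forall i, nmem s arr_mark i = 0) ->
  wp label s (L.+1 * (3000 * (narcs L adj + k + 1) + for_overhead (get var_L)))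
    (label_inv L).
Proof.
move=> k0 L0 adj0 b0 c0 r0 id0 m0.
apply: (wp_for_const (N := L) (K := 3000 * (narcs L adj + k + 1)) (I := label_inv)) => //.
- by move=> j s1 _ fr; rewrite /= fr.
- split=> //.
  by rewrite c0 r0 /block_pos mod0n.
- by move=> j s1 jL inv fr _ vj; apply: label_body_correct k0 L0 adj0 jL inv fr vj.
Qed.
End Label.

(** * Listing the pairs of the two relations *)

Notation var_i := 5 (only parsing).
Notation var_ords := 29 (only parsing).
Notation var_incs := 30 (only parsing).
Notation var_x := 31 (only parsing).

Definition emit a b c x y :=
  CNSet a (get c) x ;; CNSet b (get c) y ;; assign c (get c :+: 1).

Definition out_inc_body :=
  assign var_x (NGet arr_block (get var_w) :+: get var_j) ;;
  CIf (BAnd (1 :<=: NGet arr_id (get var_x)) (BNot (BAnd (get var_x :<=: get var_w) (get var_w :<=: get var_x))))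
    (emit 3 4 var_incs (NGet arr_id (get var_x) :-: 1) (NGet arr_id (get var_v) :-: 1)) CSkip.

Definition out_ord_step :=
  assign var_w (NGet arr_queue (NGet arr_row (get var_v) :+: get var_i)) ;;
  CIf (1 :<=: NGet arr_id (get var_w))
    (emit 1 2 var_ords (NGet arr_id (get var_w) :-: 1) (NGet arr_id (get var_v) :-: 1)) CSkip.

Definition out_reached :=
  out_ord_step ;;
  CIf (2 :<=: get var_w) (for_loop var_j (get var_k) out_inc_body) CSkip.

Definition out_body :=
  CIf (1 :<=: NGet arr_id (get var_v)) (for_loop var_i (NGet arr_len (get var_v)) out_reached) CSkip.

Definition out := for_loop var_v (get var_L) out_body.

Section Stored.
Variable R : realType.
Implicit Types (s : state R) (P : nat * nat -> Prop).

(** Only membership is specified, since repetitions in the lists are harmless. *)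
Definition stored s a b c P := exists l : seq (nat * nat),
  [/\ nmem s c 0 = size l,
      forall i, i < size l -> (nmem s a i, nmem s b i) = nth (0, 0) l i
    & forall p, p \in l <-> P p].

Lemma eq_stored s a b c P P' :
  (forall p, P p <-> P' p) -> stored s a b c P -> stored s a b c P'.
Proof.
by move=> PP [l [sz nl lP]]; exists l; split=> // p; rewrite lP PP.
Qed.

Lemma stored_nframe mods s s' a b c P :
  nframe mods s s' -> a \notin mods -> b \notin mods -> c \notin mods ->
  stored s a b c P -> stored s' a b c P.
Proof.
move=> fr aM bM cM [l [sz nl lP]]; exists l; split=> //; first by rewrite fr.
by move=> i il; rewrite !fr // nl.
Qed.

Lemma stored_emit s s' a b c P x y :
  stored s a b c P ->
  nmem s' c 0 = (nmem s c 0).+1 ->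
  (forall i, nmem s' a i = if i == nmem s c 0 then x else nmem s a i) ->
  (forall i, nmem s' b i = if i == nmem s c 0 then y else nmem s b i) ->
  stored s' a b c (fun p => P p \/ p = (x, y)).
Proof.
move=> [l [sz nl lP]] c' a' b'; exists (rcons l (x, y)).
rewrite size_rcons c' sz; split=> // [i|p].
  rewrite ltnS leq_eqVlt a' b' sz nth_rcons; case: eqVneq => [-> _|_ /= il].
    by rewrite ltnn.
  by rewrite il nl.
rewrite mem_rcons inE; split=> [/orP[/eqP|/lP]|[/lP|]]; auto.
  by move=> ->; rewrite orbT.
by move=> ->; rewrite eqxx.
Qed.
End Stored.

Section Out.
Variable R : realType.
Implicit Types (s : state R) (P : nat * nat -> Prop).
Variables (L k n : nat) (adj : nat -> seq nat) (reach : rel nat).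
Hypothesis L_eq : L = 2 + n * k.
Hypothesis reach_lt : forall u w, reach u w -> w < L.
Hypothesis reach_least : forall (C : pred nat) u w,
  (forall a b, C a -> b \in adj a -> C b) -> C u -> reach u w -> C w.
Hypothesis good_size : forall v (q : seq nat),
  good k reach v -> uniq q -> q =i reach v -> size q <= n.+1.

Local Notation sel := (selected k reach).
Local Notation idx := (elt_index k reach).

Definition ord_pair v w p := [/\ sel v, reach v w, sel w & p = (idx w, idx v)].
(** Inconsistency of v with a vertex x is recognized by a sibling w of x that is
    reached from v. *)
Definition inc_pair v w b p :=
  [/\ sel v, reach v w, 2 <= w &
   [/\ block_start k w + b != w, sel (block_start k w + b)
     & p = (idx (block_start k w + b), idx v)]].

Lemma out_inc_correct s v w P :
  nmem s var_k 0 = k -> nmem s var_v 0 = v -> nmem s var_w 0 = w -> sel v -> v < L -> reach v w ->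
  2 <= w < L -> (forall u, u < L -> nmem s arr_id u = elt_id k reach u) ->
  nmem s arr_block w = block_start k w -> stored s 3 4 var_incs P ->
  wp (for_loop var_j (get var_k) out_inc_body) s
    (k.+1 * (scost out_inc_body + for_overhead (get var_k)))
    (fun s' => stored s' 3 4 var_incs
       (fun p => P p \/ exists2 b, b < k & inc_pair v w b p)).
Proof.
move=> k0 vv ww sv vL rvw wL ids bsw st0.
apply: (wp_for_const (N := k) (K := scost out_inc_body)
  (I := fun j s' => stored s' 3 4 var_incs
     (fun p => P p \/ exists2 b, b < j & inc_pair v w b p))) => //.
- by move=> j s1 _ fr; rewrite /= fr.
- by apply: eq_stored st0 => p; split=> [|[//|[]//]]; auto.
- move=> j s1 jk stj fr _ jj; apply: wp_loopfree => //.
  have xL := block_startD L_eq wL jk.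
  set x := block_start k w + j in xL *.
  have idv : nmem s1 arr_id v = (idx v).+1 by rewrite fr // ids // /elt_id sv.
  have idx_ : nmem s1 arr_id x = elt_id k reach x by rewrite fr // ids.
  have vv1 : nmem s1 var_v 0 = v by rewrite fr.
  have ww1 : nmem s1 var_w 0 = w by rewrite fr.
  have bs1 : nmem s1 arr_block w = block_start k w by rewrite fr.
  have stepP p : (exists2 b, b < j.+1 & inc_pair v w b p) <->
     (exists2 b, b < j & inc_pair v w b p) \/ inc_pair v w j p.
    split=> [[b]|[[b bj inc]|inc]]; last by exists j.
      by rewrite ltnS leq_eqVlt => /orP[/eqP->|bj] inc; [right | left; exists b].
    by exists b => //; apply: ltnW.
  have {}stj : stored (setn s1 var_x 0 x) 3 4 var_incs
      (fun p => P p \/ exists2 b, b < j & inc_pair v w b p) := stj.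
  rewrite /out_inc_body /= ww1 bs1 jj -/x idx_ /elt_id andbC -eqn_leq.
  case: (boolP (sel x)) => sx /=; last first.
    rewrite andbF; apply: eq_stored stj => p; rewrite stepP; split; first by case; auto.
    by case=> [|[]]; auto; case=> _ _ _ []; rewrite -/x (negPf sx).
  case: (eqVneq x w) => xw /=.
    apply: eq_stored stj => p; rewrite stepP; split; first by case; auto.
    by case=> [|[]]; auto; case=> _ _ _ []; rewrite -/x xw eqxx.
  apply: (eq_stored (P := fun p => (P p \/ exists2 b, b < j & inc_pair v w b p)
      \/ p = (idx x, idx v))).
    move=> p; rewrite stepP; split; last first.
      case=> [|[|[_ _ _ [_ _ ->]]]]; auto.
    case=> [[]|->]; auto; do 2 right; case/andP: wL => w2 _.
    by split=> //; split.
  apply: stored_emit stj _ _ _ => [|i|i] /=; rewrite ?addn1 ?vv1 ?idv ?idx_ ?/elt_id ?sx ?subn1 //.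
Qed.

Lemma out_reached_correct s v P1 P2 (q : seq nat) T :
  nmem s var_k 0 = k -> nmem s var_v 0 = v -> sel v -> v < L ->
  uniq q -> q =i reach v ->
  (forall i, i < size q -> nmem s arr_queue (v * L + i) = nth 0 q i) ->
  nmem s arr_row v = v * L -> nmem s arr_len v = size q ->
  (forall u, u < L -> nmem s arr_id u = elt_id k reach u) ->
  (forall u, u < L -> nmem s arr_block u = block_start k u) ->
  stored s 1 2 var_ords P1 -> stored s 3 4 var_incs P2 ->
  (size q).+1 * (1000 * k) <= T ->
  wp (for_loop var_i (NGet arr_len (get var_v)) out_reached) s T
    (fun s' =>
       stored s' 1 2 var_ords (fun p => P1 p \/ exists2 w, w < L & ord_pair v w p) /\
       stored s' 3 4 var_incs
         (fun p => P2 p \/ exists w b, [/\ w < L, b < k & inc_pair v w b p])).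
Proof.
move=> k0 vv sv vL uq qr qQ rbv lenv ids bss st1 st2 leT.
have k_gt0 : 0 < k by case/andP: sv => /and4P[v2 _ _ _] _; case: (k) L_eq; lia.
pose I j s' := stored s' 1 2 var_ords
    (fun p => P1 p \/ exists2 w, w \in take j q & ord_pair v w p) /\
  stored s' 3 4 var_incs
    (fun p => P2 p \/ exists w b, [/\ w \in take j q, b < k & inc_pair v w b p]).
have out_all s' : I (size q) s' ->
    stored s' 1 2 var_ords (fun p => P1 p \/ exists2 w, w < L & ord_pair v w p) /\
    stored s' 3 4 var_incs
      (fun p => P2 p \/ exists w b, [/\ w < L, b < k & inc_pair v w b p]).
  rewrite /I take_size => -[i1 i2]; split; [apply: eq_stored i1 | apply: eq_stored i2].
    move=> p; split=> -[|[w]]; auto; first by rewrite qr => /reach_lt wL; right; exists w.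
    by move=> _ op; right; exists w => //; rewrite qr; case: op.
  move=> p; split=> -[|[w [b []]]]; auto.
    by rewrite qr => /reach_lt wL; right; exists w, b.
  by move=> _ bk ip; right; exists w, b; split=> //; rewrite qr; case: ip.
apply: (wp_weak (Q := I (size q)) _ (leqnn _) out_all).
apply: (wp_for_const (N := size q) (I := I)
  (K := (scost out_ord_step + (bcost (2 :<=: get var_w) +
     k.+1 * (scost out_inc_body + for_overhead (get var_k))).+1).+1)) => //.
- by move=> j s1 _ fr; rewrite /= (fr var_v) // vv fr // lenv.
- split.
    by apply: eq_stored st1 => p; rewrite take0; split=> [|[|[]]//]; auto.
  by apply: eq_stored st2 => p; rewrite take0; split=> [|[|[? [? []]]]//]; auto.
- move=> j s1 jq [i1 i2] fr _ jj; set w := nth 0 q j.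
  have wq : w \in q by apply: mem_nth.
  have rvw : reach v w by rewrite -[reach v w]qr.
  have wL := reach_lt rvw.
  apply: (wp_seq_cost (Q1 := fun s' => s' = srun out_ord_step s1)); first exact: wp_run.
  move=> _ ->; set s2 := srun _ _.
  have fr2 : nframe (nmod out_ord_step) s1 s2 by apply: nframe_srun.
  have v1 : nmem s1 var_v 0 = v by rewrite fr.
  have w1 : nmem s1 arr_queue (nmem s1 arr_row v + j) = w by rewrite !fr // rbv qQ.
  have ids1 u : u < L -> nmem s1 arr_id u = elt_id k reach u by move=> uL; rewrite fr // ids.
  have w2 : nmem s2 var_w 0 = w.
    by rewrite /s2 /out_ord_step /= v1 jj w1; case: ifP.
  have i1' : stored s2 1 2 var_ords
      (fun p => P1 p \/ exists2 w, w \in take j.+1 q & ord_pair v w p).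
    have stepP p : (exists2 x, x \in take j.+1 q & ord_pair v x p) <->
        (exists2 x, x \in take j q & ord_pair v x p) \/ ord_pair v w p.
      rewrite (take_nth 0) // -/w; split=> [[x]|[[x xq op]|op]].
      - by rewrite mem_rcons inE => /orP[/eqP->|xq] op; [right | left; exists x].
      - by exists x => //; rewrite mem_rcons inE xq orbT.
      - by exists w => //; rewrite mem_rcons mem_head.
    have {}i1 : stored (setn s1 var_w 0 w) 1 2 var_ords
      (fun p => P1 p \/ exists2 x, x \in take j q & ord_pair v x p) := i1.
    rewrite /s2 /out_ord_step /= v1 jj w1 (ids1 w wL) /elt_id.
    case: (boolP (sel w)) => sw /=; last first.
      apply: eq_stored i1 => p; rewrite stepP; split; first by case; auto.
      by case=> [|[]]; auto; case=> _ _; rewrite (negPf sw).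
    apply: (eq_stored (P := fun p => (P1 p \/ exists2 x, x \in take j q & ord_pair v x p)
        \/ p = (idx w, idx v))).
      move=> p; rewrite stepP; split; last by case=> [|[|[_ _ _ ->]]]; auto.
      by case=> [[]|->]; auto; do 2 right.
    by apply: stored_emit i1 _ _ _ => [|i|i] /=;
      rewrite ?addn1 ?v1 ?(ids1 w wL) ?(ids1 v vL) /elt_id ?sw ?sv ?subn1.
  have i2' : stored s2 3 4 var_incs (fun p => P2 p \/
      exists w b, [/\ w \in take j q, b < k & inc_pair v w b p]).
    exact: stored_nframe fr2 _ _ _ i2.
  have stepP p : (exists x b, [/\ x \in take j.+1 q, b < k & inc_pair v x b p]) <->
      (exists x b, [/\ x \in take j q, b < k & inc_pair v x b p]) \/
      (exists2 b, b < k & inc_pair v w b p).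
    rewrite (take_nth 0) // -/w; split=> [[x [b []]]|[[x [b [xq bk ip]]]|[b bk ip]]].
    - by rewrite mem_rcons inE => /orP[/eqP->|xq] op; [right; exists b | left; exists x, b].
    - by exists x, b; rewrite mem_rcons inE xq orbT.
    - by exists w, b; rewrite mem_rcons mem_head.
  apply: wp_if; rewrite /= w2 => w_ge2.
    apply: (wp_weak (wp_frame (out_inc_correct (v := v) (w := w) _ _ w2 sv vL rvw _ _ _ i2'))) => //.
    + by rewrite fr2 // fr.
    + by rewrite fr2.
    + by rewrite w_ge2.
    + by move=> u uL; rewrite fr2 // ids1.
    + by rewrite fr2 // fr // bss.
    + move=> s3 [i3 fr3 _]; split; first exact: stored_nframe fr3 _ _ _ i1'.
      by apply: eq_stored i3 => p; rewrite stepP; split; first [by case=> [[]|]; auto | by case=> [|[]]; auto].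
  apply: wp_loopfree => //.
  split=> //; apply: eq_stored i2' => p; rewrite stepP; split; first by case; auto.
  case=> [|[|[b _ [_ _ w_ge2' _]]]]; auto; by rewrite w_ge2' in w_ge2.
- apply: leq_trans leT; rewrite leq_mul2l; apply/orP; right.
  by rewrite /for_overhead /=; lia.
Qed.

(** A selected v reaches at most n + 1 vertices, and it reaches only itself if it
    has no outgoing arc. So the lists of all selected vertices have total length at
    most L + (n + 1) * narcs, and each entry costs time proportional to k. *)
Lemma out_correct s :
  nmem s var_k 0 = k -> nmem s var_L 0 = L -> nmem s var_ords 0 = 0 -> nmem s var_incs 0 = 0 ->
  label_inv L k reach L s ->
  wp out s (L * (100 + 2000 * k) + 1000 * k * n.+1 * narcs L adj + 100) (fun s' =>
    [/\ stored s' 1 2 var_ords (fun p => exists v w, [/\ v < L, w < L & ord_pair v w p]),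
        stored s' 3 4 var_incs
          (fun p => exists v w b, [/\ v < L, w < L, b < k & inc_pair v w b p])
      & nmem s' var_count 0 = nmem s var_count 0]).
Proof.
move=> k0 L0 o0 i0 [[rows rbs bss] ids _ _ _].
pose I j s' := stored s' 1 2 var_ords
    (fun p => exists v w, [/\ v < j, w < L & ord_pair v w p]) /\
  stored s' 3 4 var_incs
    (fun p => exists v w b, [/\ v < j, w < L, b < k & inc_pair v w b p]).
suff : wp out s (L * (100 + 2000 * k) + 1000 * k * n.+1 * narcs L adj + 100) (I L).
  move=> /wp_frame H; apply: wp_weak H (leqnn _) _ => s' [[i1 i2] fr _].
  by split=> //; rewrite fr.
have ids0 u : u < L -> nmem s arr_id u = elt_id k reach u by move=> uL; rewrite ids uL.
apply: (wp_for (N := L) (I := I)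
  (cost := fun v => 50 + 1000 * k * (2 + n.+1 * size (adj v)))) => //.
- by move=> j s1 _ fr; rewrite /= fr.
- by split; exists [::]; split=> // p; split=> // -[? [? []]] // ? [].
- move=> v s1 vL [i1 i2] fr _ vv.
  have ids1 u : u < L -> nmem s1 arr_id u = elt_id k reach u by move=> uL; rewrite fr // ids0.
  have stepO p : (exists v' w, [/\ v' < v.+1, w < L & ord_pair v' w p]) <->
      (exists v' w, [/\ v' < v, w < L & ord_pair v' w p]) \/
      (exists2 w, w < L & ord_pair v w p).
    split=> [[v' [w []]]|[[v' [w [v'v wL op]]]|[w wL op]]].
    - by rewrite ltnS leq_eqVlt => /orP[/eqP->|v'v] wL op; [right; exists w | left; exists v', w].
    - by exists v', w; rewrite ltnW.
    - by exists v, w.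
  have stepI p : (exists v' w b, [/\ v' < v.+1, w < L, b < k & inc_pair v' w b p]) <->
      (exists v' w b, [/\ v' < v, w < L, b < k & inc_pair v' w b p]) \/
      (exists w b, [/\ w < L, b < k & inc_pair v w b p]).
    split=> [[v' [w [b []]]]|[[v' [w [b [v'v wL bk op]]]]|[w [b [wL bk op]]]]].
    - by rewrite ltnS leq_eqVlt => /orP[/eqP->|v'v] wL bk op;
        [right; exists w, b | left; exists v', w, b].
    - by exists v', w, b; rewrite ltnW.
    - by exists v, w, b.
  apply: (wp_weak (Q := I v.+1)
    (T := (bcost (1 :<=: NGet arr_id (get var_v)) + (1000 * k * (2 + n.+1 * size (adj v))).+1).+1)) => //;
    last by rewrite /=; lia.
  (* For k = 0 no vertex is selected, and the bound must not grow with n then. *)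
  apply: wp_if; rewrite /= vv ids1 // /elt_id.
    case: (boolP (sel v)) => // sv _.
    have [q [uq qQ _ qr] lenq] := rows _ vL.
    apply: (wp_weak (out_reached_correct (v := v) (q := q) _ vv sv vL uq qr _ _ _ ids1 _ i1 i2
              (leqnn _))).
    + by rewrite fr.
    + by move=> i iq; rewrite fr // qQ.
    + by rewrite fr // rbs.
    + by rewrite fr.
    + by move=> u uL; rewrite fr // bss.
    + rewrite mulnC; apply: leqW; rewrite leq_mul2l; apply/orP; right.
      case adjE : (adj v) => [|w l] /=.
        rewrite muln0 addn0 ltnS; have := @uniq_leq_size _ q [:: v] uq; apply.
        move=> w; rewrite qr => rvw; rewrite inE.
        apply: (@reach_least (pred1 v) v w) => //= a b /eqP->.
        by rewrite adjE.
      have := good_size _ uq qr; rewrite mulnS => /(_ _)/leq_trans; move: sv => /andP[-> _].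
      by move=> /(_ _ isT) H; rewrite -addn1 -[2 + _]addn1; have := H _ (leqnn _); lia.
    + move=> s' [st1 st2]; split.
        by apply: eq_stored st1 => p; rewrite stepO.
      by apply: eq_stored st2 => p; rewrite stepI.
  case: (boolP (sel v)) => // sv _; apply: wp_loopfree => //.
  split; [apply: eq_stored i1 => p; rewrite stepO | apply: eq_stored i2 => p; rewrite stepI].
    by split; [left | case=> // -[w _ []]; rewrite (negPf sv)].
  by split; [left | case=> // -[w [b [_ _ []]]]; rewrite (negPf sv)].
- rewrite /for_overhead /=.
  have -> : \sum_(j < L) (50 + 1000 * k * (2 + n.+1 * size (adj j)) + (2 + 20)) =
      L * (72 + 2000 * k) + 1000 * k * n.+1 * narcs L adj.
    rewrite /narcs big_distrr /= -[X in X * _ + _](card_ord L) -sum_nat_const -big_split /=.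
    by apply: eq_bigr => i _; rewrite mulnDr mulnA; lia.
  have : L * (72 + 2000 * k) <= L * (100 + 2000 * k).
    by rewrite leq_mul2l leq_add2r orbT.
  by lia.
Qed.
End Out.

(** * Preparing the network and building the residual graph *)

(** The arrays from [arr_flow0] on are those of the maximum flow program. *)
Notation arr_flow0 := 40 (only parsing).
Notation arr_flow1 := 41 (only parsing).
Notation arr_flow2 := 42 (only parsing).
Notation arr_flow4 := 44 (only parsing).
(** A copy of the capacities given to the maximum flow program, which is free to
    overwrite its own. *)
Notation arr_caps := 2 (only parsing).
Notation var_kn := 7 (only parsing).
Notation var_infinite := 9 (only parsing).
Notation var_arcs := 10 (only parsing).

(** The product k * n is computed by k additions: n may be arbitrarily large
    compared to the number of arcs if k = 0. *)
Definition mult_body := assign var_kn (get var_kn :+: NGet 0 1).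

Definition setup_mid :=
  assign var_L (get var_kn :+: 2) ;; CNSet arr_flow0 0 (get var_kn) ;; CNSet arr_flow0 1 (NGet 0 2) ;;
  CRSet 1 0 ROne.

Definition copy_body :=
  CRSet 1 0 (RAdd (RGet 1 0) (RGet 0 (get var_i))) ;;
  CNSet arr_flow1 (get var_i) (NGet 1 (get var_i)) ;; CNSet arr_flow2 (get var_i) (NGet 2 (get var_i)).

Definition cap_body :=
  CIf (1 :<=: NGet 3 (get var_i))
    (CRSet arr_caps (get var_i) (RGet 1 0)) (CRSet arr_caps (get var_i) (RGet 0 (get var_i))) ;;
  CRSet arr_flow0 (get var_i) (RGet arr_caps (get var_i)).

Definition setup :=
  for_loop var_i (get var_k) mult_body ;;
  setup_mid ;;
  for_loop var_i (NGet 0 2) copy_body ;;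
  for_loop var_i (NGet 0 2) cap_body.

Definition flag_body :=
  CIf (BAnd (1 :<=: NGet 3 (get var_i))
        (BAnd (1 :<=: NGet arr_flow4 (NGet 1 (get var_i))) (NGet arr_flow4 (NGet 2 (get var_i)) :<=: 0)))
    (assign var_infinite 1) CSkip.

Definition add_arc u w :=
  assign var_arcs (get var_arcs :+: 1) ;; CNSet arr_target (get var_arcs) w ;;
  CNSet arr_next (get var_arcs) (NGet arr_head u) ;; CNSet arr_head u (get var_arcs).

Definition forward_arc :=
  CIf (BNot (BRLe (RGet arr_caps (get var_i)) (RGet arr_flow1 (get var_i))))
    (add_arc (NGet 1 (get var_i)) (NGet 2 (get var_i))) CSkip.

Definition backward_arc :=
  CIf (BNot (BRLe (RGet arr_flow1 (get var_i)) RZero))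
    (add_arc (NGet 2 (get var_i)) (NGet 1 (get var_i))) CSkip.

(** If the minimum cut contains an infinite arc, the graph is left without arcs. *)
Definition residual_body :=
  CIf (get var_infinite :<=: 0) (forward_arc ;; backward_arc) CSkip.

Definition residual :=
  for_loop var_i (NGet 0 2) flag_body ;; for_loop var_i (NGet 0 2) residual_body.

Section Setup.
Variable R : realType.
Implicit Types s : state R.

Lemma setup_correct s k n m :
  nmem s 0 0 = k -> nmem s 0 1 = n -> nmem s 0 2 = m ->
  (forall a i, 4 <= a -> nmem s a i = 0) -> (forall a i, 0 < a -> rmem s a i = 0%R) ->
  wp setup s (200 * (k + m + 1)) (fun s' =>
    [/\ nmem s' var_L 0 = k * n + 2,
        forall i, nmem s' arr_flow0 i = nth 0 [:: k * n; m] i,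
        forall i, nmem s' arr_flow1 i = (if i < m then nmem s 1 i else 0) /\
                  nmem s' arr_flow2 i = (if i < m then nmem s 2 i else 0)
      & forall i, rmem s' arr_flow0 i = rmem s' arr_caps i /\ rmem s' arr_caps i = if i < m then
            if 0 < nmem s 3 i then (1 + \sum_(j < m) rmem s 0 j)%R else rmem s 0 i
          else 0%R]).
Proof.
move=> k0 n0 m0 nz rz.
apply: (wp_weak (T := _) (Q := _) _ _ (fun _ h => h)).
  apply: wp_seq_cost.
    apply: wp_frame; apply: (wp_for_const (N := k) (K := scost mult_body)
      (I := fun j s' => nmem s' var_kn 0 = j * n)) (leqnn _) => //.
    - by move=> j s1 _ fr; rewrite /= fr.
    - by rewrite nz.
    - move=> j s1 jk jE fr _ _; apply: wp_loopfree => //.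
      by rewrite /= jE fr // n0 mulSn addnC.
  move=> s1 [kn1 fr1 rf1]; apply: (wp_seq_cost (Q1 := fun s' => s' = srun setup_mid s1)).
    exact: wp_run.
  move=> _ ->; set s2 := srun _ _.
  have fr2 : nframe (nmod setup_mid) s1 s2 by apply: nframe_srun.
  have e2 : [/\ nmem s2 var_L 0 = k * n + 2, forall i, nmem s2 arr_flow0 i = nth 0 [:: k * n; m] i,
      rmem s2 1 0 = 1%R & forall a i, a != 1 -> rmem s2 a i = rmem s1 a i].
    rewrite /s2 /setup_mid /= kn1 fr1 // m0; split=> //; last by move=> a i /negPf->.
    by case=> [|[|i]] //=; rewrite fr1 // nz // nth_nil.
  have [l2 d2 r2 rf2] := e2.
  have m2 : nmem s2 0 2 = m by rewrite fr2 // fr1.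
  have r20 i : rmem s2 0 i = rmem s 0 i by rewrite rf2 // rf1.
  apply: wp_seq_cost.
    apply: wp_frame; apply: (wp_for_const (N := m) (K := scost copy_body)
      (I := fun j s' => [/\ forall i, nmem s' arr_flow1 i = if i < j then nmem s 1 i else 0,
         forall i, nmem s' arr_flow2 i = if i < j then nmem s 2 i else 0
       & rmem s' 1 0 = (1 + \sum_(i < j) rmem s 0 i)%R /\
         forall a i, a != 1 -> rmem s' a i = rmem s2 a i])) (leqnn _) => //.
    - by move=> j s3 _ fr; rewrite /= fr.
    - split=> [i|i|]; [by rewrite fr2 // fr1 // nz | by rewrite fr2 // fr1 // nz | ].
      by rewrite big_ord0 addr0.
    - move=> j s3 jm [i1 i2 [i3 i4]] fr _ jj; apply: wp_loopfree => //.
      rewrite /= jj; split=> [i|i|].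
      + rewrite ltnS leq_eqVlt; case: eqVneq => [->|_ /=]; last exact: i1.
        by rewrite fr // fr2 // fr1.
      + rewrite ltnS leq_eqVlt; case: eqVneq => [->|_ /=]; last exact: i2.
        by rewrite fr // fr2 // fr1.
      + rewrite i3 i4 // r20 big_ord_recr /= addrA; split=> // a i /negPf aN.
        by rewrite aN /= i4 ?aN // rf2 ?aN.
  move=> s3 [[i1 i2 [i3 i4]] fr3 _].
  apply: wp_weak (leqnn _) _.
    apply: wp_frame; apply: (wp_for_const (N := m) (K := scost cap_body)
      (I := fun j s' => [/\ forall i, rmem s' arr_flow0 i = rmem s' arr_caps i,
          forall i, rmem s' arr_caps i = if i < j then
            if 0 < nmem s 3 i then (1 + \sum_(j < m) rmem s 0 j)%R else rmem s 0 i
          else 0%R & forall a i, a < arr_caps -> rmem s' a i = rmem s3 a i])) (leqnn _) => //.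
    - by move=> j s4 _ fr; rewrite /= fr // fr3.
    - by split=> [i|i|//]; rewrite ?i4 // ?rf2 // ?rf1 // ?(rz arr_flow0) // ?(rz arr_caps).
    - move=> j s4 jm [j0 j1 j2] fr _ jj; apply: wp_loopfree => //.
      have e3 : nmem s4 3 j = nmem s 3 j by rewrite fr // fr3 // fr2 // fr1.
      rewrite /= jj e3 j2 // i3 j2 // i4 // r20.
      case: ifP => c3 /=; (split=> [i|i|a i]; last by case: a => [|[|a]] // _; apply: j2);
        rewrite ?jj ?ltnS 1?[i <= j]leq_eqVlt; case: (eqVneq i j) => [ij|_ /=];
        rewrite ?ij ?eqxx ?c3 //; by [apply: j0 | apply: j1].
  move=> s4 [[j0 j1 _] fr4 _]; split=> // [|i|i].
  - by rewrite fr4 // fr3.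
  - by rewrite fr4 // fr3.
  - by rewrite !fr4 // i1 i2.
by rewrite /for_overhead /=; lia.
Qed.

Definition targets (G : seq (nat * nat)) u := [seq e.2 | e <- G & e.1 == u].

Lemma mem_targets G u w : (w \in targets G u) = ((u, w) \in G).
Proof.
apply/mapP/idP => [[[u' w']] | uw]; last by exists (u, w); rewrite // mem_filter eqxx.
by rewrite mem_filter /= => /andP[/eqP <- ?] ->.
Qed.

Lemma narcs_targets L G : narcs L (targets G) <= size G.
Proof.
rewrite /narcs; elim: G => [|[u w] G IH] /=; first by rewrite big1.
apply: leq_trans (_ : \sum_(v < L) ((val v == u) + size (targets G v)) <= _).
  apply: leq_sum => v _; rewrite /targets /= eq_sym.
  by case: eqP => //= _; rewrite add1n.
rewrite big_split /= -addn1 addnC leq_add // -big_mkcond sum1_card.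
apply/card_le1_eqP => v1 v2 /eqP e1 /eqP e2.
by apply: val_inj; exact: etrans e2 (esym e1).
Qed.

(** The new cell is put in front of the list of u and has a number larger than
    those of all cells in use, so the other lists are not disturbed. *)
Lemma add_arc_correct L G s s' u w :
  adjacency L (targets G) s (size G) ->
  nmem s' arr_head u = (size G).+1 ->
  (forall u', u' != u -> nmem s' arr_head u' = nmem s arr_head u') ->
  (forall i, nmem s' arr_target i = if i == (size G).+1 then w else nmem s arr_target i) ->
  (forall i, nmem s' arr_next i = if i == (size G).+1 then nmem s arr_head u else nmem s arr_next i) ->
  adjacency L (targets ((u, w) :: G)) s' (size ((u, w) :: G)).
Proof.
move=> adjs hdu hd tgt nxt u' u'L.
have old : chain s' (size G).+1 (nmem s arr_head u') (targets G u').
  apply: chain_widen (leqnSn _) _; apply: eq_chain (adjs _ u'L) => i iG.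
  by rewrite tgt nxt ltn_eqF.
rewrite /targets /=; case: eqVneq => [uu | /=]; last by rewrite eq_sym => /hd->.
by subst u'; rewrite hdu /= tgt nxt eqxx; split.
Qed.

Definition adj_lists L s G :=
  nmem s var_arcs 0 = size G /\ adjacency L (targets G) s (size G).

Lemma adj_lists_counter L s G v : adj_lists L s G -> adj_lists L (setn s var_i 0 v) G.
Proof.
move=> [aE adjs]; split=> // u uL.
by apply: eq_chain (adjs _ uL) => i _.
Qed.

Lemma forward_arc_correct L s G j :
  adj_lists L s G -> nmem s var_i 0 = j ->
  adj_lists L (srun forward_arc s)
    ((if (rmem s arr_flow1 j < rmem s arr_caps j)%R then [:: (nmem s 1 j, nmem s 2 j)] else [::]) ++ G).
Proof.
move=> [aE adjs] jj; rewrite /forward_arc /= jj -ltNge; case: ifP => // _.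
split=> /=; first by rewrite aE addn1.
apply: add_arc_correct adjs _ _ _ _ => [|u' /negPf u'N|i|i] /=;
  by rewrite ?jj ?aE ?eqxx ?u'N ?addn1.
Qed.

Lemma backward_arc_correct L s G j :
  adj_lists L s G -> nmem s var_i 0 = j ->
  adj_lists L (srun backward_arc s)
    ((if (0 < rmem s arr_flow1 j)%R then [:: (nmem s 2 j, nmem s 1 j)] else [::]) ++ G).
Proof.
move=> [aE adjs] jj; rewrite /backward_arc /= jj -ltNge; case: ifP => // _.
split=> /=; first by rewrite aE addn1.
apply: add_arc_correct adjs _ _ _ _ => [|u' /negPf u'N|i|i] /=;
  by rewrite ?jj ?aE ?eqxx ?u'N ?addn1.
Qed.

Section Residual.
Variables (s0 : state R) (L m : nat).
Hypothesis s0m : nmem s0 0 2 = m.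

Definition crosses j :=
  [&& 0 < nmem s0 3 j, 0 < nmem s0 arr_flow4 (nmem s0 1 j) & nmem s0 arr_flow4 (nmem s0 2 j) == 0].
Definition unbounded := has crosses (iota 0 m).

Definition residual_arcs_of j : seq (nat * nat) :=
  if unbounded then [::] else
  (if (0 < rmem s0 arr_flow1 j)%R then [:: (nmem s0 2 j, nmem s0 1 j)] else [::]) ++
  (if (rmem s0 arr_flow1 j < rmem s0 arr_caps j)%R then [:: (nmem s0 1 j, nmem s0 2 j)] else [::]).

Fixpoint residual_arcs j :=
  if j is j'.+1 then residual_arcs_of j' ++ residual_arcs j' else [::].

Lemma size_residual_arcs j : size (residual_arcs j) <= j.*2.
Proof.
elim: j => //= j IH; rewrite size_cat doubleS -add2n leq_add //.
by rewrite /residual_arcs_of; case: ifP => // _; rewrite size_cat; do 2 case: ifP => _.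
Qed.

Lemma mem_residual_arcs u w j : reflect
  (~~ unbounded /\ exists2 i, i < j &
     (rmem s0 arr_flow1 i < rmem s0 arr_caps i)%R /\ (u, w) = (nmem s0 1 i, nmem s0 2 i) \/
     (0 < rmem s0 arr_flow1 i)%R /\ (u, w) = (nmem s0 2 i, nmem s0 1 i))
  ((u, w) \in residual_arcs j).
Proof.
have memE i : ((u, w) \in residual_arcs_of i) = ~~ unbounded &&
    ((0 < rmem s0 arr_flow1 i)%R && ((u, w) == (nmem s0 2 i, nmem s0 1 i)) ||
     (rmem s0 arr_flow1 i < rmem s0 arr_caps i)%R && ((u, w) == (nmem s0 1 i, nmem s0 2 i))).
  by rewrite /residual_arcs_of; case: unbounded => //=; rewrite mem_cat;
    do 2 case: ifP => _; rewrite ?inE ?in_nil ?orbF.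
elim: j => [|j IH] /=; first by rewrite in_nil; constructor; case=> _ [].
rewrite mem_cat memE; apply: (iffP orP).
  case=> [/andP[ub c]|/IH[ub [i ij c]]]; split=> //; last by exists i => //; apply: ltnW.
  by exists j => //; case/orP: c => /andP[c /eqP e]; [right | left].
move=> [ub [i]]; rewrite ltnS leq_eqVlt => /orP[/eqP->|ij] c.
  by left; rewrite ub /=; case: c => -[-> ->]; rewrite eqxx ?orbT.
by right; apply/IH; split=> //; exists i.
Qed.

Lemma residual_correct :
  nmem s0 var_infinite 0 = 0 -> nmem s0 var_arcs 0 = 0 -> (forall u, nmem s0 arr_head u = 0) ->
  wp residual s0 (500 * (m + 1)) (fun s' =>
    adjacency L (targets (residual_arcs m)) s' (size (residual_arcs m))).
Proof.
move=> f0 a0 h0.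
apply: (wp_weak (T := _) (Q := _) _ _ (fun _ h => h)).
  apply: wp_seq_cost.
    apply: wp_frame; apply: (wp_for_const (N := m) (K := scost flag_body)
      (I := fun j s' => nmem s' var_infinite 0 = has crosses (iota 0 j) :> nat)) (leqnn _) => //.
    - by move=> j s1 _ fr; rewrite /= fr.
    - move=> j s1 jm jE fr _ jj; apply: wp_loopfree => //.
      rewrite -[X in iota 0 X]addn1 iotaD has_cat /= orbF add0n.
      move: jE; set b := has _ _ => jE.
      rewrite /flag_body /= jj ?(fr 3, fr arr_flow4, fr 1, fr 2) // leqn0 -/(crosses j).
      by case: (crosses j); rewrite /= ?jE ?orbT ?orbF.
  move=> s1 [f1 fr1 rf1].
  apply: (wp_weak (Q := fun s' => adj_lists L s' (residual_arcs m))) (leqnn _) _;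
    last by move=> s' [].
  apply: (wp_for_const (N := m) (K := scost residual_body)
    (I := fun j s' => adj_lists L s' (residual_arcs j))) (leqnn _) => //.
  - by move=> j s2 v; apply: adj_lists_counter.
  - by move=> j s2 _ fr; rewrite /= fr // fr1.
  - by split; [rewrite fr1 | move=> u uL; rewrite /= fr1].
  - move=> j s2 jm inv fr rf jj; apply: wp_loopfree => //.
    have fl : nmem s2 var_infinite 0 = unbounded by rewrite fr // f1.
    have e1 : nmem s2 1 j = nmem s0 1 j by rewrite fr // fr1.
    have e2 : nmem s2 2 j = nmem s0 2 j by rewrite fr // fr1.
    have c0 : rmem s2 arr_caps j = rmem s0 arr_caps j by rewrite rf // rf1.
    have c1 : rmem s2 arr_flow1 j = rmem s0 arr_flow1 j by rewrite rf // rf1.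
    have -> : srun residual_body s2 =
        if unbounded then s2 else srun backward_arc (srun forward_arc s2).
      by rewrite /residual_body [LHS]/= fl; case: unbounded.
    rewrite [residual_arcs j.+1]/= /residual_arcs_of; case: unbounded => //.
    rewrite -catA; set s3 := srun forward_arc s2.
    have fr3 : nframe (nmod forward_arc) s2 s3 by apply: nframe_srun.
    have rf3 : rframe (rmod forward_arc) s2 s3 by apply: rframe_srun.
    have := forward_arc_correct inv jj; rewrite e1 e2 c0 c1 => inv3.
    have := backward_arc_correct inv3; rewrite -/s3 fr3 // => /(_ j jj).
    by rewrite !fr3 // rf3 // e1 e2 c1.
by rewrite /for_overhead /=; lia.
Qed.
End Residual.
End Setup.

(** * Minimum cuts and the residual graph *)

Definition closed_under (T : finType) (e : rel T) (X : {set T}) :=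
  forall u w, e u w -> u \in X -> w \in X.

Lemma connect_in_closed (T : finType) (e : rel T) (X : {set T}) u w :
  closed_under e X -> u \in X -> connect e u w -> w \in X.
Proof.
move=> cl uX /connectP[p]; elim: p u uX => [|v p IH] u uX /=; first by move=> _ ->.
by move=> /andP[uv pp] wl; apply: IH pp wl; apply: cl uv uX.
Qed.

Section Flow.
Variables (R : realType) (T : finType) (N : network R T).
Hypothesis N_fin : finite_network N.
Local Open Scope ring_scope.
Implicit Types (phi d : vertex T * vertex T -> R) (v : vertex T) (X : {set vertex T}).

Let c e : R := fine (cap N e).

Definition residual_rel phi : rel (vertex T) := fun u w =>
  ((u, w) \in arcs N) && (phi (u, w) < c (u, w)) ||
  ((w, u) \in arcs N) && (0 < phi (w, u)).

(** It vanishes at the inner vertices if d is a flow. *)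
Definition net_out d v : R :=
  \sum_(e <- arcs N | e.1 == v) d e - \sum_(e <- arcs N | e.2 == v) d e.

Definition slack phi X : R :=
  \sum_(e <- arcs N | (e.1 \in X) && (e.2 \notin X)) (c e - phi e) +
  \sum_(e <- arcs N | (e.2 \in X) && (e.1 \notin X)) phi e.

Lemma sum_net_out d X :
  \sum_(v in X) net_out d v =
  \sum_(e <- arcs N | (e.1 \in X) && (e.2 \notin X)) d e -
  \sum_(e <- arcs N | (e.2 \in X) && (e.1 \notin X)) d e.
Proof.
rewrite big_split sumrN /=.
have part (f : vertex T * vertex T -> vertex T) :
    \sum_(v in X) \sum_(e <- arcs N | f e == v) d e = \sum_(e <- arcs N | f e \in X) d e.
  rewrite (exchange_big_dep (fun e => f e \in X)) /=; last by move=> v e vX /eqP->.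
  apply: eq_bigr => e feX; rewrite (big_pred1 (f e)) // => v.
  by rewrite /= eq_sym andbC; case: eqVneq => //= ->.
rewrite !part (bigID (fun e => e.2 \in X)) /= [X in _ - X](bigID (fun e => e.1 \in X)) /=.
rewrite opprD addrACA [X in X + _](_ : _ = 0) ?add0r //.
by apply/eqP; rewrite subr_eq0; apply/eqP/eq_bigl => e; rewrite andbC.
Qed.

(** Summing the net outflow over X, the arcs inside X cancel, and the flow value
    is what leaves X minus what enters it. *)
Lemma cut_cap_slack phi X : is_flow N phi -> st_cut X ->
  cut_cap N X = (flow_value N phi + slack phi X)%:E.
Proof.
move=> [_ cons] /andP[sX tX].
have -> : flow_value N phi = \sum_(v in X) net_out phi v.
  rewrite (bigD1 source) //= [X in _ + X]big1 ?addr0 // => -[[u|]|] //.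
    by move=> _; rewrite /net_out cons subrr.
  - by rewrite -/(@sink T) (negPf tX).
  - by rewrite -/(@source T) eqxx andbF.
rewrite sum_net_out /slack sumrB.
have rearrange (a b x : R) : a - b + (x - a + b) = x by ring.
rewrite rearrange /cut_cap -sumEFin big_seq_cond [RHS]big_seq_cond.
by apply: eq_bigr => e /andP[eN _]; rewrite fineK ?N_fin.
Qed.

Lemma flow_bounds phi e : is_flow N phi -> e \in arcs N -> 0 <= phi e <= c e.
Proof.
move=> [bnd _] eN; have [p0 pc] := bnd _ eN; rewrite p0 /=.
by rewrite -lee_fin fineK ?N_fin.
Qed.

Lemma slack_ge0 phi X : is_flow N phi -> 0 <= slack phi X.
Proof.
move=> flow; rewrite /slack big_seq_cond [X in _ + X]big_seq_cond.
by apply: addr_ge0; apply: sumr_ge0 => e /andP[/(flow_bounds flow)/andP[p0 pc] _] //;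
  rewrite subr_ge0.
Qed.

Lemma slack_eq0 phi X : is_flow N phi ->
  slack phi X = 0 <-> closed_under (residual_rel phi) X.
Proof.
move=> flow; rewrite /slack big_seq_cond [X in _ + X]big_seq_cond.
have pos1 e : [&& e \in arcs N, e.1 \in X & e.2 \notin X] -> 0 <= c e - phi e.
  by move=> /andP[/(flow_bounds flow)/andP[p0 pc] _]; rewrite subr_ge0.
have pos2 e : [&& e \in arcs N, e.2 \in X & e.1 \notin X] -> 0 <= phi e.
  by move=> /andP[/(flow_bounds flow)/andP[p0 pc] _].
split=> [/eqP|cl].
  rewrite paddr_eq0 ?sumr_ge0 // !psumr_eq0 // => /andP[/allP z1 /allP z2] u w uw uX.
  apply: contraLR uw => wX; rewrite /residual_rel negb_or; apply/andP; split.
    apply/negP => /andP[eN lt]; have := z1 _ eN; rewrite eN uX wX /= subr_eq0.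
    by rewrite (gt_eqF lt).
  apply/negP => /andP[eN lt]; have := z2 _ eN; rewrite eN uX wX /=.
  by rewrite (gt_eqF lt).
rewrite !big1 ?addr0 // => -[u w] /= /and3P[eN uX wX].
  have := cl w u; rewrite /residual_rel eN /= (negPf wX) => /(_ _ uX) H.
  have /andP[p0 _] := flow_bounds flow eN.
  by apply/eqP; rewrite eq_le p0 andbT leNgt; apply/negP => lt; apply/notF/H; rewrite lt orbT.
have := cl u w; rewrite /residual_rel eN /= (negPf wX) => /(_ _ uX) H.
have /andP[_ pc] := flow_bounds flow eN.
by apply/eqP; rewrite subr_eq0 eq_le pc andbT leNgt; apply/negP => lt; apply/notF/H; rewrite lt.
Qed.

(** Each arc admits all small enough steps, and there are finitely many arcs. *)
Lemma exists_small_step (s : seq (vertex T * vertex T)) phi d :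
  (forall e, e \in s ->
     [/\ 0 <= phi e <= c e, 0 < d e -> phi e < c e & d e < 0 -> 0 < phi e]) ->
  exists2 eps, 0 < eps & forall e, e \in s -> 0 <= phi e + eps * d e <= c e.
Proof.
move=> H; suff [eps e0 small] : exists2 eps, 0 < eps &
    forall e, e \in s -> forall x, 0 < x <= eps -> 0 <= phi e + x * d e <= c e.
  by exists eps => // e es; apply: small; rewrite ?e0 /=.
elim: s H => [|e s IH] H; first by exists 1.
have [|eps e0 small] := IH; first by move=> f fs; apply: H; rewrite inE fs orbT.
have [/andP[p0 pc] up dn] := H e (mem_head _ _).
have [eps' e0' small'] : exists2 x, 0 < x & forall y, 0 < y <= x -> 0 <= phi e + y * d e <= c e.
  have [d0|d0|d0] := ltgtP (d e) 0.
  - exists (phi e / - d e); first by rewrite divr_gt0 ?dn ?oppr_gt0.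
    move=> y /andP[y0]; rewrite ler_pdivlMr ?oppr_gt0 // => yle.
    have : y * d e < 0 by rewrite pmulr_rlt0.
    by move: yle; rewrite mulrN => yle yd; apply/andP; split; lra.
  - exists ((c e - phi e) / d e); first by rewrite divr_gt0 ?subr_gt0 ?up.
    move=> y /andP[y0]; rewrite ler_pdivlMr // => yle.
    have : 0 < y * d e by rewrite mulr_gt0.
    by move=> yd; apply/andP; split; lra.
  - by exists 1 => // y _; rewrite d0 mulr0 addr0 p0.
exists (Num.min eps eps'); first by rewrite lt_min e0.
move=> f; rewrite inE => /orP[/eqP->|fs] x; rewrite le_min => /andP[x0 /andP[x1 x2]].
  by apply: small'; rewrite x0.
by apply: small => //; rewrite x0.
Qed.

Lemma sum_arc_indicator (P : pred (vertex T * vertex T)) e0 : e0 \in arcs N ->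
  \sum_(e <- arcs N | P e) (e == e0)%:R = (P e0)%:R :> R.
Proof.
move=> e0N; rewrite big_mkcond (bigD1_seq e0) ?arcs_uniq //= eqxx big1 ?addr0.
  by case: (P e0).
by move=> e /negPf->; case: (P e).
Qed.

(** Each arc of a residual path changes the direction by 1 or -1 on one arc of the
    network, in a way that the flow leaves room for. Since only the signs of the
    entries matter, the path may repeat arcs. *)
Lemma augmenting_direction phi v : connect (residual_rel phi) source v ->
  exists d, (forall e, e \in arcs N -> (0 < d e -> phi e < c e) /\ (d e < 0 -> 0 < phi e)) /\
    forall u, net_out d u = (u == source)%:R - (u == v)%:R.
Proof.
move=> /connectP[p]; elim/last_ind: p v => [|p w IH] v /=.
  move=> _ ->; exists (fun=> 0); split; first by move=> e _; rewrite ltxx.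
  by move=> u; rewrite /net_out !big1 // !subrr.
rewrite rcons_path last_rcons => /andP[/IH/(_ erefl)[d [dP dn]] uw ->].
set u0 := last _ _ in dn uw.
case/orP: uw => /andP[eN lt].
  exists (fun e => d e + (e == (u0, w))%:R); split.
    move=> e /dP[up dnw]; case: (eqVneq e (u0, w)) => [ee|_]; rewrite /= ?addr0 //.
    by split=> [_|h]; [rewrite ee | apply: dnw; lra].
  move=> u; have := dn u; rewrite /net_out !big_split /= !sum_arc_indicator //= => dnu.
  by rewrite opprD addrACA dnu ![_ == u]eq_sym; ring.
exists (fun e => d e - (e == (w, u0))%:R); split.
  move=> e /dP[up dnw]; case: (eqVneq e (w, u0)) => [ee|_]; rewrite /= ?subr0 //.
  by split=> [h|_]; [apply: up; lra | rewrite ee].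
move=> u; have := dn u; rewrite /net_out !sumrB /= !sum_arc_indicator //= => dnu.
by rewrite opprD addrACA dnu ![_ == u]eq_sym; ring.
Qed.

(** A small step in an augmenting direction would increase the flow value. *)
Lemma max_flow_no_path phi : max_flow N phi -> ~~ connect (residual_rel phi) source sink.
Proof.
move=> [flow opt]; apply/negP => /augmenting_direction[d [dP dn]].
have [e eN|eps e0 small] := @exists_small_step (arcs N) phi d.
  by have [up dnw] := dP _ eN; split=> //; apply: flow_bounds.
pose phi' e := phi e + eps * d e.
have out v : net_out phi' v = net_out phi v + eps * net_out d v.
  rewrite /net_out !big_split /= -!big_distrr /=; ring.
have flow' : is_flow N phi'.
  split=> [e eN|v].
    have /andP[p0 pc] := small _ eN; split=> //.
    by rewrite -[leRHS]fineK ?N_fin // lee_fin.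
  have : net_out phi' (inner v) = 0.
    by rewrite out dn /net_out flow.2 !subrr mulr0 addr0.
  by move/eqP; rewrite subr_eq0 => /eqP.
have := opt _ flow'; rewrite -[flow_value N phi']/(net_out phi' source) out dn.
by rewrite eqxx subr0 mulr1 gerDl leNgt e0.
Qed.

(** All cuts have the same capacity up to their slack, and the set of the vertices
    reachable from the source is a cut without slack. *)
Lemma min_cutP phi X : max_flow N phi ->
  min_cut N X <-> st_cut X /\ closed_under (residual_rel phi) X.
Proof.
move=> max; have [flow _] := max.
split=> [[stX minX]|[stX /(slack_eq0 _ flow) X0]]; last first.
  split=> // Y stY; rewrite !(cut_cap_slack flow) // X0 addr0 lee_fin lerDl.
  exact: slack_ge0.
split=> //; pose Z := [set v | connect (residual_rel phi) source v].
have stZ : st_cut Z by rewrite /st_cut !inE connect0 max_flow_no_path.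
have clZ : closed_under (residual_rel phi) Z.
  by move=> u w uw; rewrite !inE => su; apply: connect_trans su (connect1 uw).
apply/(slack_eq0 _ flow)/eqP; rewrite eq_le slack_ge0 // andbT.
have := minX _ stZ; rewrite !(cut_cap_slack flow) //.
by rewrite (slack_eq0 Z flow).2 // addr0 lee_fin gerDl.
Qed.

End Flow.

(** * The poset read off a reachability relation *)

Section Combinatorics.
Variables (n k : nat).
Local Notation V := (vertex ('I_n * 'I_k)%type).
Implicit Types (x y z : vec n k) (X Y : {set V}) (i : 'I_n) (a b : 'I_k)
  (u v w : 'I_n * 'I_k).

Definition legal X := forall i a b, vtx i a \in X -> vtx i b \in X -> a = b.

Lemma mem_U i j a : (vtx j a \in U k i) = (j == i).
Proof.
apply/imsetP/eqP => [[b _ [] //]|->]; by exists a.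
Qed.

Lemma mem_legal_part X i a :
  reflect (vtx i a \in X /\ forall b, vtx i b \in X -> b = a)
          (vtx i a \in legal_part X).
Proof.
rewrite in_setD; apply: (iffP andP) => [[nb aX]|[aX one]]; split=> //.
  move=> b bX; apply: contraNeq nb => ba; apply/bigcupP; exists i; last by rewrite inE aX mem_U eqxx.
  by apply/card_gt1P; exists (vtx i b), (vtx i a); split; rewrite ?inE ?bX ?aX ?mem_U ?eqxx //;
    apply: contra ba => /eqP[->].
apply/bigcupP => -[j /card_gt1P[s [t [sX tX st]]]]; rewrite inE mem_U => /andP[_ /eqP ij]; subst j.
move: sX tX st; rewrite !inE => /andP[sX /imsetP[c _ sE]] /andP[tX /imsetP[d _ tE]].
by subst s t; rewrite (one c sX) (one d tX) eqxx.
Qed.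

Lemma source_legal_part X : source \in X -> source \in legal_part X.
Proof.
move=> sX; rewrite in_setD sX andbT; apply/bigcupP => -[i _].
by rewrite inE sX => /imsetP[].
Qed.

Lemma legal_part_sub X : legal_part X \subset X.
Proof. exact: subsetDl. Qed.

Lemma st_cut_legal_part X : st_cut X -> st_cut (legal_part X).
Proof.
move=> /andP[sX tX]; rewrite /st_cut source_legal_part //=.
by apply: contra tX; apply: (subsetP (legal_part_sub X)).
Qed.

Lemma legal_legal_part X : legal (legal_part X).
Proof.
by move=> i a b /mem_legal_part[aX _] /mem_legal_part[_ one]; rewrite (one a).
Qed.

Lemma legal_sub X Y : X \subset Y -> legal Y -> legal X.
Proof. by move=> /subsetP XY lY i a b /XY aY /XY bY; apply: lY aY bY. Qed.

Lemma mem_psi x i a : (vtx i a \in psi x) = (x i == lift ord0 a).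
Proof.
rewrite !inE /=; apply/imsetP/idP => [[[j b]]|xi]; last by exists (i, a); rewrite ?inE.
by rewrite inE /= => xj [-> ->].
Qed.

Lemma source_psi x : source \in psi x.
Proof. by rewrite !inE eqxx. Qed.

Lemma st_cut_psi x : st_cut (psi x).
Proof. by rewrite /st_cut source_psi !inE /=; apply/imsetP => -[]. Qed.

Lemma legal_psi x : legal (psi x).
Proof. by move=> i a b; rewrite !mem_psi => /eqP-> /eqP/lift_inj. Qed.

(** The inverse of [psi] on legal cuts. *)
Definition unpsi X : vec n k :=
  [ffun i => if [pick a | vtx i a \in X] is Some a then lift ord0 a else ord0].

Lemma psi_unpsi X : st_cut X -> legal X -> psi (unpsi X) = X.
Proof.
move=> /andP[sX tX] lX; apply/setP => -[[[i a]|]|]; last by rewrite source_psi.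
  rewrite -/(vtx i a) mem_psi ffunE; case: pickP => [b bX|no].
    apply/eqP/idP => [/lift_inj <- //|aX]; by rewrite (lX i a b).
  by rewrite [RHS]no; apply/eqP => /eqP; rewrite (negPf (neq_lift _ _)).
by have /andP[_ /negPf->] := st_cut_psi (unpsi X); rewrite -[Some None]/sink (negPf tX).
Qed.

Lemma vle_psi x y : vle x y = (psi x \subset psi y).
Proof.
apply/forallP/subsetP => [xy [[[i a]|]|]|xy i].
- rewrite -/(vtx i a) !mem_psi => /eqP xi; have := xy i.
  by rewrite /sle xi eq_sym (negPf (neq_lift _ _)) => /= /eqP->.
- by have /andP[_ /negPf->] := st_cut_psi x.
- by rewrite !source_psi.
rewrite /sle; case: (unliftP ord0 (x i)) => [a xi|->]; last by rewrite eqxx.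
by have := xy (vtx i a); rewrite !mem_psi xi eqxx => /(_ isT)/eqP->; rewrite eqxx orbT.
Qed.

Section Reachability.
Variables (E : rel V) (M : {set vec n k}).
Hypothesis mem_M : forall x, x \in M <-> closed_under E (psi x).
Hypothesis closed_legal_part : forall X,
  st_cut X -> closed_under E X -> closed_under E (legal_part X).
Hypothesis sink_unreachable : ~~ connect E source sink.

Definition reached (s : V) := [set w | connect E s w].

Lemma closed_reached s : closed_under E (reached s).
Proof.
by move=> u w uw; rewrite !inE => su; apply: connect_trans su (connect1 uw).
Qed.

Lemma closedU X Y :
  closed_under E X -> closed_under E Y -> closed_under E (X :|: Y).
Proof.
by move=> cX cY u w uw; rewrite !inE => /orP[/(cX _ _ uw)|/(cY _ _ uw)] ->; rewrite ?orbT.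
Qed.

Lemma reached_sub s X : closed_under E X -> s \in X -> reached s \subset X.
Proof.
by move=> cX sX; apply/subsetP => w; rewrite inE; apply: connect_in_closed.
Qed.

Definition good_vertex v :=
  [&& ~~ connect E (inner v) sink, ~~ connect E source (inner v)
    & [forall b, (b == v.2) ||
        ~~ connect E (inner v) (vtx v.1 b) && ~~ connect E source (vtx v.1 b)]].

(** The least closed cut containing v. *)
Definition hull v := reached source :|: reached (inner v).
Definition irr v := unpsi (hull v).

Lemma source_hull v : source \in hull v.
Proof. by rewrite !inE connect0. Qed.

Lemma self_hull v : inner v \in hull v.
Proof. by rewrite !inE connect0 orbT. Qed.

Lemma closed_hull v : closed_under E (hull v).
Proof. by apply: closedU; apply: closed_reached. Qed.

Lemma hull_sub v X : closed_under E X -> source \in X -> inner v \in X -> hull v \subset X.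
Proof. by move=> cX sX vX; rewrite subUset !reached_sub. Qed.

Lemma st_cut_hull v : good_vertex v -> st_cut (hull v).
Proof.
move=> /and3P[vt _ _].
by rewrite /st_cut source_hull !inE negb_or sink_unreachable vt.
Qed.

Lemma good_sibling v b : good_vertex v -> vtx v.1 b \in hull v -> b = v.2.
Proof.
move=> /and3P[_ _ /forallP/(_ b)/orP[/eqP-> //|/andP[/negPf vb /negPf sb]]].
by rewrite !inE vb sb.
Qed.

(** The legal part of the hull is closed, and it still contains v if no sibling
    of v belongs to the hull; by minimality of the hull nothing has been removed. *)
Lemma legal_hull v : good_vertex v -> legal (hull v).
Proof.
move=> gv; have st := st_cut_hull gv.
apply: legal_sub (legal_legal_part (X := hull v)); apply: hull_sub.
- by apply: closed_legal_part => //; apply: closed_hull.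
- exact/source_legal_part/source_hull.
have := @mem_legal_part (hull v) v.1 v.2; rewrite /vtx -surjective_pairing => h.
by apply/h; split=> [|b]; [apply: self_hull | apply: good_sibling].
Qed.

Lemma psi_irr v : good_vertex v -> psi (irr v) = hull v.
Proof. by move=> gv; rewrite psi_unpsi ?st_cut_hull //; apply: legal_hull. Qed.

Lemma irr_M v : good_vertex v -> irr v \in M.
Proof. by move=> gv; apply/mem_M; rewrite psi_irr //; apply: closed_hull. Qed.

Lemma irr_le v x : good_vertex v -> x \in M -> vle (irr v) x = (inner v \in psi x).
Proof.
move=> gv /mem_M cx; rewrite vle_psi psi_irr //; apply/idP/idP => [/subsetP|vx].
  by apply; apply: self_hull.
by apply: hull_sub => //; apply: source_psi.
Qed.

Lemma irr_leE u v : good_vertex u -> good_vertex v ->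
  vle (irr v) (irr u) = connect E (inner u) (inner v).
Proof.
move=> gu gv; rewrite irr_le ?irr_M // psi_irr // !inE.
by case/and3P: gv => _ /negPf->.
Qed.

(** The hull of v is contained in every closed legal cut that contains v. *)
Lemma good_of_psi x v : x \in M -> inner v \in psi x -> ~~ connect E source (inner v) ->
  good_vertex v.
Proof.
move=> /mem_M cx vx sv; apply/and3P; split=> //.
  have /andP[_] := st_cut_psi x; apply: contra; exact: connect_in_closed cx vx.
apply/forallP => b; case: eqVneq => //= bv; rewrite -negb_or; apply/negP.
have vx' : vtx v.1 v.2 \in psi x by rewrite /vtx -surjective_pairing.
case/orP => [vb|sb]; move: bv; rewrite (legal_psi (x := x) (i := v.1) (b := v.2) (a := b)) ?eqxx //.
  exact: connect_in_closed cx vx vb.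
exact: connect_in_closed cx (source_psi x) sb.
Qed.

(** If irr v were a join of smaller elements, none of these would contain v, and
    neither would their union with the vertices reachable from the source, which
    is a legal closed cut and thus a smaller upper bound. *)
Lemma irr_join_irreducible v : good_vertex v -> irr v \in join_irreducibles M.
Proof.
move=> gv; rewrite inE irr_M //=.
have closed_unpsi X : X \subset hull v -> source \in X -> closed_under E X ->
    unpsi X \in M /\ psi (unpsi X) = X.
  move=> Xv sX cX; have pX : psi (unpsi X) = X.
    apply: psi_unpsi; last exact: legal_sub Xv (legal_hull gv).
    rewrite /st_cut sX; have /andP[_] := st_cut_hull gv.
    by apply: contra => /(subsetP Xv).
  by split=> //; apply/mem_M; rewrite pX.
apply/andP; split.
  have [] := closed_unpsi (reached source); rewrite ?inE ?connect0 //.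
  - exact: subsetUl.
  - exact: closed_reached.
  move=> x0M x0E; apply/negP => /andP[_ /forall_inP/(_ _ x0M)].
  by rewrite irr_le // x0E inE; case/and3P: gv => _ /negPf->.
apply/existsPn => Y; apply/negP => /andP[/subsetP YM /and3P[_ /forall_inP ub /forall_inP least]].
pose X := reached source :|: \bigcup_(y in Y) psi y.
have yM y : y \in Y -> y \in M by move=> /YM; rewrite !inE => /andP[].
have vX : inner v \notin X.
  rewrite inE negb_or inE; have /and3P[_ -> _] := gv.
  apply/bigcupP => -[y yY]; rewrite -irr_le ?yM // => vy.
  have := YM _ yY; rewrite !inE => /andP[/eqP[]].
  by apply: vle_anti; rewrite vy ub.
have [] := closed_unpsi X.
- rewrite subUset subsetUl; apply/bigcupsP => y yY.
  by rewrite -psi_irr // -vle_psi ub.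
- by rewrite !inE connect0.
- apply: closedU (@closed_reached _) _ => s w sw /bigcupP[y yY sy].
  apply/bigcupP; exists y => //; have /mem_M cy := yM _ yY; exact: cy sw sy.
move=> xM xE; have := least _ xM; rewrite irr_le // xE (negPf vX) implybF => /negP[].
apply/forall_inP => y yY; rewrite vle_psi xE.
by apply: subsetU; rewrite bigcup_sup ?orbT.
Qed.

(** Every minimizer x is the join of the irr v over the good v in psi x: the
    vertices of psi x that are not good are reachable from the source. *)
Lemma join_irreducible_irr x : x \in join_irreducibles M ->
  exists2 v, good_vertex v & x = irr v.
Proof.
rewrite inE => /and3P[xM _ /existsPn irrx].
case: (boolP [exists v, good_vertex v && (x == irr v)]) => [/existsP[v /andP[gv /eqP->]]|].
  by exists v.
rewrite negb_exists => /forallP nx.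
pose Y := [set irr v | v in [pred v | good_vertex v && (inner v \in psi x)]].
have /negP[] := irrx Y; apply/andP; split.
  apply/subsetP => y /imsetP[v]; rewrite !inE => /andP[gv _] ->; rewrite irr_M // andbT.
  by have := nx v; rewrite gv eq_sym.
apply/and3P; split=> //.
  by apply/forall_inP => y /imsetP[v]; rewrite inE => /andP[gv vx] ->; rewrite irr_le.
apply/forall_inP => w wM; apply/implyP => /forall_inP ub; rewrite vle_psi.
have /mem_M cw := wM.
apply/subsetP => -[[v|]|]; last by move=> _; apply: source_psi.
  move=> vx; case: (boolP (connect E source (inner v))) => sv.
    exact: connect_in_closed cw (source_psi w) sv.
  have gv := good_of_psi xM vx sv; rewrite -irr_le //; apply: ub.
  by apply/imsetP; exists v => //; rewrite inE gv.
by have /andP[_ /negPf->] := st_cut_psi x.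
Qed.

(** If no sibling of v is reached from u, then no sibling of u is reached from v
    either: the legal part of the union of both hulls is closed and still contains
    v, but it contains no sibling of u.  So it contains u as well and is the whole
    union, which is therefore legal and bounds both elements. *)
Lemma irr_inc u v : good_vertex u -> good_vertex v ->
  vinc (irr u) (irr v) = [exists b, (b != v.2) && connect E (inner u) (vtx v.1 b)].
Proof.
move=> gu gv; have vE : inner v = vtx v.1 v.2 by rewrite /vtx -surjective_pairing.
have uE : inner u = vtx u.1 u.2 by rewrite /vtx -surjective_pairing.
apply/vincP/existsP => [noub|[b /andP[bv ub]] [z [uz vz]]]; last first.
  rewrite !vle_psi !psi_irr // in uz vz; move: bv.
  rewrite (legal_psi (x := z) (i := v.1) (a := b) (b := v.2)) ?eqxx //.
    by apply: (subsetP uz); rewrite !inE ub orbT.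
  by rewrite -vE; apply: (subsetP vz); rewrite self_hull.
apply/existsP; apply: contraT; rewrite negb_exists => /forallP nosib.
case: noub; pose X := hull u :|: hull v.
have stX : st_cut X.
  have /andP[_ tu] := st_cut_hull gu; have /andP[_ tv] := st_cut_hull gv.
  by apply/andP; split; rewrite in_setU ?source_hull // negb_or tu tv.
have cX : closed_under E X by apply: closedU; apply: closed_hull.
have cL : closed_under E (legal_part X) by apply: closed_legal_part.
have uX : inner u \in X by rewrite in_setU self_hull.
have vX : inner v \in X by rewrite in_setU self_hull orbT.
have vL : inner v \in legal_part X.
  rewrite vE; apply/mem_legal_part; rewrite -vE; split=> // b.
  rewrite in_setU => /orP[|/(good_sibling gv)//]; rewrite !inE => /orP[sb|ub].
    by apply: good_sibling gv _; rewrite !inE sb.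
  by have := nosib b; rewrite ub andbT negbK => /eqP.
have uL : inner u \in legal_part X.
  rewrite uE; apply/mem_legal_part; rewrite -uE; split=> // b.
  rewrite in_setU => /orP[/(good_sibling gu)//|]; rewrite !inE => /orP[sb|vb].
    by apply: good_sibling gu _; rewrite !inE sb.
  have /mem_legal_part[_ one] := connect_in_closed cL vL vb.
  by rewrite (one u.2) // -uE.
have sL : source \in legal_part X.
  by apply: source_legal_part; rewrite in_setU source_hull.
have lX : legal X.
  apply: legal_sub (legal_legal_part (X := X)).
  by rewrite subUset !hull_sub.
exists (unpsi X); rewrite !vle_psi !psi_irr // psi_unpsi //.
by rewrite subsetUl subsetUr.
Qed.

(** A legal set has at most one vertex in each of the n blocks; the one further
    vertex is the source. *)
Lemma card_reached v : good_vertex v -> #|reached (inner v)| <= n.+1.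
Proof.
move=> gv; have lv := legal_hull gv.
pose blk (s : V) : option 'I_n := if s is Some (Some w) then Some w.1 else None.
rewrite -(card_in_imset (f := blk)); last first.
  have in_hull s : s \in reached (inner v) -> s \in hull v by rewrite in_setU orbC => ->.
  have /andP[_ tv] := st_cut_hull gv.
  move=> [[[i a]|]|] [[[j b]|]|] /in_hull sv /in_hull wv //= => [[ij]||].
  - by subst j; rewrite (lv i a b).
  - by rewrite -[Some None]/sink (negPf tv) in sv.
  - by rewrite -[Some None]/sink (negPf tv) in wv.
by apply: leq_trans (max_card _) _; rewrite card_option card_ord.
Qed.

End Reachability.
End Combinatorics.

(** * The program *)

Definition finish :=
  CNSet 0 1 (get var_ords) ;; CNSet 0 2 (get var_incs) ;; CNSet 0 0 (get var_count).

Definition analyse := residual ;; label ;; out ;; finish.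

(** The caller of the maximum flow program works in the arrays below [arr_flow0] and
    leaves all the others to it. *)
Definition pip_program maxflow := setup ;; cshift arr_flow0 maxflow ;; analyse.

Section Analyse.
Variable R : realType.
Implicit Types s : state R.

Definition lists_pairs s len a b (P : nat * nat -> Prop) :=
  forall p, p \in [seq (nmem s a j, nmem s b j) | j <- iota 0 len] <-> P p.

Lemma stored_lists s s' a b c len P :
  stored s a b c P -> len = nmem s c 0 ->
  (forall i, nmem s' a i = nmem s a i) -> (forall i, nmem s' b i = nmem s b i) ->
  lists_pairs s' len a b P.
Proof.
move=> [l [sz nl lP]] -> a' b' p; rewrite -lP sz.
suff -> : [seq (nmem s' a j, nmem s' b j) | j <- iota 0 (size l)] = l by [].
apply: (@eq_from_nth _ (0, 0)); rewrite ?size_map ?size_iota // => i il.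
by rewrite (nth_map 0) ?size_iota // nth_iota // add0n a' b' nl.
Qed.

Definition analyse_cost k n m :=
  500 * (m + 1) + (3 + n * k) * (3000 * (2 * m + k + 1) + 22) +
  (2 + n * k) * (100 + 2000 * k) + 1000 * k * n.+1 * (2 * m) + 200.

Lemma analyse_correct s0 k n m (reach : rel nat) :
  let L := 2 + n * k in
  let adj := targets (residual_arcs s0 m m) in
  nmem s0 0 0 = k -> nmem s0 0 2 = m -> nmem s0 var_L 0 = L ->
  (forall a i, 9 <= a < arr_flow0 -> nmem s0 a i = 0) ->
  (forall u w, reach u w -> w < L) -> (forall u, u < L -> reach u u) ->
  (forall u w x, reach u w -> x \in adj w -> reach u x) ->
  (forall (C : pred nat) u w,
     (forall a b, C a -> b \in adj a -> C b) -> C u -> reach u w -> C w) ->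
  (forall v (q : seq nat), good k reach v -> uniq q -> q =i reach v -> size q <= n.+1) ->
  wp analyse s0 (analyse_cost k n m) (fun s' =>
    [/\ nmem s' 0 0 = elt_index k reach L,
        lists_pairs s' (nmem s' 0 1) 1 2
          (fun p => exists v w, [/\ v < L, w < L & ord_pair k reach v w p])
      & lists_pairs s' (nmem s' 0 2) 3 4
          (fun p => exists v w b, [/\ v < L, w < L, b < k & inc_pair k reach v w b p])]).
Proof.
move=> L adj k0 m0 l0 z0 rlt rrefl rstep rleast gsz.
have na : narcs L adj <= 2 * m.
  by apply: leq_trans (narcs_targets _ _) _; rewrite mul2n size_residual_arcs.
apply: (wp_weak (T := _) (Q := _) _ _ (fun _ h => h)).
  apply: wp_seq_cost.
    by apply: wp_frame; apply: (residual_correct (m := m) L m0) => [|| u]; rewrite z0.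
  move=> s1 [adj1 fr1 _]; have z1 a i : 14 <= a < arr_flow0 -> nmem s1 a i = 0.
    move=> /andP[a1 a2]; rewrite fr1 ?z0 ?(leq_trans _ a1) //.
    by rewrite /= !inE; apply/negP; lia.
  apply: wp_seq_cost.
    apply: wp_frame; apply: (label_correct (n := n) (adj := adj) erefl rlt rrefl rstep rleast _ _ adj1);
      by [rewrite fr1 | move=> u; apply: z1 | apply: z1].
  move=> s2 [inv fr2 _]; apply: wp_seq_cost.
    apply: (out_correct (adj := adj) erefl rlt rleast gsz) inv => //.
    - by rewrite fr2 // fr1.
    - by rewrite fr2 // fr1.
    - by rewrite fr2 // z1.
    - by rewrite fr2 // z1.
  move=> s3 [st1 st2 c3]; apply: wp_run => //.
  have [_ _ _ _ [c2 _]] := inv.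
  split; [by rewrite /= c3 c2 | |].
    by apply: stored_lists st1 _ _ _.
  by apply: stored_lists st2 _ _ _.
rewrite /analyse_cost /for_overhead /=.
have : (L.+1 * (3000 * (narcs L adj + k + 1) + 22)) <= (3 + n * k) * (3000 * (2 * m + k + 1) + 22).
  by apply: leq_mul => //; lia.
have : 1000 * k * n.+1 * narcs L adj <= 1000 * k * n.+1 * (2 * m) by rewrite leq_mul2l na orbT.
rewrite -/L; lia.
Qed.

End Analyse.

(** * Infinite capacities *)

Section Network.
Variables (R : realType) (n k : nat) (N : network R ('I_n * 'I_k)%type).
Local Notation V := (vertex ('I_n * 'I_k)%type).
Implicit Types (X : {set V}) (e : V * V).

(** Larger than the capacity of every cut without infinite arcs, so that replacing
    infinite capacities by this number keeps the finite minimum cuts. *)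
Definition big_cap : R := (1 + \sum_(e <- arcs N) fine (cap N e))%R.

Definition cap_fin e : \bar R := if cap N e == +oo%E then (big_cap%:E)%E else cap N e.

Definition cut_fin X : \bar R :=
  (\sum_(e <- arcs N | (e.1 \in X) && (e.2 \notin X)) cap_fin e)%E.

Definition cut_fin_min X := forall X', st_cut X' -> (cut_fin X <= cut_fin X')%E.

Definition cuts_infinite X :=
  has (fun e => [&& cap N e == +oo%E, e.1 \in X & e.2 \notin X]) (arcs N).

Lemma fine_cap_ge0 e : e \in arcs N -> (0 <= fine (cap N e))%R.
Proof. by move=> eN; apply/fine_ge0/cap_ge0. Qed.

Lemma big_cap_ge1 : (1 <= big_cap)%R.
Proof. by rewrite lerDl big_seq; apply: sumr_ge0 => e; apply: fine_cap_ge0. Qed.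

Lemma cap_fin_ge0 e : e \in arcs N -> (0 <= cap_fin e)%E.
Proof.
move=> eN; rewrite /cap_fin; case: ifP => _; last exact: cap_ge0.
by rewrite lee_fin (le_trans ler01) ?big_cap_ge1.
Qed.

Lemma cap_fin_num e : e \in arcs N -> cap_fin e \is a fin_num.
Proof.
move=> eN; rewrite /cap_fin; case: ifP => // /negbT capN.
by rewrite ge0_fin_numE ?cap_ge0 // lt_neqAle capN leey.
Qed.

Lemma cut_fin_lt X : ~~ cuts_infinite X ->
  cut_fin X = cut_cap N X /\ (cut_fin X < big_cap%:E)%E.
Proof.
move=> /hasPn fin; have capE e : e \in arcs N -> (e.1 \in X) && (e.2 \notin X) ->
    cap_fin e = cap N e /\ cap N e = ((fine (cap N e))%:E)%E.
  move=> eN eX; have := fin e eN; rewrite eX andbT /cap_fin => capN.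
  by rewrite (negPf capN) fineK // ge0_fin_numE ?cap_ge0 // lt_neqAle capN leey.
split.
  rewrite /cut_fin /cut_cap big_seq_cond [RHS]big_seq_cond.
  by apply: eq_bigr => e /andP[eN eX]; have [] := capE e eN eX.
have -> : cut_fin X =
    ((\sum_(e <- arcs N | (e.1 \in X) && (e.2 \notin X)) fine (cap N e))%:E)%E.
  rewrite -sumEFin /cut_fin big_seq_cond [RHS]big_seq_cond.
  by apply: eq_bigr => e /andP[eN eX]; have [-> {1}->] := capE e eN eX.
rewrite lte_fin /big_cap ltr_pwDl // [leRHS](bigID (fun e => (e.1 \in X) && (e.2 \notin X))) /=.
by rewrite lerDl big_seq_cond; apply: sumr_ge0 => e /andP[eN _]; apply: fine_cap_ge0.
Qed.

Lemma cut_fin_ge X : cuts_infinite X ->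
  cut_cap N X = +oo%E /\ (big_cap%:E <= cut_fin X)%E.
Proof.
move=> /hasP[e0 e0N /andP[/eqP cap0 e0X]].
have term_le (F : V * V -> \bar R) : (forall e, e \in arcs N -> (0 <= F e)%E) ->
    (F e0 <= \sum_(e <- arcs N | (e.1 \in X) && (e.2 \notin X)) F e)%E.
  move=> F0; rewrite -big_filter (bigD1_seq e0) ?filter_uniq ?arcs_uniq //=; last first.
    by rewrite mem_filter e0X.
  apply: leeDl; rewrite big_seq_cond; apply: sume_ge0 => e.
  by rewrite mem_filter => /andP[/andP[_ /F0]].
split; last by have := term_le cap_fin cap_fin_ge0; rewrite {1}/cap_fin cap0 eqxx.
by have := term_le (cap N) (@cap_ge0 _ _ N); rewrite cap0 leye_eq => /eqP.
Qed.

Lemma cut_fin_le X : (cut_fin X <= cut_cap N X)%E.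
Proof.
case: (boolP (cuts_infinite X)) => [/cut_fin_ge[-> _]|/cut_fin_lt[-> _] //].
exact: leey.
Qed.

(** Cuts with an infinite arc have at least the capacity [big_cap] after the
    replacement, so X0 shows that they are minimal neither before nor after it. *)
Lemma min_cut_fin X0 X : st_cut X0 -> cut_fin_min X0 -> ~~ cuts_infinite X0 -> st_cut X ->
  cut_fin_min X <-> forall X', st_cut X' -> (cut_cap N X <= cut_cap N X')%E.
Proof.
move=> st0 min0 /cut_fin_lt[eq0 lt0] stX.
have fin_of : (cut_fin X < big_cap%:E)%E -> cut_fin X = cut_cap N X.
  by case: (boolP (cuts_infinite X)) => [/cut_fin_ge[_ ge]|/cut_fin_lt[]//]; rewrite ltNge ge.
split=> minX X' stX'.
  rewrite -fin_of; last exact: le_lt_trans (minX _ st0) lt0.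
  exact: le_trans (minX _ stX') (cut_fin_le _).
have le0 := minX _ st0; rewrite -eq0 in le0.
by apply: le_trans (cut_fin_le X) _; apply: le_trans le0 (min0 _ stX').
Qed.

Lemma all_cuts_infinite X0 X : cut_fin_min X0 -> cuts_infinite X0 -> st_cut X ->
  cut_cap N X = +oo%E.
Proof.
move=> min0 /cut_fin_ge[_ ge0] stX.
case: (boolP (cuts_infinite X)) => [/cut_fin_ge[] //|/cut_fin_lt[_]].
by rewrite ltNge (le_trans ge0 (min0 _ stX)).
Qed.

(** Minimizing over the legal cuts amounts to minimizing over all cuts, because
    passing to the legal part does not increase the capacity.  In the application E
    is the residual graph, or the graph without arcs if f is constantly infinite. *)
Lemma minimizers_closed (f : vec n k -> \bar R) (E : rel V) X0 :
  represents N f -> st_cut X0 -> cut_fin_min X0 ->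
  (cuts_infinite X0 -> forall u w, E u w = false) ->
  (~~ cuts_infinite X0 -> forall X, st_cut X -> cut_fin_min X <-> closed_under E X) ->
  [/\ forall x, x \in minimizers f <-> closed_under E (psi x),
      forall X, st_cut X -> closed_under E X -> closed_under E (legal_part X)
    & ~~ connect E source sink].
Proof.
move=> [[K fE] legal_le] st0 min0 infE finE.
case: (boolP (cuts_infinite X0)) => inf0.
  have noE := infE inf0; split=> [x|X _ _ u w|].
  - split=> _; first by move=> u w; rewrite noE.
    rewrite inE; apply/forallP => y; rewrite !fE.
    by rewrite !(all_cuts_infinite min0 inf0) ?st_cut_psi.
  - by rewrite noE.
  - by apply/negP => /connectP[[|v p]] //=; rewrite noE.
have closedE X (stX : st_cut X) := iff_trans (iff_sym (finE inf0 X stX))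
  (min_cut_fin st0 min0 inf0 stX).
split=> [x|X stX|].
- rewrite closedE ?st_cut_psi // inE; split=> [/forallP minx X stX|minx].
    have stL := st_cut_legal_part stX.
    have := minx (unpsi (legal_part X)); rewrite !fE leeD2rE //.
    rewrite psi_unpsi //; last exact: legal_legal_part.
    by move=> /le_trans; apply; apply: legal_le.
  by apply/forallP => y; rewrite !fE leeD2rE // minx ?st_cut_psi.
- move=> /(closedE _ stX) minX; apply/closedE; first exact: st_cut_legal_part.
  by move=> X' stX'; apply: le_trans (legal_le _ stX) (minX _ stX').
- have cl0 : closed_under E X0 by apply/finE.
  have /andP[s0 t0] := st0; apply: contra t0; exact: connect_in_closed cl0 s0.
Qed.

(** * The network given to the maximum flow program *)

Definition vnum (u : 'I_n * 'I_k) := u.1 * k + u.2.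

Lemma vnum_lt u : vnum u < k * n.
Proof.
case: u => i a; rewrite /vnum /= (leq_trans (n := i.+1 * k)) //.
  by rewrite mulSn addnC ltn_add2r.
by rewrite mulnC leq_mul2l ltn_ord orbT.
Qed.

Lemma vnum_inj : injective vnum.
Proof.
move=> [i a] [j b]; rewrite /vnum /= => e; have ka : 0 < k by case: a {e} => a'; lia.
have ij : val i = val j.
  by have := congr1 (divn^~ k) e; rewrite !divnMDl // !divn_small ?addn0 // ltn_ord.
by move: e; rewrite -[nat_of_ord j]ij => /addnI e; congr pair; apply: val_inj.
Qed.

(** The maximum flow program expects the inner vertices to be those of 'I_(k * n);
    the renaming respects the numbering of the vertices, so that both networks have
    the same arrays of tails and heads. *)
Definition vcopy (v : V) : vertex 'I_(k * n) :=
  match v with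
  | Some (Some u) => inner (Ordinal (vnum_lt u))
  | Some None => sink
  | None => source
  end.

Lemma vcopy_inj : injective vcopy.
Proof.
by move=> [[u|]|] [[w|]|] //= [] /vnum_inj ->.
Qed.

Lemma vcode_copy v : vcode (@nat_of_ord (k * n)) (vcopy v) = vcode vnum v.
Proof. by case: v => [[u|]|]. Qed.

Definition acopy e := (vcopy e.1, vcopy e.2).

Lemma acopy_inj : injective acopy.
Proof. by move=> [u w] [u' w'] [/vcopy_inj-> /vcopy_inj->]. Qed.

(** Searching for the preimage avoids the inverse of the renaming of vertices. *)
Definition cap_copy (e' : vertex 'I_(k * n) * vertex 'I_(k * n)) : \bar R :=
  if [pick e | acopy e == e'] is Some e then cap_fin e else 0%E.

Lemma cap_copyE e : cap_copy (acopy e) = cap_fin e.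
Proof.
rewrite /cap_copy; case: pickP => [e' /eqP/acopy_inj -> //|/(_ e)].
by rewrite eqxx.
Qed.

Definition net_copy : network R 'I_(k * n).
Proof.
refine (@Network _ _ [seq acopy e | e <- arcs N] cap_copy _ _).
  by rewrite (map_inj_uniq acopy_inj) arcs_uniq.
by move=> _ /mapP[e eN ->]; rewrite cap_copyE cap_fin_ge0.
Defined.

Lemma size_net_copy : size (arcs net_copy) = size (arcs N).
Proof. exact: size_map. Qed.

Lemma net_copy_finite : finite_network net_copy.
Proof. by move=> _ /mapP[e eN ->]; rewrite /= cap_copyE cap_fin_num. Qed.

Lemma cut_cap_copy Y : cut_cap net_copy Y = cut_fin (vcopy @^-1: Y).
Proof.
rewrite /cut_cap big_map /cut_fin.
by apply: eq_big => [e|e _]; [rewrite !inE | apply: cap_copyE].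
Qed.

Lemma st_cut_copy (Y : {set vertex 'I_(k * n)}) : st_cut (vcopy @^-1: Y) = st_cut Y.
Proof. by rewrite /st_cut !inE. Qed.

Lemma preim_copy X : vcopy @^-1: (vcopy @: X) = X.
Proof. by apply/setP => v; rewrite inE (mem_imset _ _ vcopy_inj). Qed.

Lemma min_cut_copy Y : min_cut net_copy Y ->
  st_cut (vcopy @^-1: Y) /\ cut_fin_min (vcopy @^-1: Y).
Proof.
move=> [stY minY]; split=> [|X' stX']; first by rewrite st_cut_copy.
have := minY (vcopy @: X'); rewrite !cut_cap_copy preim_copy; apply.
by rewrite -st_cut_copy preim_copy.
Qed.

(** Residual arcs only join copies of vertices, so closedness can be tested
    before the renaming. *)
Lemma closed_copy phi X : max_flow net_copy phi -> st_cut X ->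
  cut_fin_min X <->
  closed_under (fun u w => residual_rel net_copy phi (vcopy u) (vcopy w)) X.
Proof.
move=> max stX; have stY : st_cut (vcopy @: X) by rewrite -st_cut_copy preim_copy.
have minP := min_cutP net_copy_finite (vcopy @: X) max.
split=> [minX u w uw uX|cl].
  have [_ clY] : st_cut (vcopy @: X) /\ closed_under (residual_rel net_copy phi) (vcopy @: X).
    apply/minP; split=> // Y stY'; rewrite !cut_cap_copy preim_copy; apply: minX.
    by rewrite st_cut_copy.
  by have := clY _ _ uw; rewrite !(mem_imset _ _ vcopy_inj); apply.
have [] : min_cut net_copy (vcopy @: X); last first.
  move=> _ minY X' stX'; have := minY (vcopy @: X'); rewrite !cut_cap_copy !preim_copy; apply.
  by rewrite -st_cut_copy preim_copy.
apply/minP; split=> // u w uw /imsetP[u0 u0X uE].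
have [w0 wE] : exists w0, w = vcopy w0.
  by case/orP: uw => /andP[/mapP[[a b] _ [e1 e2]] _]; [exists b | exists a].
rewrite wE (mem_imset _ _ vcopy_inj); apply: cl u0X.
by rewrite -uE -wE.
Qed.

End Network.

(** * Numbered vertices *)

Section Codes.
Variables (n k : nat).
Local Notation V := (vertex ('I_n * 'I_k)%type).
Local Notation L := (2 + n * k).
Implicit Types (u v w : 'I_n * 'I_k) (s t : V).

Definition vertex_code : V -> nat := vcode (@vnum n k).

Lemma vertex_code_inj : injective vertex_code.
Proof. by move=> [[u|]|] [[w|]|] //= [] /vnum_inj->. Qed.

Lemma vertex_code_lt s : vertex_code s < L.
Proof. by case: s => [[u|]|] //=; rewrite mulnC; exact: vnum_lt. Qed.

Lemma vertex_code_surj c : 2 <= c < L -> exists v, c = vertex_code (inner v).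
Proof.
move=> /andP[c2 cL]; have k0 : 0 < k by case: (k) cL; lia.
have ic : (c - 2) %/ k < n by rewrite ltn_divLR; lia.
have ac : (c - 2) %% k < k by rewrite ltn_mod.
exists (Ordinal ic, Ordinal ac); rewrite /= /vnum /= -divn_eq; lia.
Qed.

Lemma vertex_code_block v b : block_start k (vertex_code (inner v)) + b = (v.1 * k + b).+2.
Proof.
rewrite /block_start /block_pos /= /vnum subn2 /= modnMDl modn_small ?ltn_ord //.
by rewrite -[_.+2]addn2 -addnBAC ?leq_addl // addnK addn2.
Qed.

Lemma vertex_code_sibling v (b : 'I_k) :
  block_start k (vertex_code (inner v)) + b = vertex_code (vtx v.1 b).
Proof. by rewrite vertex_code_block. Qed.

Variable G : seq (nat * nat).
Hypothesis G_lt : forall a b, (a, b) \in G -> a < L /\ b < L.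

Definition code_rel : rel V := fun s t => (vertex_code s, vertex_code t) \in G.

(** Reachability transported to numbers; it is empty outside of the range of
    vertex numbers. *)
Definition reach : rel nat := fun a b =>
  [exists s, exists t, [&& vertex_code s == a, vertex_code t == b & connect code_rel s t]].

Lemma reachP a b : reflect (exists s t, [/\ vertex_code s = a, vertex_code t = b & connect code_rel s t])
  (reach a b).
Proof.
apply: (iffP existsP) => [[s /existsP[t /and3P[/eqP sa /eqP tb st]]]|[s [t [sa tb st]]]].
  by exists s, t.
by exists s; apply/existsP; exists t; rewrite sa tb !eqxx.
Qed.

Lemma reach_code s t : reach (vertex_code s) (vertex_code t) = connect code_rel s t.
Proof.
apply/reachP/idP => [[s' [t' [/vertex_code_inj-> /vertex_code_inj->]]] //|st].
by exists s, t.
Qed.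

Lemma reach_lt a b : reach a b -> b < L.
Proof. by move=> /reachP[s [t [_ <- _]]]; apply: vertex_code_lt. Qed.

Lemma vertex_codeP c : c < L -> exists s, c = vertex_code s.
Proof.
case: c => [|[|c]] cL; first by exists source.
  by exists sink.
by have [] := @vertex_code_surj c.+2; rewrite ?cL // => v ->; exists (inner v).
Qed.

Lemma reach_refl a : a < L -> reach a a.
Proof. by move=> /vertex_codeP[s ->]; rewrite reach_code connect0. Qed.

Lemma reach_step a b c : reach a b -> c \in targets G b -> reach a c.
Proof.
rewrite mem_targets => /reachP[s [t [<- <- st]]] bc.
have [_ /vertex_codeP[r rE]] := G_lt bc; subst c; rewrite reach_code.
exact: connect_trans st (connect1 bc).
Qed.

Lemma reach_least (C : pred nat) a b :
  (forall a b, C a -> b \in targets G a -> C b) -> C a -> reach a b -> C b.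
Proof.
move=> cl Ca /reachP[s [t [sa tb st]]]; subst a b.
have := @connect_in_closed _ code_rel [set r | C (vertex_code r)] s t; rewrite !inE; apply=> //.
by move=> x y xy; rewrite !inE => /cl; apply; rewrite mem_targets.
Qed.

Lemma good_code v : good k reach (vertex_code (inner v)) = good_vertex code_rel v.
Proof.
have to_sink : reach (vertex_code (inner v)) 1 = connect code_rel (inner v) sink.
  exact: (reach_code _ sink).
have from_source t : reach 0 (vertex_code t) = connect code_rel source t.
  exact: (reach_code source).
have two : 2 <= vertex_code (inner v) by [].
rewrite /good /good_vertex two andTb to_sink from_source; congr [&& _, _ & _].
apply/allP/forallP => H.
  move=> b; have := H b; rewrite mem_iota add0n ltn_ord => /(_ isT).
  rewrite vertex_code_sibling from_source reach_code => /orP[|->]; last by rewrite orbT.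
  by move=> /eqP/vertex_code_inj[]; case: (v) => i a [->]; rewrite eqxx.
move=> c; rewrite mem_iota add0n => /andP[_ ck]; have := H (Ordinal ck).
have -> : block_start k (vertex_code (inner v)) + c = vertex_code (vtx v.1 (Ordinal ck)).
  exact: (vertex_code_sibling v (Ordinal ck)).
rewrite from_source reach_code.
by case/orP => [/eqP e|->]; rewrite ?orbT // e /vtx -surjective_pairing eqxx.
Qed.

Lemma good_inner c : good k reach c -> c < L -> exists2 v, c = vertex_code (inner v) & good_vertex code_rel v.
Proof.
move=> gc cL; have [|v cv] := @vertex_code_surj c; first by rewrite cL andbT; case/and4P: gc.
by exists v => //; rewrite -good_code -cv.
Qed.

Variable M : {set vec n k}.
Hypothesis mem_M : forall x, x \in M <-> closed_under code_rel (psi x).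
Hypothesis closed_legal_part : forall X,
  st_cut X -> closed_under code_rel X -> closed_under code_rel (legal_part X).
Hypothesis sink_unreachable : ~~ connect code_rel source sink.

Lemma good_size c (q : seq nat) :
  good k reach c -> uniq q -> q =i reach c -> size q <= n.+1.
Proof.
move=> gc uq qr; case: (ltnP c L) => [cL|Lc]; last first.
  case: q uq qr => // a q _ /(_ a); rewrite mem_head => /esym/reachP[s [t [sc]]].
  by have := vertex_code_lt s; rewrite sc ltnNge Lc.
have [v cv gv] := good_inner gc cL; subst c.
apply: leq_trans (card_reached closed_legal_part sink_unreachable gv).
rewrite cardE -(size_map vertex_code); apply: uniq_leq_size => // a.
rewrite qr => ra; have [s sa] := vertex_codeP (reach_lt ra); subst a.
by apply: map_f; rewrite mem_enum inE -reach_code.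
Qed.

Local Notation sel := (selected k reach).
Local Notation idx := (elt_index k reach).
Local Notation irr := (irr code_rel).
Local Notation PIP := (pip_rep M).

Lemma sel_good v : sel (vertex_code (inner v)) -> good_vertex code_rel v.
Proof. by rewrite -good_code => /andP[]. Qed.

Lemma irr_le_code u v : good_vertex code_rel u -> good_vertex code_rel v ->
  vle (irr v) (irr u) = reach (vertex_code (inner u)) (vertex_code (inner v)).
Proof.
by move=> gu gv; rewrite reach_code (irr_leE mem_M closed_legal_part sink_unreachable gu gv).
Qed.

(** Equal elements come from strongly connected vertices, of which only the least
    is selected. *)
Lemma sel_irr_inj u v : sel (vertex_code (inner u)) -> sel (vertex_code (inner v)) ->
  irr u = irr v -> u = v.
Proof.
move=> su sv uv; have gu := sel_good su; have gv := sel_good sv.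
have ruv : reach (vertex_code (inner u)) (vertex_code (inner v)) by rewrite -irr_le_code // uv vle_refl.
have rvu : reach (vertex_code (inner v)) (vertex_code (inner u)) by rewrite -irr_le_code // uv vle_refl.
have [lt|lt|/vertex_code_inj[]//] := ltngtP (vertex_code (inner u)) (vertex_code (inner v)).
  by case/andP: sv => _ /allP/(_ (vertex_code (inner u))); rewrite mem_iota add0n lt ruv rvu => /(_ isT).
by case/andP: su => _ /allP/(_ (vertex_code (inner v))); rewrite mem_iota add0n lt ruv rvu => /(_ isT).
Qed.

(** The least vertex v of a good strong component is selected. That another vertex
    of the component is good follows because it lies in the minimizer irr v. *)
Lemma exists_rep (p : PIP) : exists v, sel (vertex_code (inner v)) && (val p == irr v).
Proof.
have [v gv pv] := join_irreducible_irr mem_M closed_legal_part sink_unreachable (valP p).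
pose scc (u : 'I_n * 'I_k) := good_vertex code_rel u && (irr u == irr v).
have scc_v : scc v by rewrite /scc gv eqxx.
have [u /andP[gu /eqP uv] minu] := arg_minnP (fun u => vertex_code (inner u)) scc_v.
exists u; rewrite pv uv eqxx andbT /selected good_code gu andTb.
apply/allP => a; rewrite mem_iota add0n => /andP[_ au]; apply/negP => /andP[rua rau].
have [s sa] := vertex_codeP (reach_lt rua); subst a; rewrite !reach_code in rua rau.
have [w sw] : exists w, s = inner w.
  case: s rua rau {au} => [[w|]|] => [_ _|su _|_ su]; first by exists w.
    by case/and3P: gu => /negP[].
  by case/and3P: gu => _ /negP[].
subst s; have /negP[] : ~~ (vertex_code (inner u) <= vertex_code (inner w)) by rewrite -ltnNge.
have iuM := irr_M mem_M closed_legal_part sink_unreachable gu.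
have gw : good_vertex code_rel w.
  apply: (good_of_psi mem_M iuM).
    rewrite (psi_irr closed_legal_part sink_unreachable gu).
    by rewrite !inE rua orbT.
  case/and3P: gu => _ su _; apply: contra su => sw; exact: connect_trans sw rau.
apply: minu; rewrite /scc gw -uv; apply/eqP/vle_anti.
by rewrite !irr_le_code // !reach_code rua rau.
Qed.

Definition rep p := xchoose (exists_rep p).
(** The program numbers the elements in the order of their representatives. *)
Definition rank p := idx (vertex_code (inner (rep p))).

Lemma rep_sel p : sel (vertex_code (inner (rep p))).
Proof. by case/andP: (xchooseP (exists_rep p)). Qed.

Lemma rep_irr p : val p = irr (rep p).
Proof. by case/andP: (xchooseP (exists_rep p)) => _ /eqP. Qed.

Lemma sel_rep v : sel (vertex_code (inner v)) -> exists2 p : PIP, rep p = v & rank p = idx (vertex_code (inner v)).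
Proof.
move=> sv; have gv := sel_good sv.
pose p : PIP := exist _ (irr v) (irr_join_irreducible mem_M closed_legal_part sink_unreachable gv).
have pv : rep p = v by apply: sel_irr_inj (rep_sel p) sv _; rewrite -rep_irr.
by exists p; rewrite // /rank pv.
Qed.

Lemma elt_index_lt a b : sel a -> a < b -> idx a < idx b.
Proof.
move=> sa ab; have -> : b = a + (1 + (b - a.+1)) by lia.
by rewrite /elt_index iotaD count_cat /= add0n sa add1n addnS ltnS leq_addr.
Qed.

Lemma rank_inj : injective rank.
Proof.
move=> p q; rewrite /rank => e; apply: val_inj; rewrite !rep_irr; congr irr.
have [lt|lt|/vertex_code_inj[]//] := ltngtP (vertex_code (inner (rep p))) (vertex_code (inner (rep q))).
  by have := elt_index_lt (rep_sel p) lt; rewrite e ltnn.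
by have := elt_index_lt (rep_sel q) lt; rewrite e ltnn.
Qed.

Lemma card_pip : #|PIP| = idx L.
Proof.
rewrite card_sig; pose S := [set v : 'I_n * 'I_k | sel (vertex_code (inner v))].
have -> : #|[pred x | x \in join_irreducibles M]| = #|[set irr v | v in S]|.
  apply: eq_card => x; rewrite -[LHS]/(x \in join_irreducibles M).
  apply/idP/imsetP => [xI|[v]].
    pose p : PIP := exist _ x xI; exists (rep p); first by rewrite inE rep_sel.
    exact: (rep_irr p).
  rewrite inE => /sel_good gv ->.
  exact: irr_join_irreducible.
rewrite card_in_imset; last by move=> u v; rewrite !inE; apply: sel_irr_inj.
rewrite cardE -(size_map (fun v => vertex_code (inner v))) /elt_index -size_filter.
apply: perm_size; apply: uniq_perm.
- by rewrite map_inj_uniq ?enum_uniq // => u v /vertex_code_inj[].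
- by rewrite filter_uniq // iota_uniq.
move=> c; rewrite mem_filter mem_iota add0n; apply/mapP/andP => [[v]|[sc /= cL]].
  by rewrite mem_enum inE => sv ->; rewrite vertex_code_lt.
have [|v cv _] := @good_inner c _ cL; first by case/andP: sc.
by exists v; rewrite // mem_enum inE -cv.
Qed.

Lemma rank_lt p : rank p < #|PIP|.
Proof. by rewrite card_pip; apply: elt_index_lt (rep_sel p) (vertex_code_lt _). Qed.

Lemma ord_pair_rank a b :
  (exists (v w : nat), [/\ v < L, w < L & ord_pair k reach v w (a, b)]) <->
  exists p q : PIP, [/\ a = rank p, b = rank q & ple p q].
Proof.
split=> [[v [w [vL wL [sv rvw sw [-> ->]]]]]|[p [q [-> -> pq]]]].
  have [v' vv' _] := good_inner (proj1 (andP sv)) vL.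
  have [w' ww' _] := good_inner (proj1 (andP sw)) wL.
  subst v w; have [q qv <-] := sel_rep sv; have [p pw <-] := sel_rep sw.
  exists p, q; split=> //=; rewrite !rep_irr qv pw irr_le_code ?sel_good //.
exists (vertex_code (inner (rep q))), (vertex_code (inner (rep p))); rewrite !vertex_code_lt; split=> //.
split; try exact: rep_sel; last by [].
by rewrite -irr_le_code ?sel_good ?rep_sel // -!rep_irr.
Qed.

(** By symmetry of the inconsistency relation it does not matter which of the two
    elements the program takes the siblings from. *)
Lemma inc_pair_rank a b :
  (exists (v w c : nat), [/\ v < L, w < L, c < k & inc_pair k reach v w c (a, b)]) <->
  exists p q : PIP, [/\ a = rank p, b = rank q & pinc p q].
Proof.
split=> [[v [w [c [vL wL ck [sv rvw w2 [xw sx [-> ->]]]]]]]|[p [q [-> -> pq]]]].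
  have [v' vv' _] := good_inner (proj1 (andP sv)) vL.
  have [|w' ww'] := @vertex_code_surj w; first by rewrite w2 wL.
  subst v w; move: xw sx.
  have -> : block_start k (vertex_code (inner w')) + c = vertex_code (vtx w'.1 (Ordinal ck)).
    exact: (vertex_code_sibling w' (Ordinal ck)).
  move=> xw sx.
  have [q qv <-] := sel_rep sv; have [p pw <-] := sel_rep sx.
  exists p, q; split=> //=; rewrite vinc_sym !rep_irr qv pw.
  rewrite (irr_inc closed_legal_part sink_unreachable) ?sel_good //.
  apply/existsP; exists w'.2; rewrite /= /vtx -surjective_pairing -reach_code rvw andbT.
  by apply: contra xw => /eqP e; rewrite /vtx /= -e -surjective_pairing.
move: pq; rewrite /= vinc_sym !rep_irr.
rewrite (irr_inc closed_legal_part sink_unreachable) ?sel_good ?rep_sel //.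
move=> /existsP[d /andP[dp qd]]; set v := rep p in dp qd *.
exists (vertex_code (inner (rep q))), (vertex_code (vtx v.1 d)), v.2; rewrite !vertex_code_lt ltn_ord; split=> //.
have bE : block_start k (vertex_code (vtx v.1 d)) + v.2 = vertex_code (inner v).
  by rewrite (vertex_code_sibling (v.1, d) v.2); case: (v).
split; [exact: rep_sel | by rewrite reach_code | by [] | ].
rewrite bE; split; [ | exact: rep_sel | by []].
by apply: contra dp => /eqP/vertex_code_inj[]; case: (v) => i c /= [->].
Qed.

(** The ranks are distinct numbers below the number of elements, so the inverse
    of [rank] is the enumeration that the output format asks for. *)
Lemma pip_output_of (R : realType) (s : state R) :
  nmem s 0 0 = idx L ->
  lists_pairs s (nmem s 0 1) 1 2
    (fun p => exists (v w : nat), [/\ v < L, w < L & ord_pair k reach v w p]) ->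
  lists_pairs s (nmem s 0 2) 3 4
    (fun p => exists (v w c : nat), [/\ v < L, w < L, c < k & inc_pair k reach v w c p]) ->
  pip_output PIP s.
Proof.
move=> s0 ords incs; split; first by rewrite card_pip.
have [||g rankK gK] := @inj_card_bij _ _ (fun p => Ordinal (rank_lt p)).
- by move=> p q [] /rank_inj.
- by rewrite card_ord.
have rank_g i : rank (g i) = val i by have := congr1 val (gK i).
exists g; first by exists (fun p => Ordinal (rank_lt p)).
have image_rank (r : rel PIP) a b :
    ((a, b) \in [seq (val x.1, val x.2) |
        x in [pred x : 'I_#|PIP| * 'I_#|PIP| | r (g x.1) (g x.2)]]) <->
    exists p q, [/\ a = rank p, b = rank q & r p q].
  split=> [/imageP[[i j]]|[p [q [-> -> rpq]]]].
    by rewrite inE => rij [-> ->]; exists (g i), (g j); rewrite !rank_g.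
  apply/imageP; exists (Ordinal (rank_lt p), Ordinal (rank_lt q)) => //.
  by rewrite inE /= !rankK.
split=> -[a b]; apply/idP/idP.
- by move/ords/ord_pair_rank/image_rank.
- by move/image_rank/ord_pair_rank/ords.
- by move/incs/inc_pair_rank/image_rank.
- by move/image_rank/inc_pair_rank/incs.
Qed.

End Codes.

(** * Correctness and running time *)

Section Correctness.
Variables (R : realType) (n k : nat) (N : network R ('I_n * 'I_k)%type).
Local Notation V := (vertex ('I_n * 'I_k)%type).
Local Notation m := (size (arcs N)).
Local Notation s0 := (pip_input N).
Local Notation arc i := (nth (source, source) (arcs N) i : V * V).

Lemma input_tail i : i < m -> nmem s0 1 i = vertex_code (arc i).1.
Proof. by move=> im; rewrite /= (nth_map (source, source)). Qed.

Lemma input_head i : i < m -> nmem s0 2 i = vertex_code (arc i).2.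
Proof. by move=> im; rewrite /= (nth_map (source, source)). Qed.

Lemma input_infinite i : i < m -> (0 < nmem s0 3 i) = (cap N (arc i) == +oo%E).
Proof. by move=> im; rewrite /= (nth_map (source, source)) // lt0b. Qed.

Lemma input_cap i : i < m -> rmem s0 0 i = fine (cap N (arc i)).
Proof. by move=> im; rewrite /= (nth_map (source, source)). Qed.

Lemma sum_input_cap : (1 + \sum_(j < m) rmem s0 0 j)%R = big_cap N.
Proof.
congr (_ + _)%R; rewrite (big_nth (source, source)) big_mkord.
by apply: eq_bigr => i _; rewrite input_cap.
Qed.

(** The arrays from [arr_flow0] on hold exactly the input that the maximum flow
    program would receive for the finite copy of the network. *)
Lemma setup_simulates : wp setup s0 (200 * (k + m + 1)) (fun s =>
  [/\ simulates arr_flow0 (flow_input (net_copy N)) s, nmem s var_L 0 = 2 + n * k,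
      forall i, i < m -> rmem s arr_caps i = fine (cap_fin N (arc i))
    & nframe (nmod setup) s0 s]).
Proof.
apply: (wp_weak (wp_frame (setup_correct (k := k) (n := n) (m := m) _ _ _ _ _)) (leqnn _)) => //.
- by do 4 case=> //.
- by case.
move=> s [[ll d0 d12 r0] fr rf].
have caps i : i < m -> rmem s arr_caps i = fine (cap_fin N (arc i)).
  move=> im; rewrite (r0 i).2 sum_input_cap im input_infinite // input_cap //.
  by rewrite /cap_fin; case: ifP.
split=> //; last by rewrite ll mulnC addnC.
have default (l : seq nat) i (b : bool) : (b = false -> nth 0 l i = 0) ->
  (if b then nth 0 l i else 0) = nth 0 l i by case: b => // ->.
split=> [[|[|[|[|a]]]] i|[|a] i].
- by rewrite [LHS]d0 /= size_map.
- rewrite (d12 i).1 /= -map_comp default.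
    by congr nth; apply: eq_map => e; rewrite /= vcode_copy.
  by move=> /negbT; rewrite -leqNgt => mi; rewrite nth_default // size_map.
- rewrite (d12 i).2 /= -map_comp default.
    by congr nth; apply: eq_map => e; rewrite /= vcode_copy.
  by move=> /negbT; rewrite -leqNgt => mi; rewrite nth_default // size_map.
- rewrite fr //=; case: (ltnP i m) => im; last by rewrite nth_default // !size_map.
  rewrite -map_comp (nth_map (source, source)) //= cap_copyE.
  by have := cap_fin_num (mem_nth (source, source) im); case: cap_fin.
- by rewrite fr /= ?inE //; lia.
- rewrite [LHS](r0 i).1 /= -map_comp; case: (ltnP i m) => im.
    by rewrite caps // (nth_map (source, source)) //= cap_copyE.
  by rewrite (r0 i).2 ltnNge im /= nth_default // size_map.
- by rewrite rf /= ?inE //; lia.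
Qed.

Section AfterFlow.
Variables (s : state R) (phi : vertex 'I_(k * n) * vertex 'I_(k * n) -> R)
  (Y : {set vertex 'I_(k * n)}).
Hypothesis max_phi : max_flow (net_copy N) phi.
Hypothesis min_Y : min_cut (net_copy N) Y.
Hypothesis s_tail : forall i, i < m -> nmem s 1 i = vertex_code (arc i).1.
Hypothesis s_head : forall i, i < m -> nmem s 2 i = vertex_code (arc i).2.
Hypothesis s_inf : forall i, i < m -> (0 < nmem s 3 i) = (cap N (arc i) == +oo%E).
Hypothesis s_cap : forall i, i < m -> rmem s arr_caps i = fine (cap_fin N (arc i)).
Hypothesis s_flow : forall i, i < m -> rmem s arr_flow1 i = phi (acopy (arc i)).
Hypothesis s_cut : forall v : V, (0 < nmem s arr_flow4 (vertex_code v)) = (vcopy v \in Y).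

Local Notation X0 := (@vcopy n k @^-1: Y).
Local Notation G := (residual_arcs s m m).

(** The program tests the one minimum cut that it is given; for the replaced
    capacities all minimum cuts agree on whether they contain an infinite arc. *)
Lemma unboundedE : unbounded s m = cuts_infinite N X0.
Proof.
apply/hasP/hasP => [[i]|[e eN inf]].
  rewrite mem_iota add0n => /andP[_ im]; rewrite /crosses s_inf // s_tail // s_head // s_cut.
  rewrite -leqn0 leqNgt s_cut => c; exists (arc i); first exact: mem_nth.
  by rewrite !inE.
have im : index e (arcs N) < m by rewrite index_mem.
exists (index e (arcs N)); first by rewrite mem_iota.
rewrite /crosses s_inf // s_tail // s_head // s_cut -leqn0 leqNgt s_cut nth_index //.
by move: inf; rewrite !inE.
Qed.

Lemma residual_arcs_lt a b : (a, b) \in G -> a < 2 + n * k /\ b < 2 + n * k.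
Proof.
move=> /mem_residual_arcs[_ [i im]] [] [_ [-> ->]];
  by rewrite s_tail // s_head //; split; apply: vertex_code_lt.
Qed.

Lemma code_rel_residual u w : ~~ unbounded s m ->
  code_rel G u w = residual_rel (net_copy N) phi (vcopy u) (vcopy w).
Proof.
move=> ub.
have arcE a b : ((vcopy a, vcopy b) \in arcs (net_copy N)) = ((a, b) \in arcs N).
  by rewrite -[(vcopy a, _)]/(acopy (a, b)) (mem_map (@acopy_inj _ _)).
have capE a b : cap (net_copy N) (vcopy a, vcopy b) = cap_fin N (a, b).
  exact: (cap_copyE N (a, b)).
rewrite /code_rel /residual_rel !arcE capE; apply/mem_residual_arcs/orP => [[_ [i im]]|].
  have aN := mem_nth (source, source) im.
  rewrite s_cap // s_flow // s_tail // s_head //.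
  case: (arc i) aN => a b aN [] [lt [/vertex_code_inj-> /vertex_code_inj->]]; [left | right];
    by rewrite aN lt.
move=> c; split=> //; case: c => /andP[aN lt].
  have im : index (u, w) (arcs N) < m by rewrite index_mem.
  exists (index (u, w) (arcs N)) => //; left.
  by rewrite s_cap // s_flow // s_tail // s_head // nth_index.
have im : index (w, u) (arcs N) < m by rewrite index_mem.
exists (index (w, u) (arcs N)) => //; right.
by rewrite s_flow // s_tail // s_head // nth_index.
Qed.

Lemma minimizers_residual (f : vec n k -> \bar R) : represents N f ->
  [/\ forall x, x \in minimizers f <-> closed_under (@code_rel n k G) (psi x),
      forall X, st_cut X -> closed_under (@code_rel n k G) X ->
        closed_under (@code_rel n k G) (legal_part X)
    & ~~ connect (@code_rel n k G) source sink].
Proof.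
move=> repr; have [st0 min0] := min_cut_copy min_Y.
apply: (minimizers_closed repr st0 min0); rewrite -unboundedE => ub.
  by move=> u w; apply/mem_residual_arcs => -[]; rewrite ub.
move=> X stX; rewrite (closed_copy max_phi stX).
by split=> cl u w; [rewrite code_rel_residual | rewrite -code_rel_residual]; auto; apply: cl.
Qed.

End AfterFlow.

Lemma size_arcs_le : m <= (k * n).+2 * (k * n).+2.
Proof.
have <- : #|{: V * V}| = (k * n).+2 * (k * n).+2.
  by rewrite card_prod !card_option card_prod !card_ord mulnC.
by rewrite -(card_uniqP (arcs_uniq N)) max_card.
Qed.

(** Every term of the cost is at most a constant times k * n * m, unless
    k * n = 0, when the network has only the vertices s and t and hence at most
    four arcs. *)
Lemma cost_le c Q t : k <= m -> 0 < Q -> k * n * m <= c * Q -> t <= Q ->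
  200 * (k + m + 1) + (t + analyse_cost k n m).+1 < 300 * 1000 * (c + 1) * Q.
Proof.
move=> km Q0 cQ tQ; have CQ : 300 * 1000 * (c + 1) * Q = 300 * 1000 * (c * Q) + 300 * 1000 * Q.
  by rewrite -[_ * _ * Q]mulnA [(c + 1) * Q]mulnDl mul1n [X in X = _]mulnDr.
rewrite {}CQ; case: (posnP (k * n)) => kn.
  have := size_arcs_le; rewrite kn => m4; have kn1 : k * n.+1 = k by rewrite mulnS kn addn0.
  have kkm : k * m <= 4 * 4 by apply: leq_mul => //; apply: leq_trans km _.
  have -> : analyse_cost k n m = 500 * (m + 1) + 3 * (3000 * (2 * m + k + 1) + 22) +
      2 * (100 + 2000 * k) + 2000 * (k * m) + 200.
    by rewrite /analyse_cost -[1000 * k * n.+1]mulnA kn1 [n * k]mulnC kn; lia.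
  by move: (leq0n (c * Q)); lia.
have [k0 n0] : 0 < k /\ 0 < n by move: kn; rewrite muln_gt0 => /andP[].
have m0 : 0 < m by apply: leq_trans km.
have z1 : k * n <= k * n * m by rewrite leq_pmulr.
have z2 : m <= k * n * m by rewrite leq_pmull.
have z3 : k * n * k <= k * n * m by rewrite leq_mul2l km orbT.
have z4 : k * m <= k * n * m by rewrite leq_mul2r leq_pmulr ?orbT.
have -> : analyse_cost k n m = 500 * (m + 1) + 3 * 3000 * (2 * m + k + 1) + 66 +
    2 * 3000 * (k * n * m) + 3000 * (k * n * k) + 3022 * (k * n) + 2 * (100 + 2000 * k) +
    100 * (k * n) + 2000 * (k * n * k) + 2000 * (k * n * m) + 2000 * (k * m) + 200.
  rewrite /analyse_cost.
  have -> : (3 + n * k) * (3000 * (2 * m + k + 1) + 22) = 3 * 3000 * (2 * m + k + 1) + 66 +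
      2 * 3000 * (k * n * m) + 3000 * (k * n * k) + 3022 * (k * n) by nia.
  have -> : (2 + n * k) * (100 + 2000 * k) =
      2 * (100 + 2000 * k) + 100 * (k * n) + 2000 * (k * n * k) by nia.
  have -> : 1000 * k * n.+1 * (2 * m) = 2000 * (k * n.+1 * m).
    by move: n.+1 => n'; nia.
  have -> : k * n.+1 * m = k * n * m + k * m by rewrite mulnS mulnDl addnC.
  by lia.
by move: (k * n * m) (k * n * k) (k * n) (k * m) (c * Q) z1 z2 z3 z4 cQ kn => *; lia.
Qed.

End Correctness.

Theorem theorem16 (R : realType) (MF : nat -> nat -> nat) (maxflow : cmd)
    (hmaxflow : solves_max_flow R maxflow MF)
    (hMF : exists c : nat, forall n m : nat, n * m <= c * MF n m) :
  exists (prog : cmd) (C : nat),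
    forall (n k : nat) (f : vec n k -> \bar R) (N : network R ('I_n * 'I_k)%type),
      (forall x, f x <> -oo%E) ->
      k_submodular f ->
      represents N f ->
      k <= size (arcs N) ->
      exists (t : nat) (s : state R),
        [/\ exec prog (pip_input N) t s,
            t <= C * MF (k * n) (size (arcs N))
          & pip_output (pip_rep (minimizers f)) s].
Proof.
have [c cMF] := hMF; exists (pip_program maxflow), (300 * 1000 * (c + 1)).
move=> n k f N _ _ repr km.
have [t [sf [exf tMF [[phi max_phi phiE] [Y minY YE]]]]] := hmaxflow _ _ (@net_copy_finite R n k N).
rewrite size_net_copy in tMF phiE.
have t0 : 0 < t by case: exf.
suff [t' [s' [ex' le' out']]] : wp (pip_program maxflow) (pip_input N)
    (200 * (k + size (arcs N) + 1) + (t + analyse_cost k n (size (arcs N))).+1).+1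
    (pip_output (pip_rep (minimizers f))).
  exists t', s'; split=> //; apply: leq_trans le' _.
  apply: (cost_le (t := t)) => //; exact: leq_trans tMF.
apply: (wp_seq_cost (setup_simulates N)) => s1 [sim1 ll1 caps1 fr1].
have [s2 ex2 sim2] := exec_shift exf sim1.
have [fr2 rf2] := exec_frame ex2.
apply: (wp_seq_cost (Q1 := fun s => s = s2)); first by exists t, s2.
move=> _ ->.
have old a i : a < arr_flow0 -> nmem s2 a i = nmem s1 a i.
  by move=> aD; rewrite fr2 // nmod_shift.
have s_tail i : i < size (arcs N) -> nmem s2 1 i = vertex_code (nth (source, source) (arcs N) i).1.
  by move=> im; rewrite old // fr1 // input_tail.
have s_head i : i < size (arcs N) -> nmem s2 2 i = vertex_code (nth (source, source) (arcs N) i).2.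
  by move=> im; rewrite old // fr1 // input_head.
have s_inf i : i < size (arcs N) ->
    (0 < nmem s2 3 i) = (cap N (nth (source, source) (arcs N) i) == +oo%E).
  by move=> im; rewrite old // fr1 // input_infinite.
have s_cap i : i < size (arcs N) ->
    rmem s2 arr_caps i = fine (cap_fin N (nth (source, source) (arcs N) i)).
  by move=> im; rewrite rf2 ?rmod_shift // caps1.
have s_flow i : i < size (arcs N) ->
    rmem s2 arr_flow1 i = phi (acopy (nth (source, source) (arcs N) i)).
  move=> im; rewrite (sim2.2 1 i).
  have := congr1 (fun l => nth 0%R l i) phiE.
  rewrite (nth_map 0) ?size_iota // nth_iota // => ->.
  by rewrite (nth_map (source, source)) ?size_map // (nth_map (source, source)).
have s_cut v : (0 < nmem s2 arr_flow4 (vertex_code v)) = (vcopy v \in Y).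
  by rewrite (sim2.1 4) YE vcode_copy lt0n.
have [mem_M cl_legal no_sink] :=
  minimizers_residual max_phi minY s_tail s_head s_inf s_cap s_flow s_cut repr.
have G_lt := residual_arcs_lt s_tail s_head.
apply: (wp_weak (analyse_correct (k := k) (n := n) (m := size (arcs N))
  (reach := @reach n k (residual_arcs s2 (size (arcs N)) (size (arcs N))))
  _ _ _ _ _ _ _ _ _) (leqnn _)) => //.
- by rewrite old // fr1.
- by rewrite old // fr1.
- by rewrite old.
- move=> a i /andP[a9 aD]; rewrite old // fr1.
    by case: a a9 {aD} => [|[|[|[|a]]]].
  by rewrite /= !inE; lia.
- exact: reach_lt.
- exact: reach_refl.
- by move=> u w x; apply: reach_step.
- by move=> C u w; apply: reach_least.
- by move=> v q; apply: good_size.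
move=> s' [cnt ords incs].
exact: (pip_output_of mem_M cl_legal no_sink cnt ords incs).
Qed.
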